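(* When $G=\mathrm{SU}(n+1,1)$, $n\ge 2$, the action $l|_\Gamma$ of a standard subgroup $\Gamma$ of $G$ on $G/P$ by left translations is not $C^2$-locally rigid.
   Context: $G$ is (up to the usual identification) the group of orientation-preserving isometries of a rank one symmetric space of non-compact type (complex hyperbolic space). $G=KAN$ is a fixed Iwasawa decomposition, $M$ is the centralizer of $A$ in $K$, and $P=MAN$ is a minimal parabolic subgroup. $l:G\to\mathrm{Diff}(G/P)$ is the action by left translations. A subgroup $\Gamma\subset AN$ is a standard subgroup of $G=KAN$ if $\Gamma$ is generated by a lattice $\Lambda$ of $N$ and a nontrivial element $a\in A$ such that $a\Lambda a^{-1}\subset\Lambda$. The action $l|_\Gamma$ is $C^2$-locally rigid if every $C^\infty$ action $\rho:\Gamma\to\mathrm{Diff}(G/P)$ sufficiently $C^2$-close to $l|_\Gamma$ is conjugate to $l|_\Gamma$ by a $C^\infty$ diffeomorphism $h$ of $G/P$, i.e. $\rho(g)=h\circ l(g)\circ h^{-1}$ for all $g\in\Gamma$. $C^2$-closeness refers to the topology on $\mathrm{Hom}(\Gamma,\mathrm{Diff}(G/P))$ of pointwise convergence on $\Gamma$ (equivalently, on a finite generating set) induced by the $C^2$-topology on the group of $C^\infty$ diffeomorphisms. *)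

(* Defs.v *)
From HB Require Import structures.
From mathcomp Require Import all_boot all_order all_algebra complex.
From mathcomp Require Import all_classical all_reals all_analysis.
Set Implicit Arguments.
Unset Strict Implicit.
Unset Printing Implicit Defensive.
Import Order.TTheory GRing.Theory Num.Theory numFieldNormedType.Exports.
Local Open Scope classical_set_scope.
Local Open Scope ring_scope.
Local Open Scope complex_scope.
Local Open Scope sesquilinear_scope.

(* The ascription [numFieldType] gives the matrix space its usual topology. *)
Definition mat (R : realType) (n : nat) : Type := 'M[(R[i] : numFieldType)]_n.+2.
HB.instance Definition _ R n := NormedModule.on (mat R n).
HB.instance Definition _ R n := GRing.UnitRing.on (mat R n).

(** * The group SU(n+1,1) *)

(* The hermitian form |z_0|^2 + ... + |z_n|^2 - |z_(n+1)|^2. *)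
Definition Jform (R : realType) (n : nat) : mat R n :=
  diag_mx (\row_i (if i == ord_max then -1 else 1)).

Definition in_SU (R : realType) (n : nat) : pred (mat R n) :=
  fun g => (g^t* *m Jform R n *m g == Jform R n) && (\det g == 1).

Record SU (R : realType) (n : nat) := MkSU { SUval :> mat R n; _ : in_SU SUval }.

HB.instance Definition _ R n := [isSub for @SUval R n].
HB.instance Definition _ R n := [Choice of SU R n by <:].

Section SU_group.
Variables (R : realType) (n : nat).
Implicit Types g h : mat R n.

Fact in_SU1 : in_SU (1%:M : mat R n).
Proof. by rewrite /in_SU trmx1 map_mx1 mul1mx mulmx1 eqxx det1 eqxx. Qed.

Fact in_SUM g h : in_SU g -> in_SU h -> in_SU (g *m h : mat R n).
Proof.
move=> /andP[/eqP gJ /eqP g1] /andP[/eqP hJ /eqP h1]; apply/andP; split.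
  rewrite trmx_mul map_mxM -!mulmxA (mulmxA (Jform R n)) (mulmxA (g^t*)).
  by rewrite (mulmxA (g^t*)) gJ mulmxA hJ.
by rewrite det_mulmx g1 h1 mulr1.
Qed.

Fact in_SU_unit g : in_SU g -> g \in unitmx.
Proof. by move=> /andP[_ /eqP g1]; rewrite unitmxE g1 unitr1. Qed.

Fact in_SUV g : in_SU g -> in_SU (invmx g : mat R n).
Proof.
move=> gSU; have gu := in_SU_unit gSU.
move: gSU => /andP[/eqP gJ /eqP g1]; apply/andP; split.
  rewrite -{1}gJ -!mulmxA mulmxV// mulmx1 !mulmxA -map_mxM -trmx_mul.
  by rewrite mulmxV// trmx1 map_mx1 mul1mx.
by rewrite det_inv g1 invr1.
Qed.

Definition SU1 : SU R n := MkSU in_SU1.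
Definition SUM (g h : SU R n) : SU R n := MkSU (in_SUM (valP g) (valP h)).
Definition SUV (g : SU R n) : SU R n := MkSU (in_SUV (valP g)).

Fact SUMA : associative SUM.
Proof. by move=> g h k; apply: val_inj; rewrite /= mulmxA. Qed.
Fact SUM1l : left_id SU1 SUM.
Proof. by move=> g; apply: val_inj; rewrite /= mul1mx. Qed.
Fact SUM1r : right_id SU1 SUM.
Proof. by move=> g; apply: val_inj; rewrite /= mulmx1. Qed.
Fact SUMVl : left_inverse SU1 SUV SUM.
Proof. by move=> g; apply: val_inj; rewrite /= mulVmx// in_SU_unit// (valP g). Qed.
Fact SUMVr : right_inverse SU1 SUV SUM.
Proof. by move=> g; apply: val_inj; rewrite /= mulmxV// in_SU_unit// (valP g). Qed.

HB.instance Definition _ := isGroup.Build (SU R n) SUMA SUM1l SUM1r SUMVl SUMVr.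
HB.instance Definition _ := isPointed.Build (SU R n) SU1.
(* SU(n+1,1) carries the subspace topology of the matrix space. *)
HB.instance Definition _ :=
  Topological.copy (SU R n) (initial_topology (@SUval R n)).

End SU_group.

Section Iwasawa.
Variables (R : realType) (n : nat).
Local Notation mat := (mat R n).
Local Notation G := (SU R n).

Definition su (X : mat) : Prop :=
  X^t* *m Jform R n + Jform R n *m X = 0 /\ \tr X = 0.

(* Spans a maximal abelian subspace of the hermitian part of su(n+1,1); the
   restricted roots take the values 1 and 2 (and -1, -2) on it. *)
Definition Hmat : mat :=
  delta_mx (inord n) ord_max + delta_mx ord_max (inord n).

Definition root_space (c : R[i]) : set mat :=
  [set X | su X /\ Hmat *m X - X *m Hmat = c *: X].

Definition K0 : set G := [set g | (SUval g)^t* *m SUval g = 1%:M].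

(* exp(tH) = 1 + sinh(t) H + (cosh(t) - 1) H^2, because H^3 = H. *)
Definition A0 : set G := [set g | exists t : R,
  SUval g = 1%:M + ((expR t - expR (- t)) / 2)%:C *: Hmat
            + ((expR t + expR (- t)) / 2 - 1)%:C *: (Hmat *m Hmat)].

(* exp(X) = 1 + X + X^2/2, because X^3 = 0 when X lies in the sum of the root
   spaces for the roots 1 and 2. *)
Definition N0 : set G := [set g | exists Y Z : mat,
  [/\ root_space 1 Y, root_space 2%:R Z &
   SUval g = 1%:M + (Y + Z) + 2%:R^-1 *: ((Y + Z) *m (Y + Z))]].

Definition conj_set (x : G) (S : set G) : set G :=
  [set (x * s * x^-1)%g | s in S].

(* Any two Iwasawa decompositions of a semisimple group are conjugate. *)
Definition Iwasawa (K A N : set G) : Prop :=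
  exists x : G, [/\ K = conj_set x K0, A = conj_set x A0 & N = conj_set x N0].

Definition centralizer_in (K A : set G) : set G :=
  [set m | K m /\ forall a, A a -> (m * a = a * m)%g].

Definition minimal_parabolic (K A N : set G) : set G :=
  [set p | exists m a u,
    [/\ centralizer_in K A m, A a, N u & p = (m * a * u)%g]].

End Iwasawa.

Section Lattice.
Variables (R : realType) (n : nat).
Local Notation G := (SU R n).

Definition subgroup (S : set G) : Prop :=
  S 1%g /\ forall g h, S g -> S h -> S (g * h^-1)%g.

Definition generated (S : set G) : set G :=
  [set g | forall T : set G, subgroup T -> S `<=` T -> T g].

Definition discrete_subgroup (L : set G) : Prop :=
  subgroup L /\ exists U : set G, [/\ open U, U 1%g & U `&` L = [set 1%g]].

(* Borel subsets B of G such that BL = B. Those contained in N are the preimages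
   of the Borel subsets of N/L, so that a Borel measure on N/L is a measure
   on this sigma-algebra for which the complement of N is negligible. *)
Definition saturated_Borel (L : set G) : set (set G) :=
  [set B | <<s @open G >> B /\ forall g l, B g -> L l -> B (g * l)%g].

(* Discrete subgroup L such that N/L carries a nonzero finite N-invariant
   Borel measure. *)
Definition lattice (N L : set G) : Prop :=
  [/\ discrete_subgroup L, L `<=` N &
   exists mu : {measure set (g_sigma_algebraType (saturated_Borel L)) -> \bar R},
     [/\ mu (~` N) = 0%E, (0 < mu N < +oo)%E &
      forall x B, N x -> saturated_Borel L B ->
        mu [set (x * b)%g | b in B] = mu B]].

Definition standard_subgroup (A N Gamma : set G) : Prop :=
  exists (L : set G) (a : G),
    [/\ lattice N L, A a, a <> 1%g, conj_set a L `<=` L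
      & Gamma = generated (L `|` [set a])].

End Lattice.

Section Smooth.
Variables (R : realType) (n : nat).
Local Notation mat := (mat R n).
Implicit Types (F : mat -> R) (X V : mat).

(* Derivative in the direction V, along the real line X + tV. *)
Definition dir_derive V F : mat -> R :=
  fun X => derive1 (fun t : R => F (X + t%:C *: V)) 0.

Definition dir_derives (Vs : seq mat) F : mat -> R := foldr dir_derive F Vs.

Definition smooth_on (U : set mat) F : Prop :=
  forall (Vs : seq mat) X, U X ->
    {for X, continuous (dir_derives Vs F)} /\
    forall V, derivable (fun t : R => dir_derives Vs F (X + t%:C *: V)) 0 1.

Definition real_basis : set mat :=
  [set V | exists j k, V = delta_mx j k \/ V = 'i *: delta_mx j k].

End Smooth.

Section HomogeneousSpace.
Variables (R : realType) (n : nat).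
Local Notation G := (SU R n).

Definition left_coset (P : set G) (g : G) : set G := [set (g * p)%g | p in P].

Definition quotient (P : set G) : Type :=
  {X : set G | exists g, X = left_coset P g}.

Variable P : set G.

Definition coset_of (g : G) : quotient P :=
  exist _ (left_coset P g) (ex_intro _ g erefl).

Fact left_translate_subproof (g : G) (X : quotient P) :
  exists h, left_coset (sval X) g = left_coset P h.
Proof.
case: X => X [h eX] /=; rewrite eX; exists (g * h)%g; apply/seteqP; split.
  by move=> _ [_ [p Pp <-] <-]; exists p => //; rewrite mulgA.
by move=> _ [p Pp <-]; exists (h * p)%g; [exists p|rewrite mulgA].
Qed.

Definition left_translate (g : G) (X : quotient P) : quotient P :=
  exist _ (left_coset (sval X) g) (left_translate_subproof g X).

(* F extends the lift of f to G. *)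
Definition extends (f : quotient P -> R) (U : set (mat R n)) (F : mat R n -> R) :=
  [/\ open U, range (@SUval R n) `<=` U, smooth_on U F
    & forall g : G, F g = f (coset_of g)].

(* G is a closed submanifold of the matrix space and G -> G/P is a submersion:
   f is smooth iff its lift to G is, iff this lift has a smooth extension to a
   neighbourhood of G. *)
Definition smooth_fun (f : quotient P -> R) : Prop := exists U F, extends f U F.

Definition smooth_map (phi : quotient P -> quotient P) : Prop :=
  forall f, smooth_fun f -> smooth_fun (f \o phi).

Definition diffeo (phi : quotient P -> quotient P) : Prop :=
  exists psi, [/\ cancel phi psi, cancel psi phi, smooth_map phi & smooth_map psi].

(* The C^2-topology on smooth functions on G/P, as a quotient seminorm: K is
   compact and maps onto G/P, and f is C^2-small iff some extension of its lift
   has small 2-jet along K. *)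
Definition C2_small (K : set G) (eps : R) (f : quotient P -> R) : Prop :=
  exists U F, extends f U F /\
    forall k V W, K k -> real_basis V -> real_basis W ->
      [/\ `|F k| < eps, `|dir_derive V F k| < eps
        & `|dir_derive V (dir_derive W F) k| < eps].

(* Only the values of rho on Gamma matter. *)
Definition smooth_action (Gamma : set G) (rho : G -> quotient P -> quotient P) : Prop :=
  [/\ forall g, Gamma g -> diffeo (rho g), rho 1%g = id &
      forall g h, Gamma g -> Gamma h -> rho (g * h)%g = rho g \o rho h].

(* Basic neighbourhood of l|Gamma in Hom(Gamma, Diff(G/P)). The C^2-topology on
   Diff(G/P) is the coarsest one for which phi |-> f \o phi is continuous into
   the C^2-topology for each smooth function f. *)
Definition C2_close (K S : set G) (T : set (quotient P -> R)) (eps : R)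
    (rho : G -> quotient P -> quotient P) : Prop :=
  forall g f, S g -> T f ->
    C2_small K eps (fun x => f (rho g x) - f (left_translate g x)).

Definition C2_locally_rigid (K Gamma : set G) : Prop :=
  exists (S : set G) (T : set (quotient P -> R)) (eps : R),
    [/\ finite_set S, S `<=` Gamma, finite_set T, T `<=` smooth_fun & 0 < eps] /\
    forall rho, smooth_action Gamma rho -> C2_close K S T eps rho ->
      exists h h', [/\ cancel h h', cancel h' h, smooth_map h, smooth_map h' &
        forall g, Gamma g -> rho g = h \o left_translate g \o h'].

End HomogeneousSpace.

(* Main.v *)
Require Import Defs.
From HB Require Import structures.
From mathcomp Require Import all_boot all_order all_algebra complex ring lra.
From mathcomp Require Import perm.
From mathcomp Require Import all_classical all_reals all_analysis.
Set Implicit Arguments.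
Unset Strict Implicit.
Unset Printing Implicit Defensive.
Import Order.TTheory GRing.Theory Num.Theory numFieldNormedType.Exports.
Local Open Scope classical_set_scope.
Local Open Scope ring_scope.
Local Open Scope sesquilinear_scope.

(** The boundary G/P is the space of null lines of the hermitian form of
    signature (n+1,1).  Fix null vectors eP, eM with product 2 spanning the plane
    on which A acts by dilations; P is the stabilizer of the line of eP, the
    base point o, and the line of eM is written oo.  The group N is the
    Heisenberg group of pairs (z, t) with z orthogonal to eP and eM and
    t + t^* + |z|^2 = 0; its commutators are governed by the symplectic form
    Im <z, z'>.

    Deforming the action.  A real symplectic map of the z-space need not be
    unitary, yet it induces an automorphism of N once the real part of t is
    corrected, and it commutes with the dilations by A.  The transvections along
    u = i z, of parameter e, thus give endomorphisms beta_e of AN with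
    beta_0 = id ([betaM]), hence actions rho_e = l o beta_e of Gamma.  Each
    matrix beta_e(g) is a quadratic polynomial in e, derivatives depend linearly
    on their direction and K is compact, so rho_e tends to l in the
    C^2-topology ([near_C2], [rho_close]).

    The deformed actions are not conjugate to l.  Let h conjugate l to rho_e.
    Gamma contains an expanding element b of A, which beta_e fixes.  The only
    fixed points of b are o and oo ([A_fixed]), and h preserves each of them,
    because N fixes o and moves oo.  Therefore h(b^m g oo) = b^m beta_e(g) oo
    for g in Gamma.  If g = (z, t), the points b^m g oo tend to o along the curve
    th |-> (th z / 2t, th^2 / 4t) of the opposite Heisenberg group, th = al^-m,
    so the differential of h at o sends the direction z / 2t to w / 2t', where
    (w, t') = beta_e(z, t).  The lattice provides, over a fixed z, the points
    t_k = t + k s with s a nonzero imaginary number ([lattice_fibre]).  Writing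
    p = |z|^2, q = |w|^2 and s_k = Im t_k, which beta_e preserves, one has
    4 |t_k|^2 = p^2 + 4 s_k^2 and 4 |t_k'|^2 = q^2 + 4 s_k^2.  Testing the
    differential against Re <w, .> gives, by real linearity,
      (-p X - 2 s_k Y) / (p^2 + 4 s_k^2) = - q^2 / (q^2 + 4 s_k^2)
    for all k, with constants X and Y.  Such an identity forces p = q
    ([rational_rigid]).  But when u = i z the transvection multiplies |z|^2 by
    1 + 4 e^2 p^2, so q > p.

    The lattice enters through one property: it is not contained in the kernel
    of any nonzero character g |-> Im <u, z> ([lattice_not_in_hyperplane]).
    Applied twice, this gives a z != 0 and then an element that does not
    commute with it; s comes from their commutator. *)

(** * The hermitian form and the Heisenberg group *)

Section ConjRules.
Variable F : numClosedFieldType.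
Implicit Types x y : F.
Lemma conjDE x y : (x + y)^* = x^* + y^*. Proof. exact: rmorphD. Qed.
Lemma conjNE x : (- x)^* = - x^*. Proof. exact: rmorphN. Qed.
Lemma conjME x y : (x * y)^* = x^* * y^*. Proof. exact: rmorphM. Qed.
Lemma conj0E : 0^* = 0 :> F. Proof. exact: rmorph0. Qed.
Lemma conj1E : 1^* = 1 :> F. Proof. exact: rmorph1. Qed.
Lemma conjnE m : (m%:R)^* = m%:R :> F. Proof. exact: rmorph_nat. Qed.
Lemma conjVE x : (x^-1)^* = (x^*)^-1. Proof. exact: fmorphV. Qed.
Definition conjE := (conjDE, conjNE, conjME, conj0E, conj1E, conjnE, conjVE).
End ConjRules.

(** For C = R[i] this is [Jform].  The matrix identities are proved over an
    abstract closed field, where conversion cannot unfold the arithmetic of R. *)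
Definition formJ (C : numClosedFieldType) (n : nat) : 'M[C]_n.+2 :=
  diag_mx (\row_i (if i == ord_max then -1 else 1)).

Section Form.
Variables (C : numClosedFieldType) (n : nat).
Local Notation vec := 'cV[C]_n.+2.
Local Notation J := (formJ C n).
Implicit Types (u v w z : vec) (c t : C).

Definition hdot u v : C := (u^t* *m (J *m v)) 0 0.

Lemma hdotDl u v w : hdot (u + v) w = hdot u w + hdot v w.
Proof. by rewrite /hdot raddfD/= map_mxD mulmxDl mxE. Qed.
Lemma hdotDr u v w : hdot u (v + w) = hdot u v + hdot u w.
Proof. by rewrite /hdot !mulmxDr mxE. Qed.
Lemma hdotZl c u w : hdot (c *: u) w = c^* * hdot u w.
Proof. by rewrite /hdot linearZ/= map_mxZ -scalemxAl mxE. Qed.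
Lemma hdotZr c u w : hdot u (c *: w) = c * hdot u w.
Proof. by rewrite /hdot -!scalemxAr mxE. Qed.
Lemma hdotNl u w : hdot (- u) w = - hdot u w.
Proof. by rewrite -scaleN1r hdotZl !conjE mulN1r. Qed.
Lemma hdotNr u w : hdot u (- w) = - hdot u w.
Proof. by rewrite -scaleN1r hdotZr mulN1r. Qed.
Lemma hdot0l w : hdot 0 w = 0.
Proof. by rewrite -(scale0r w) hdotZl conj0E mul0r. Qed.
Lemma hdot0r w : hdot w 0 = 0.
Proof. by rewrite -(scale0r w) hdotZr mul0r. Qed.

Definition hdotlin := (hdotDl, hdotDr, hdotZl, hdotZr, hdotNl, hdotNr).

Lemma hdotE u v :
  hdot u v = \sum_i (u i 0)^* * ((if i == ord_max then -1 else 1) * v i 0).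
Proof.
rewrite /hdot mxE; apply: eq_bigr => i _; rewrite !mxE; congr (_ * _).
rewrite (bigD1 i)//= big1 ?addr0 => [|j ji]; last first.
  by rewrite !mxE [i == j]eq_sym (negbTE ji) mulr0n mul0r.
by rewrite !mxE eqxx mulr1n.
Qed.

Lemma hdotC u v : (hdot u v)^* = hdot v u.
Proof.
rewrite !hdotE rmorph_sum/=; apply: eq_bigr => i _.
rewrite !conjE conjCK; case: ifP => _; rewrite ?conjE; ring.
Qed.

Lemma outer_mul u v w : u *m (v^t* *m J) *m w = hdot v w *: u.
Proof.
rewrite -mulmxA -mulmxA [X in u *m X]mx11_scalar mul_mx_scalar.
by rewrite -/(hdot _ _).
Qed.

Lemma isom_hdot (g : 'M[C]_n.+2) u v :
  g^t* *m J *m g = J -> hdot (g *m u) (g *m v) = hdot u v.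
Proof.
move=> gJ; rewrite /hdot trmx_mul map_mxM.
by rewrite -{2}gJ !mulmxA.
Qed.

Lemma form_entry (A : 'M[C]_n.+2) i j :
  ((delta_mx i 0 : vec)^t* *m (A *m (delta_mx j 0 : vec))) 0 0 = A i j.
Proof.
rewrite -colE mxE (bigD1 i)//= big1 ?addr0 => [|k ki].
  by rewrite !mxE !eqxx conj1E mul1r.
by rewrite !mxE (negbTE ki) conj0E mul0r.
Qed.

Lemma hdot_isom (g : 'M[C]_n.+2) :
  (forall u v, hdot (g *m u) (g *m v) = hdot u v) -> g^t* *m J *m g = J.
Proof.
move=> gi; apply/matrixP => i j.
rewrite -[RHS]form_entry -/(hdot _ _) -gi -[LHS]form_entry /hdot.
by rewrite trmx_mul map_mxM !mulmxA.
Qed.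

Lemma mulmx_ext (A B : 'M[C]_n.+2) : (forall v, A *m v = B *m v) -> A = B.
Proof.
move=> AB; apply/matrixP => i j; have /matrixP/(_ i 0) := AB (delta_mx j 0).
by rewrite -!colE !mxE.
Qed.

(** The dominant and the contracted eigenvector of A.  They and the matrices
    below are locked so that unification treats them as atoms. *)
Definition eP : vec := locked (delta_mx (inord n) 0 + delta_mx ord_max 0).
Definition eM : vec := locked (delta_mx (inord n) 0 - delta_mx ord_max 0).

Lemma ePE : eP = delta_mx (inord n) 0 + delta_mx ord_max 0.
Proof. by rewrite /eP -lock. Qed.
Lemma eME : eM = delta_mx (inord n) 0 - delta_mx ord_max 0.
Proof. by rewrite /eM -lock. Qed.

Lemma inord_max : (inord n == ord_max :> 'I_n.+2) = false.
Proof. by apply/eqP => /(congr1 val); rewrite /= inordK// => /n_Sn. Qed.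

Lemma hdot_delta_l i v :
  hdot (delta_mx i 0) v = (if i == ord_max then -1 else 1) * v i 0.
Proof.
rewrite hdotE (bigD1 i)//= big1 ?addr0 => [|j ji].
  by rewrite mxE !eqxx rmorph1 mul1r.
by rewrite mxE (negbTE ji) conj0E mul0r.
Qed.

Lemma hdotP v : hdot eP v = v (inord n) 0 - v ord_max 0.
Proof.
by rewrite ePE hdotDl !hdot_delta_l inord_max eqxx mul1r mulN1r.
Qed.
Lemma hdotM v : hdot eM v = v (inord n) 0 + v ord_max 0.
Proof.
by rewrite eME hdotDl hdotNl !hdot_delta_l inord_max eqxx mul1r mulN1r opprK.
Qed.

Lemma eP_coord : eP (inord n) 0 = 1 /\ eP ord_max 0 = 1.
Proof.
by rewrite ePE !mxE !eqxx inord_max (eq_sym ord_max) inord_max addr0 add0r.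
Qed.
Lemma eM_coord : eM (inord n) 0 = 1 /\ eM ord_max 0 = -1.
Proof.
rewrite eME !mxE !eqxx inord_max (eq_sym ord_max) inord_max.
by rewrite oppr0 addr0 add0r.
Qed.
Lemma hdotPP : hdot eP eP = 0.
Proof. by case: eP_coord => a b; rewrite hdotP a b subrr. Qed.
Lemma hdotMM : hdot eM eM = 0.
Proof. by case: eM_coord => a b; rewrite hdotM a b subrr. Qed.
Lemma hdotPM : hdot eP eM = 2%:R.
Proof. by case: eM_coord => a b; rewrite hdotP a b opprK. Qed.
Lemma hdotMP : hdot eM eP = 2%:R.
Proof. by rewrite -hdotC hdotPM conjnE. Qed.
Definition hdote := (hdotPP, hdotMM, hdotPM, hdotMP).

Definition perp z := hdot eP z = 0 /\ hdot eM z = 0.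
Definition tang v : vec :=
  locked (v - (hdot eM v / 2) *: eP - (hdot eP v / 2) *: eM).

Lemma tang_perp v : perp (tang v).
Proof. by rewrite /perp /tang -lock; split; rewrite !hdotlin !hdote; field. Qed.

Lemma tangE v : v = tang v + (hdot eM v / 2) *: eP + (hdot eP v / 2) *: eM.
Proof. by rewrite /tang -lock; apply/colP => i; rewrite !mxE; ring. Qed.

Lemma perpC z : perp z -> hdot z eP = 0 /\ hdot z eM = 0.
Proof. by move=> [zP zM]; rewrite -hdotC zP -[hdot z eM]hdotC zM conj0E. Qed.

Lemma perp_coord z : perp z -> z (inord n) 0 = 0 /\ z ord_max 0 = 0.
Proof.
move=> []; rewrite hdotP hdotM => h1 h2.
have e : z (inord n) 0 = z ord_max 0 by apply/eqP; rewrite -subr_eq0 h1.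
move: h2; rewrite e -mulr2n => /eqP; rewrite mulrn_eq0/= => /eqP ->; by [].
Qed.

(** The negative direction of the form lies in the plane of eP and eM, so the
    form is the standard hermitian norm on the orthogonal complement. *)
Lemma perp_sqr z : perp z -> hdot z z = \sum_i `|z i 0| ^+ 2.
Proof.
move=> /perp_coord[_ zm]; rewrite hdotE; apply: eq_bigr => i _.
rewrite normCK; case: eqP => [->|_]; first by rewrite zm !mulr0 mul0r.
by rewrite mul1r mulrC.
Qed.

Lemma perp_ge0 z : perp z -> 0 <= hdot z z.
Proof. by move=> /perp_sqr ->; apply: sumr_ge0 => i _; rewrite exprn_ge0. Qed.

Lemma perp_eq0 z : perp z -> (hdot z z == 0) = (z == 0).
Proof.
move=> zp; apply/eqP/eqP => [|->]; last exact: hdot0r.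
rewrite perp_sqr// => /eqP; rewrite psumr_eq0 => [/allP z0|i _]; last first.
  by rewrite exprn_ge0.
apply/colP => i; have := z0 i; rewrite mem_index_enum => /(_ isT).
by rewrite sqrf_eq0 normr_eq0 mxE => /eqP.
Qed.

(** The exponential with horizontal coordinate z and central coordinate
    t + |z|^2 / 2 (see [exp_root]); the shift by |z|^2 / 2 makes the matrix affine
    in (z, z^*, t) and the product formula [nu_mul] short. *)
Definition nu z t : 'M[C]_n.+2 :=
  locked (1%:M + z *m (eP^t* *m J) - eP *m (z^t* *m J)
          + t *: (eP *m (eP^t* *m J))).

(** The equation of the Heisenberg group in the coordinates (z, t). *)
Definition hpt z t := perp z /\ t + t^* + hdot z z = 0.

Lemma nuE z t v :
  nu z t *m v = v + hdot eP v *: z - hdot z v *: eP + (t * hdot eP v) *: eP.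
Proof.
by rewrite /nu -lock !mulmxDl mulNmx -scalemxAl !outer_mul mul1mx scalerA.
Qed.

Lemma nuP z t : hpt z t -> nu z t *m eP = eP.
Proof.
move=> [/perpC[zP zM] _]; rewrite nuE !hdote zP mulr0 !scale0r subr0 !addr0 //.
Qed.

Lemma nuM z t : hpt z t -> nu z t *m eM = eM + 2 *: z + (2 * t) *: eP.
Proof.
move=> [/perpC[zP zM] _]; rewrite nuE !hdote zM scale0r subr0.
by rewrite [2 * t]mulrC.
Qed.

Lemma nu_mul z t z' t' : hpt z t -> hpt z' t' ->
  nu z t *m nu z' t' = nu (z + z') (t + t' - hdot z z').
Proof.
move=> [[zP zM] _] [[z'P z'M] _]; apply: mulmx_ext => v.
have [zP' zM'] := perpC (conj zP zM).
rewrite -mulmxA !nuE !hdotlin !hdote zP' z'P; apply/colP => i; rewrite !mxE.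
ring.
Qed.

Lemma hptM z t z' t' : hpt z t -> hpt z' t' -> hpt (z + z') (t + t' - hdot z z').
Proof.
move=> [[zP zM] e] [[z'P z'M] e']; split.
  by rewrite /perp !hdotlin zP zM z'P z'M addr0.
rewrite !hdotlin !conjE hdotC -[RHS]addr0 -{1}e -e'; ring.
Qed.

Lemma hpt0 : hpt 0 0.
Proof. by split; rewrite ?/perp ?hdot0r// conj0E !addr0. Qed.

Lemma nu0 : nu 0 0 = 1%:M.
Proof.
apply: mulmx_ext => v; rewrite nuE hdot0l mul0r !scale0r scaler0 mul1mx.
by rewrite subr0 !addr0.
Qed.

Lemma hptN z t : hpt z t -> hpt (- z) t^*.
Proof.
move=> [[zP zM] e]; split; first by rewrite /perp !hdotlin zP zM oppr0.
by rewrite !hdotlin conjCK opprK (addrC _ t).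
Qed.

Lemma nuNr z t : hpt z t -> nu z t *m nu (- z) t^* = 1%:M.
Proof.
move=> zt; rewrite nu_mul//; last exact: hptN.
by rewrite subrr hdotNr opprK; case: zt => _ ->; rewrite nu0.
Qed.

Lemma nu_form z t : hpt z t -> (nu z t)^t* *m J *m nu z t = J.
Proof.
move=> zt; have [zp tt] := zt.
have [zP zM] := zp; have [zP' zM'] := perpC zp.
apply: hdot_isom => u v.
have et : t^* = - t - hdot z z.
  by apply/eqP; rewrite -subr_eq0 -[X in _ == X]tt; apply/eqP; ring.
rewrite !nuE !hdotlin !hdote !conjE !hdotC ?conjCK zP zP' et; ring.
Qed.

End Form.

(** * Dilations and the opposite Heisenberg group *)

Section Dil.
Variables (C : numClosedFieldType) (n : nat).
Local Notation vec := 'cV[C]_n.+2.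
Local Notation J := (formJ C n).
Local Notation eP := (eP C n).
Local Notation eM := (eM C n).
Implicit Types (u v w z : vec) (a b c t : C).

Definition dil a : 'M[C]_n.+2 :=
  locked (1%:M + ((a - 1) / 2) *: (eP *m (eM^t* *m J))
               + ((a^-1 - 1) / 2) *: (eM *m (eP^t* *m J))).

Lemma dilE a v : dil a *m v =
  v + ((a - 1) / 2 * hdot eM v) *: eP + ((a^-1 - 1) / 2 * hdot eP v) *: eM.
Proof. by rewrite /dil -lock !mulmxDl -!scalemxAl !outer_mul mul1mx !scalerA. Qed.

Lemma dil_perp a z : perp z -> dil a *m z = z.
Proof. by move=> [zP zM]; rewrite dilE zP zM !mulr0 !scale0r !addr0. Qed.
Lemma dilP a : dil a *m eP = a *: eP.
Proof.
rewrite dilE !hdote; by apply/colP => i; rewrite !mxE; set b := a^-1; field.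
Qed.
Lemma dilM a : dil a *m eM = a^-1 *: eM.
Proof.
by rewrite dilE !hdote; apply/colP => i; rewrite !mxE; set b := a^-1; field.
Qed.

Lemma dil_mul a b : a != 0 -> b != 0 -> dil a *m dil b = dil (a * b).
Proof.
move=> a0 b0; apply: mulmx_ext => v; rewrite -mulmxA !dilE !hdotlin !hdote.
by apply/colP => i; rewrite !mxE; field; rewrite a0 b0.
Qed.

Lemma dil1 : dil 1 = 1%:M.
Proof.
apply: mulmx_ext => v; rewrite dilE invr1 subrr !mul0r !scale0r !addr0.
by rewrite mul1mx.
Qed.

Lemma dilV a : a != 0 -> dil a *m dil a^-1 = 1%:M.
Proof. by move=> a0; rewrite dil_mul ?invr_eq0// divff// dil1. Qed.

Lemma dil_form a : a != 0 -> a^* = a -> (dil a)^t* *m J *m dil a = J.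
Proof.
move=> a0 ar; apply: hdot_isom => u v; rewrite !dilE !hdotlin !hdote.
rewrite !conjE ar !hdotC.
by field; rewrite a0.
Qed.

Lemma hptZ a z t : a^* = a -> hpt z t -> hpt (a *: z) (a ^+ 2 * t).
Proof.
move=> ar [[zP zM] e]; split; first by rewrite /perp !hdotlin zP zM mulr0.
rewrite !hdotlin !conjE ar -[RHS](mulr0 (a ^+ 2)) -e; ring.
Qed.

Lemma dil_nu a z t : a != 0 -> a^* = a -> hpt z t ->
  dil a *m nu z t = nu (a *: z) (a ^+ 2 * t) *m dil a.
Proof.
move=> a0 ar [zp _]; have [zP zM] := zp; have [zP' zM'] := perpC zp.
apply: mulmx_ext => v.
rewrite -!mulmxA !nuE !dilE !hdotlin !hdote zP zM ar zP' zM'.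
by apply/colP => i; rewrite !mxE; field; rewrite a0.
Qed.

(** The unipotent matrix [nu z t] is a commutator of a dilation with another
    element of N, so its determinant is 1. *)
Lemma det_nu z t : hpt z t -> \det (nu z t) = 1.
Proof.
move=> zt; have [zp tt] := zt.
pose t' := (t - hdot z z) / 3%:R.
have zr : (hdot z z)^* = hdot z z by exact: hdotC.
have zt' : hpt z t'.
  split=> //; rewrite /t' !conjE zr.
  have -> : t^* = - t - hdot z z.
    by apply/eqP; rewrite -subr_eq0 -[X in _ == X]tt; apply/eqP; ring.
  by field.
(* t' solves t + t' - |z|^2 = 4 t', so that conjugating by the dilation of
   ratio 2 multiplies nu z t' by nu z t. *)
have e : nu z t *m (nu z t' *m dil 2) = dil 2 *m nu z t'.
  have n2 : (2 : C) != 0 by rewrite pnatr_eq0.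
  rewrite (dil_nu n2 (conjnE _ _) zt') mulmxA (nu_mul zt zt').
  have -> : z + z = 2 *: z by rewrite scaler_nat mulr2n.
  have -> // : t + t' - hdot z z = 2 ^+ 2 * t' by rewrite /t'; field.
have {}e := congr1 determinant e; rewrite !det_mulmx in e.
have d2 : \det (dil 2) != 0.
  apply/eqP => d0; have := congr1 determinant (dilV (a := 2) _).
  by rewrite det_mulmx d0 mul0r det1 pnatr_eq0 => /(_ isT) /esym/eqP; rewrite oner_eq0.
have d3 : \det (nu z t') != 0.
  apply/eqP => d0; have := congr1 determinant (nuNr zt').
  by rewrite det_mulmx d0 mul0r det1 => /esym/eqP; rewrite oner_eq0.
apply: (mulIf (mulf_neq0 d3 d2)); rewrite e; ring.
Qed.

Lemma JJ : J *m J = 1%:M.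
Proof.
rewrite /formJ mulmx_diag -diag_const_mx; congr diag_mx.
by apply/rowP => i; rewrite !mxE; case: ifP => _; rewrite ?mulrNN mulr1.
Qed.

Lemma mulJE v i : (J *m v) i 0 = (if i == ord_max then -1 else 1) * v i 0.
Proof. by rewrite /formJ mul_diag_mx !mxE. Qed.

Lemma JP : J *m eP = eM.
Proof.
apply/colP => i; rewrite mulJE ePE eME !mxE.
by case: eqP => [->|_]; rewrite ?inord_max ?(eq_sym ord_max) ?inord_max ?eqxx/= ?mulN1r ?mul1r ?opprK ?oppr0 ?addr0 ?subr0 ?opprD ?oppr0//.
Qed.

Lemma JM : J *m eM = eP.
Proof. by rewrite -JP mulmxA JJ mul1mx. Qed.

Lemma Jperp z : perp z -> J *m z = z.
Proof.
move=> /perp_coord[_ z0]; apply/colP => i; rewrite mulJE.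
by case: eqP => [->|_]; rewrite ?z0 ?mulr0 ?mul1r.
Qed.

Lemma hdotJ u v : hdot (J *m u) (J *m v) = hdot u v.
Proof.
rewrite !hdotE; apply: eq_bigr => i _; rewrite !mulJE !conjE.
by case: ifP => _; rewrite ?conjE; ring.
Qed.

Lemma hdotPJ v : hdot eP (J *m v) = hdot eM v.
Proof. by rewrite -JM hdotJ. Qed.
Lemma hdotMJ v : hdot eM (J *m v) = hdot eP v.
Proof. by rewrite -JP hdotJ. Qed.

Lemma dilJ a : J *m dil a *m J = dil a^-1.
Proof.
apply: mulmx_ext => v; rewrite -!mulmxA !dilE hdotPJ hdotMJ.
rewrite !mulmxDr -!scalemxAr JP JM mulmxA JJ mul1mx invrK.
by rewrite addrAC.
Qed.

(** J exchanges eP and eM, hence conjugates a dilation to its inverse; a dilation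
    is then a commutator, via a square root of its ratio. *)
Lemma det_dil a : a != 0 -> \det (dil a) = 1.
Proof.
move=> a0; pose b := sqrtC a; have b0 : b != 0 by rewrite sqrtC_eq0.
have -> : dil a = dil b *m (J *m dil b^-1 *m J).
  by rewrite dilJ invrK dil_mul// -expr2 sqrtCK.
have dJ : \det J * \det J = 1 by rewrite -det_mulmx JJ det1.
have db : \det (dil b) * \det (dil b^-1) = 1 by rewrite -det_mulmx dilV ?det1.
by rewrite !det_mulmx [_ * \det J]mulrAC dJ mul1r db.
Qed.

(** The opposite unipotent group, which fixes eM and moves eP. *)
Definition nv z t := locked (J *m nu z t *m J).

Lemma nvE z t v : perp z ->
  nv z t *m v = v + hdot eM v *: z - hdot z v *: eM + (t * hdot eM v) *: eM.
Proof.
move=> zp; rewrite /nv -lock -!mulmxA nuE hdotPJ -{2}(Jperp zp) hdotJ.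
by rewrite !mulmxDr mulmxN -!scalemxAr JP (Jperp zp) mulmxA JJ mul1mx.
Qed.

Lemma det_nv z t : hpt z t -> \det (nv z t) = 1.
Proof.
move=> zt; rewrite /nv -lock !det_mulmx det_nu// mulr1 -det_mulmx JJ det1 //.
Qed.

Lemma nv_form z t : hpt z t -> (nv z t)^t* *m J *m nv z t = J.
Proof.
move=> zt; apply: hdot_isom => u v; rewrite /nv -lock -!mulmxA hdotJ.
by rewrite (isom_hdot _ _ (nu_form zt)) hdotJ.
Qed.

Definition Hm : 'M[C]_n.+2 :=
  locked (delta_mx (inord n) ord_max + delta_mx ord_max (inord n)).

Lemma HmE v : Hm *m v = (hdot eM v / 2) *: eP - (hdot eP v / 2) *: eM.
Proof.
apply/colP => i; rewrite /Hm -lock mulmxDl !mxE.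
rewrite (bigD1 ord_max)//= big1 ?addr0 => [|k km]; last first.
  by rewrite mxE (negbTE km) andbF mul0r.
rewrite (bigD1 (inord n))//= big1 ?addr0 => [|k km]; last first.
  by rewrite mxE (negbTE km) andbF mul0r.
rewrite hdotM hdotP !mxE !eqxx !andbT ePE eME !mxE !andbT.
by field.
Qed.

(** 0, 1 and -1 are the only eigenvalues of H: a root vector of weight c shifts
    the H-weight by c, so many of its blocks vanish. *)
Lemma Hm_eigen c v : c ^+ 2 != 1 -> c != 0 -> Hm *m v = c *: v -> v = 0.
Proof.
move=> c1 c0 e; have := congr1 (hdot eM) e; have := congr1 (hdot eP) e.
rewrite HmE !hdotlin !hdote.
set p := hdot eP v; set m := hdot eM v => e1 e2.
have {}e1 : - p = c * p by rewrite -e1; field.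
have {}e2 : m = c * m by rewrite -e2; field.
have p0 : p = 0.
  apply/eqP; have : (c + 1) * p == 0 by rewrite mulrDl -e1 mul1r addNr.
  rewrite mulf_eq0 => /orP[|//]; rewrite addr_eq0 => /eqP ce.
  by move: c1; rewrite ce sqrrN expr1n eqxx.
have m0 : m = 0.
  apply/eqP; have : (c - 1) * m == 0 by rewrite mulrBl -e2 mul1r subrr.
  rewrite mulf_eq0 => /orP[|//]; rewrite subr_eq0 => /eqP ce.
  by move: c1; rewrite ce expr1n eqxx.
move: e; rewrite HmE -/p -/m p0 m0 mul0r !scale0r subrr => /esym/eqP.
by rewrite scaler_eq0 (negbTE c0)/= => /eqP.
Qed.

Lemma Hm_eigen1 v : Hm *m v = v -> v = (hdot eM v / 2) *: eP.
Proof.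
move=> e; have := congr1 (hdot eP) e.
rewrite HmE !hdotlin !hdote => e1.
have p0 : hdot eP v = 0.
  have {}e1 : - hdot eP v = hdot eP v by rewrite -[RHS]e1; field.
  move/eqP: e1; rewrite eq_sym -subr_eq0 opprK -mulr2n mulrn_eq0/=.
  by move/eqP.
by rewrite -[LHS]e HmE p0 mul0r scale0r subr0.
Qed.

Lemma Hm_eigen0 v : Hm *m v = 0 -> perp v.
Proof.
move=> e; have := congr1 (hdot eP) e; have := congr1 (hdot eM) e.
rewrite HmE !hdotlin !hdote !hdot0r => e1 e2; split.
  by rewrite -[RHS]oppr0 -[in RHS]e2; field.
by rewrite -[RHS]e1; field.
Qed.

Definition skewJ (X : 'M[C]_n.+2) := X^t* *m J + J *m X = 0.

Lemma skew_hdot X u v : skewJ X -> hdot (X *m u) v + hdot u (X *m v) = 0.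
Proof.
move=> sk; rewrite /hdot trmx_mul map_mxM.
have -> : u^t* *m X^t* *m (J *m v) = u^t* *m (X^t* *m J) *m v.
  by rewrite !mulmxA.
have -> : u^t* *m (J *m (X *m v)) = u^t* *m (J *m X) *m v by rewrite !mulmxA.
have := congr1 (fun A : 'M[C]_n.+2 => (u^t* *m A *m v) 0 0) sk.
rewrite mulmxDr mulmxDl mulmx0 mul0mx => e.
by rewrite mxE in e; rewrite e mxE.
Qed.

Lemma hdot_skew X :
  (forall u v, hdot (X *m u) v + hdot u (X *m v) = 0) -> skewJ X.
Proof.
move=> h; apply/matrixP => i j; rewrite [RHS]mxE -(h (delta_mx i 0) (delta_mx j 0)).
rewrite -[LHS]form_entry /hdot trmx_mul map_mxM mulmxDl mulmxDr mxE.
by rewrite !mulmxA.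
Qed.

Definition heisY z : 'M[C]_n.+2 :=
  locked (z *m (eP^t* *m J) - eP *m (z^t* *m J)).
Definition heisZ t : 'M[C]_n.+2 := locked (t *: (eP *m (eP^t* *m J))).

Lemma heisYE z v : heisY z *m v = hdot eP v *: z - hdot z v *: eP.
Proof. by rewrite /heisY -lock mulmxDl mulNmx !outer_mul. Qed.
Lemma heisZE t v : heisZ t *m v = (t * hdot eP v) *: eP.
Proof. by rewrite /heisZ -lock -scalemxAl outer_mul scalerA. Qed.

(** Weights determine a root vector X of weight 1: it sends eP (weight 1) to
    weight 2, hence to 0, the weight 0 space to the line of eP, and eM to
    weight 0.  Skewness ties the last two blocks together. *)
Lemma heisY_inv X : skewJ X -> Hm *m X - X *m Hm = 1 *: X ->
  exists2 z, perp z & X = heisY z.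
Proof.
move=> sk; rewrite scale1r => e.
have act v : Hm *m (X *m v) = X *m v + X *m (Hm *m v).
  rewrite !mulmxA -mulmxDl; congr (_ *m _).
  by apply/eqP; rewrite -subr_eq e.
have XP : X *m eP = 0.
  apply: (@Hm_eigen 2%:R); rewrite ?pnatr_eq0//.
    by rewrite -natrX pnatr_eq1.
  rewrite act HmE !hdote mul0r scale0r subr0 divff ?pnatr_eq0// scale1r.
  by rewrite scaler_nat mulr2n.
have Xperp v : perp v -> X *m v = (hdot eM (X *m v) / 2) *: eP.
  move=> [vP vM]; apply: Hm_eigen1.
  by rewrite act HmE vP vM mul0r !scale0r subrr mulmx0 addr0.
have XM : perp (X *m eM).
  apply: Hm_eigen0; rewrite act HmE !hdote mul0r scale0r sub0r.
  by rewrite divff ?pnatr_eq0// scale1r mulmxN subrr.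
exists (2^-1 *: (X *m eM)).
  by case: XM => a b; rewrite /perp !hdotlin a b mulr0.
apply: mulmx_ext => v; rewrite heisYE {1}[v]tangE !mulmxDr -!scalemxAr XP scaler0.
rewrite addr0 Xperp; last exact: tang_perp.
have := skew_hdot (tang v) eM sk.
have h2 : hdot eM (X *m tang v) = (hdot (X *m tang v) eM)^* by rewrite hdotC.
have h3 : hdot (X *m eM) v = hdot (X *m eM) (tang v).
  by have [xP xM] := perpC XM; rewrite {1}[v]tangE !hdotlin xP xM !mulr0 !addr0.
move=> h1; have {}h1 : hdot (X *m tang v) eM = - hdot (tang v) (X *m eM).
  by apply/eqP; rewrite -subr_eq0 opprK h1.
rewrite h2 h1 hdotlin conjE hdotC !conjE -h3; apply/colP => i; rewrite !mxE.
by field.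
Qed.

(** Weight 2: only the block from eM to eP survives, and skewness makes its
    coefficient imaginary. *)
Lemma heisZ_inv X : skewJ X -> Hm *m X - X *m Hm = 2%:R *: X ->
  exists2 t, t + t^* = 0 & X = heisZ t.
Proof.
move=> sk e.
have act v : Hm *m (X *m v) = 2%:R *: (X *m v) + X *m (Hm *m v).
  by rewrite scalemxAl -e mulmxBl !mulmxA subrK.
have XP : X *m eP = 0.
  apply: (@Hm_eigen 3%:R); rewrite ?pnatr_eq0//.
    by rewrite -natrX pnatr_eq1.
  rewrite act HmE !hdote mul0r scale0r subr0 divff ?pnatr_eq0// scale1r.
  by apply/colP => i; rewrite !mxE; ring.
have Xperp v : perp v -> X *m v = 0.
  move=> [vP vM]; apply: (@Hm_eigen 2%:R); rewrite ?pnatr_eq0//.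
    by rewrite -natrX pnatr_eq1.
  by rewrite act HmE vP vM mul0r !scale0r subrr mulmx0 addr0.
have XM : X *m eM = (hdot eM (X *m eM) / 2) *: eP.
  apply: Hm_eigen1; rewrite act HmE !hdote mul0r scale0r sub0r.
  rewrite divff ?pnatr_eq0// scale1r mulmxN.
  by apply/colP => i; rewrite !mxE; ring.
exists (hdot eM (X *m eM) / 2 / 2).
  have := skew_hdot eM eM sk; rewrite -[hdot (X *m _) _]hdotC => h.
  by rewrite !conjE -[RHS](mul0r (2^-1 / 2)) -h; ring.
apply: mulmx_ext => v; rewrite heisZE {1}[v]tangE !mulmxDr -!scalemxAr XP scaler0.
rewrite addr0 (Xperp _ (tang_perp v)) add0r XM !hdotlin !hdote scalerA.
by congr (_ *: _); field.
Qed.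

Lemma mxtrace_outer u v : \tr (u *m (v^t* *m J)) = hdot v u.
Proof. by rewrite mxtrace_mulC -mulmxA [X in \tr X]mx11_scalar mxtrace_scalar. Qed.

Lemma heisY_skew z : perp z -> skewJ (heisY z).
Proof.
move=> zp; apply: hdot_skew => u v; rewrite !heisYE !hdotlin !hdotC; ring.
Qed.
Lemma heisZ_skew t : t + t^* = 0 -> skewJ (heisZ t).
Proof.
move=> e; apply: hdot_skew => u v; rewrite !heisZE !hdotlin !conjE !hdotC.
by rewrite -[RHS](mul0r (hdot u eP * hdot eP v)) -e; ring.
Qed.
Lemma heisY_tr z : perp z -> \tr (heisY z) = 0.
Proof.
move=> zp; have [zP _] := zp; have [zP' _] := perpC zp.
by rewrite /heisY -lock raddfB/= !mxtrace_outer zP zP' subrr.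
Qed.
Lemma heisZ_tr t : \tr (heisZ t) = 0.
Proof. by rewrite /heisZ -lock mxtraceZ mxtrace_outer hdote mulr0. Qed.
Lemma heisY_br z : perp z -> Hm *m heisY z - heisY z *m Hm = 1 *: heisY z.
Proof.
move=> zp; have [zP zM] := zp; have [zP' zM'] := perpC zp.
apply: mulmx_ext => v; rewrite scale1r mulmxBl -!mulmxA !(heisYE, HmE, hdotlin).
rewrite !hdote zP zM zP' zM'; apply/colP => i; rewrite !mxE; by field.
Qed.
Lemma heisZ_br t : Hm *m heisZ t - heisZ t *m Hm = 2%:R *: heisZ t.
Proof.
apply: mulmx_ext => v; rewrite -scalemxAl mulmxBl -!mulmxA.
rewrite !(heisZE, HmE, hdotlin) !hdote; apply/colP => i; rewrite !mxE; by field.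
Qed.

Lemma exp_root z t : perp z ->
  1%:M + (heisY z + heisZ t)
    + 2%:R^-1 *: ((heisY z + heisZ t) *m (heisY z + heisZ t))
  = nu z (t - hdot z z / 2).
Proof.
move=> zp; set X : 'M[C]_n.+2 := heisY z + heisZ t. have [zP zM] := zp; have [zP' zM'] := perpC zp.
have XE v : X *m v = hdot eP v *: z - hdot z v *: eP + (t * hdot eP v) *: eP.
  by rewrite /X mulmxDl heisYE heisZE.
clearbody X; apply: mulmx_ext => v; rewrite nuE !mulmxDl -scalemxAl mul1mx -[X *m X *m v]mulmxA !XE.
rewrite !hdotlin !hdote zP zP'; apply/colP => i; rewrite !mxE; by field.
Qed.

Lemma nu_exp z t : perp z ->
  nu z t = 1%:M + (heisY z + heisZ (t + hdot z z / 2))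
    + 2%:R^-1 *: ((heisY z + heisZ (t + hdot z z / 2))
                  *m (heisY z + heisZ (t + hdot z z / 2))).
Proof. by move=> zp; rewrite exp_root// addrK. Qed.

End Dil.

(** * Isometries relative to the pair of null vectors *)

Section Iso.
Variables (C : numClosedFieldType) (n : nat).
Local Notation vec := 'cV[C]_n.+2.
Local Notation J := (formJ C n).
Local Notation eP := (eP C n).
Local Notation eM := (eM C n).
Implicit Types (u v w z : vec) (a b c t : C).

Lemma eP_neq0 : eP != 0.
Proof.
apply/eqP => e; have := hdotMP C n; rewrite e hdot0r => /esym/eqP.
by rewrite pnatr_eq0.
Qed.

Lemma mul_tang (A : 'M[C]_n.+2) v : A *m v = A *m tang v
  + (hdot eM v / 2) *: (A *m eP) + (hdot eP v / 2) *: (A *m eM).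
Proof. by rewrite {1}[v]tangE !mulmxDr -!scalemxAr. Qed.

Lemma hdot_total0 d : hdot eP d = 0 -> hdot eM d = 0 ->
  (forall u, perp u -> hdot u d = 0) -> d = 0.
Proof.
move=> dP dM du; have dt : d = tang d.
  by rewrite {1}[d]tangE dP dM !mul0r !scale0r !addr0.
apply/eqP; rewrite dt -perp_eq0; last exact: tang_perp.
by have := du _ (tang_perp d); rewrite {2}dt => ->.
Qed.

Lemma dil_eigenP a v : a != 0 -> a ^+ 2 != 1 -> dil n a *m v = a *: v ->
  v = (hdot eM v / 2) *: eP.
Proof.
move=> a0 a1 e; have := congr1 (hdot eP) e; move: e.
rewrite dilE !hdotlin !hdote => e e1.
have p0 : hdot eP v = 0.
  have {}e1 : a^-1 * hdot eP v = a * hdot eP v by rewrite -e1; field.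
  have {}e1 : (a ^+ 2 - 1) * hdot eP v = 0.
    by rewrite mulrBl expr2 -mulrA -e1 mulrA divff// subrr.
  by move/eqP: e1; rewrite mulf_eq0 subr_eq0 (negbTE a1)/= => /eqP.
move: e; rewrite p0 mulr0 scale0r addr0 => e.
have a1' : a - 1 != 0 by apply: contraNneq a1 => /eqP; rewrite subr_eq0 => /eqP->; rewrite expr1n.
have : (a - 1) *: v = ((a - 1) / 2 * hdot eM v) *: eP.
  by rewrite scalerBl -e scale1r addrC addKr.
move/(congr1 (fun w => (a - 1)^-1 *: w)); rewrite !scalerA mulVf// scale1r => ->.
by rewrite hdotlin hdote; congr (_ *: _); field.
Qed.

(** The eigenspaces of the dilation are the lines of eP and eM and their
    orthogonal complement, on which the form is definite: a null eigenvector lies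
    on one of the two lines. *)
Lemma dil_null_fix a c v : a != 0 -> a ^+ 2 != 1 -> hdot v v = 0 -> v != 0 ->
  dil n a *m v = c *: v ->
  v = (hdot eM v / 2) *: eP \/ v = (hdot eP v / 2) *: eM.
Proof.
move=> a0 a1 vv v0 e.
have e1 := congr1 (hdot eP) e; have e2 := congr1 (hdot eM) e.
move: e1 e2; rewrite dilE !hdotlin !hdote => e1 e2.
have {}e1 : a^-1 * hdot eP v = c * hdot eP v by rewrite -e1; field.
have {}e2 : a * hdot eM v = c * hdot eM v by rewrite -e2; field.
have e3 : (1 - c) *: tang v = 0.
  have : dil n a *m tang v = c *: tang v.
    have tE : tang v = v - (hdot eM v / 2) *: eP - (hdot eP v / 2) *: eM.
      by rewrite /tang -lock.
    rewrite tE !mulmxBr -!scalemxAr dilP dilM e !scalerBr !scalerA.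
    by rewrite !mulrA -e1 -e2 ![_ / 2 * _]mulrAC ![_ * a]mulrC ![_ * a^-1]mulrC.
  by rewrite dil_perp; [rewrite scalerBl scale1r => <-; rewrite subrr|exact: tang_perp].
have [p0|pn0] := eqVneq (hdot eP v) 0; last first.
  have ca : c = a^-1 by apply: (mulIf pn0); rewrite e1.
  have m0 : hdot eM v = 0.
    apply/eqP; have : (a ^+ 2 - 1) * hdot eM v == 0.
      by rewrite mulrBl expr2 -mulrA e2 ca mulrA divff// mul1r subrr.
    by rewrite mulf_eq0 subr_eq0 (negbTE a1).
  have t0 : tang v = 0.
    move/eqP: e3; rewrite scaler_eq0 subr_eq0 ca => /orP[/eqP a1'|/eqP//].
    by move: a1; rewrite -[a]invrK -a1' invr1 expr1n eqxx.
  by right; rewrite {1}[v]tangE t0 m0 mul0r scale0r !add0r.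
have [m0|mn0] := eqVneq (hdot eM v) 0.
  have vt : v = tang v by rewrite {1}[v]tangE p0 m0 !mul0r !scale0r !addr0.
  move/eqP: vv; rewrite vt perp_eq0; last exact: tang_perp.
  by rewrite -vt (negbTE v0).
have ca : c = a by apply: (mulIf mn0); rewrite e2.
have t0 : tang v = 0.
  move/eqP: e3; rewrite scaler_eq0 subr_eq0 ca => /orP[/eqP a1'|/eqP//].
  by move: a1; rewrite -a1' expr1n eqxx.
by left; rewrite {1}[v]tangE t0 p0 mul0r scale0r addr0 add0r.
Qed.

Lemma exp_Hm a : a != 0 ->
  1%:M + ((a - a^-1) / 2) *: Hm C n + ((a + a^-1) / 2 - 1) *: (Hm C n *m Hm C n)
  = dil n a.
Proof.
move=> a0; apply: mulmx_ext => v.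
rewrite dilE !mulmxDl -!scalemxAl -mulmxA !HmE !hdotlin !hdote mul1mx.
by apply/colP => i; rewrite !mxE; field; rewrite a0.
Qed.

Lemma isom_J v : J *m v = v + ((hdot eP v - hdot eM v) / 2) *: (eP - eM).
Proof.
rewrite {1}[v]tangE !mulmxDr -!scalemxAr JP JM Jperp; last exact: tang_perp.
by rewrite [X in _ = X + _]tangE; apply/colP => i; rewrite !mxE; field.
Qed.

Lemma phase_hdot (m : 'M[C]_n.+2) c e v : m^t* *m J *m m = J ->
  m *m e = c *: e -> c^* * c = 1 -> hdot e (m *m v) = c * hdot e v.
Proof.
move=> mJ me cc; have := isom_hdot e v mJ; rewrite me hdotlin => <-.
by rewrite mulrA [c * _]mulrC cc mul1r.
Qed.

(** An isometry that scales eP and eM by the same phase commutes with J, since J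
    differs from the identity only on their plane; commuting with J, it is
    unitary. *)
Lemma phase_unitary (m : 'M[C]_n.+2) c : m^t* *m J *m m = J ->
  m *m eP = c *: eP -> m *m eM = c *: eM -> c^* * c = 1 -> m^t* *m m = 1%:M.
Proof.
move=> mJ mP mM cc.
have mJC : m *m J = J *m m.
  apply: mulmx_ext => v; rewrite -!mulmxA !isom_J.
  rewrite (phase_hdot _ mJ mP cc) (phase_hdot _ mJ mM cc).
  rewrite mulmxDr -scalemxAr mulmxBr mP mM.
  by apply/colP => i; rewrite !mxE; ring.
transitivity (m^t* *m (J *m (J *m m))); first by rewrite (mulmxA J J) JJ mul1mx.
by rewrite -mJC !mulmxA mJ JJ.
Qed.

Lemma phase_dil (m : 'M[C]_n.+2) c a : m^t* *m J *m m = J ->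
  m *m eP = c *: eP -> m *m eM = c *: eM -> c^* * c = 1 ->
  m *m dil n a = dil n a *m m.
Proof.
move=> mJ mP mM cc; apply: mulmx_ext => v; rewrite -!mulmxA !dilE.
rewrite (phase_hdot _ mJ mP cc) (phase_hdot _ mJ mM cc).
rewrite !mulmxDr -!scalemxAr mP mM; apply/colP => i; rewrite !mxE; ring.
Qed.

(** The null lines other than that of eP form the N-orbit of the line of eM. *)
Lemma null_nu v : hdot v v = 0 -> hdot eP v != 0 ->
  exists z t, hpt z t /\ nu z t *m eM = (hdot eP v / 2)^-1 *: v.
Proof.
move=> vv p0; have [tP tM] := tang_perp v.
have [a aE] : exists a, a = hdot eP v / 2 by exists (hdot eP v / 2).
have a0 : a != 0 by rewrite aE mulf_neq0// invr_eq0 pnatr_eq0.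
rewrite -aE.
have hpt' : hpt ((2 * a)^-1 *: tang v) (hdot eM v / (4 * a)).
  split; first by rewrite /perp !hdotlin tP tM mulr0.
  have ac : a^* != 0 by rewrite conjC_eq0.
  have := vv; rewrite {1 2}[v]tangE -aE.
  have [tP' tM'] := perpC (tang_perp v).
  rewrite !hdotlin !hdote !tP !tM !tP' !tM' !conjE => e.
  rewrite -[RHS](mul0r (4 * a^* * a)^-1) -e.
  by field; rewrite ac a0.
exists ((2 * a)^-1 *: tang v), (hdot eM v / (4 * a)); split=> //.
rewrite nuM// [X in _ = _ *: X]tangE -aE; apply/colP => i; rewrite !mxE; by field.
Qed.

(** Take the element of N with the same effect on eM as g: both isometries fix
    eP, and on the complement they agree modulo the line of eP.  They preserve the
    products with their common image of eM, hence agree there too. *)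
Lemma isom_nu (g : 'M[C]_n.+2) : g^t* *m J *m g = J -> g *m eP = eP ->
  (forall u v, perp u -> perp v -> hdot u (g *m v) = hdot u v) ->
  exists z t, hpt z t /\ g = nu z t.
Proof.
move=> gJ gP gperp; have giso u v := isom_hdot u v gJ.
have PgM : hdot eP (g *m eM) = 2 by rewrite -{1}gP giso hdote.
have gM0 : hdot (g *m eM) (g *m eM) = 0 by rewrite giso hdote.
have [|z [t [zt]]] := null_nu gM0; first by rewrite PgM pnatr_eq0.
rewrite PgM divff ?pnatr_eq0// invr1 scale1r => gM.
exists z, t; split=> //; apply: mulmx_ext => v.
have niso u v := isom_hdot u v (nu_form zt).
have gv w : perp w -> g *m w = nu z t *m w.
  move=> wp; have [wP wM] := wp.
  have [d dE] : exists d, d = g *m w - nu z t *m w by eexists.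
  have dP : hdot eP d = 0.
    by rewrite dE hdotlin hdotNr -{1}gP giso -{2}(nuP zt) niso subrr.
  have du u : perp u -> hdot u d = 0.
    move=> up; rewrite dE hdotlin hdotNr gperp// nuE wP mulr0 !scale0r !addr0.
    by rewrite !hdotlin (perpC up).1 mulr0 oppr0 addr0 subrr.
  have dgM : hdot (g *m eM) d = 0.
    by rewrite dE hdotlin hdotNr giso -gM niso subrr.
  have dM : hdot eM d = 0.
    move: dgM; rewrite -gM (nuM zt) !hdotDl !hdotZl dP (du z) ?mulr0 ?addr0//.
    by case: zt.
  by apply/eqP; rewrite -subr_eq0 -dE (hdot_total0 dP dM du).
rewrite (mul_tang g) (mul_tang (nu z t)) gP (nuP zt) gM gv//.
exact: tang_perp.
Qed.

End Iso.

Section RealComplex.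
Variable R : realType.
Implicit Types x y : R.
Lemma rcDE x y : (x + y)%:C%C = x%:C%C + y%:C%C :> R[i]. Proof. exact: rmorphD. Qed.
Lemma rcNE x : (- x)%:C%C = - x%:C%C :> R[i]. Proof. exact: rmorphN. Qed.
Lemma rcME x y : (x * y)%:C%C = x%:C%C * y%:C%C :> R[i]. Proof. exact: rmorphM. Qed.
Lemma rc0E : 0%:C%C = 0 :> R[i]. Proof. exact: rmorph0. Qed.
Lemma rc1E : 1%:C%C = 1 :> R[i]. Proof. exact: rmorph1. Qed.
Lemma rcnE m : (m%:R)%:C%C = m%:R :> R[i]. Proof. exact: rmorph_nat. Qed.
Lemma rcVE x : (x^-1)%:C%C = (x%:C%C)^-1 :> R[i]. Proof. exact: fmorphV. Qed.
Lemma rcXE x m : (x ^+ m)%:C%C = (x%:C%C) ^+ m :> R[i]. Proof. exact: rmorphXn. Qed.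
Definition rcE := (rcDE, rcNE, rcME, rc0E, rc1E, rcnE, rcVE, rcXE).
Lemma rc_eq0 x : (x%:C%C == 0 :> R[i]) = (x == 0). Proof. exact: fmorph_eq0. Qed.
Lemma conj_real x : (x%:C%C)^* = x%:C%C :> R[i]. Proof. exact: conjc_real. Qed.
End RealComplex.

(** * The groups A, N and P *)

Section Group.
Variables (R : realType) (n : nat).
Local Notation C := (R[i] : numClosedFieldType).
Local Notation vec := 'cV[C]_n.+2.
Local Notation G := (SU R n).
Local Notation eP := (eP C n).
Local Notation eM := (eM C n).

Lemma SUvalM (g h : G) : SUval (g * h)%g = SUval g *m SUval h.
Proof. by []. Qed.
Lemma SUval1 : SUval (1%g : G) = 1%:M.
Proof. by []. Qed.
Lemma SU_form (g : G) : (SUval g)^t* *m formJ C n *m SUval g = formJ C n.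
Proof. by case: g => g /= /andP[/eqP]. Qed.
Definition act (g : G) (v : vec) : vec := locked (SUval g *m v).
Lemma actE g v : act g v = SUval g *m v.
Proof. by rewrite /act -lock. Qed.
Lemma act_hdot (g : G) (u v : vec) : hdot (act g u) (act g v) = hdot u v.
Proof. by rewrite !actE; apply/isom_hdot/SU_form. Qed.
Lemma actM (g h : G) v : act (g * h)%g v = act g (act h v).
Proof. by rewrite !actE SUvalM mulmxA. Qed.
Lemma act1 v : act 1%g v = v.
Proof. by rewrite actE SUval1 mul1mx. Qed.
Lemma actK g : cancel (act g) (act g^-1%g).
Proof. by move=> v; rewrite -actM mulVg act1. Qed.
Lemma actVK g : cancel (act g^-1%g) (act g).
Proof. by move=> v; rewrite -actM mulgV act1. Qed.
Lemma actZ g c v : act g (c *: v) = c *: act g v.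
Proof. by rewrite !actE -scalemxAr. Qed.
Lemma SU_ext (g h : G) : SUval g = SUval h -> g = h.
Proof. exact: val_inj. Qed.
Lemma act_neq0 (g : G) (v : vec) : v != 0 -> act g v != 0.
Proof. by apply: contra_neq => e; rewrite -(actK g v) e actE mulmx0. Qed.

Lemma in_SU_nu (z : vec) (t : C) : hpt z t -> in_SU (nu z t : mat R n).
Proof. by move=> zt; apply/andP; split; apply/eqP; [exact: nu_form|exact: det_nu]. Qed.
Lemma in_SU_nv (z : vec) (t : C) : hpt z t -> in_SU (nv z t : mat R n).
Proof. by move=> zt; apply/andP; split; apply/eqP; [exact: nv_form|exact: det_nv]. Qed.
Lemma in_SU_dil (a : R) : 0 < a -> in_SU (dil n (a%:C)%C : mat R n).
Proof.
move=> a0; have a0' : (a%:C)%C != 0 :> C by rewrite rc_eq0 gt_eqF.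
apply/andP; split; apply/eqP; last exact: det_dil.
by apply: dil_form => //; exact: conj_real.
Qed.

Definition nuG (z : vec) (t : C) (zt : hpt z t) : G := MkSU (in_SU_nu zt).
Definition nvG (z : vec) (t : C) (zt : hpt z t) : G := MkSU (in_SU_nv zt).
Definition dilG (a : R) (a0 : 0 < a) : G := MkSU (in_SU_dil a0).

Lemma N0P (g : G) : N0 g <-> exists z t, hpt z t /\ SUval g = @nu C n z t.
Proof.
split.
  have eH : Hmat R n = Hm C n by rewrite /Hm -lock.
  move=> [Y [Z [[[sY _] bY] [[sZ _] bZ] ->]]]; rewrite eH in bY bZ.
  have [z zp ->] := heisY_inv sY bY; have [t tt ->] := heisZ_inv sZ bZ.
  exists z, (t - hdot z z / 2); split; last exact: exp_root.
  split=> //; rewrite !conjE hdotC -[RHS]tt; by field.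
move=> [z [t [zt gE]]]; have [zp e] := zt; rewrite /N0/= gE.
exists (heisY z), (heisZ _ (t + hdot z z / 2)).
have tt : t + hdot z z / 2 + (t + hdot z z / 2)^* = 0.
  by rewrite !conjE hdotC -[RHS]e; field.
have eH : Hmat R n = Hm C n by rewrite /Hm -lock.
rewrite /root_space eH; split.
- by split; [split; [exact: heisY_skew|exact: heisY_tr]|exact: heisY_br].
- by split; [split; [exact: heisZ_skew|exact: heisZ_tr]|exact: heisZ_br].
exact: nu_exp.
Qed.

Lemma A0P (g : G) : A0 g <-> exists a : R, 0 < a /\ SUval g = @dil C n a%:C%C.
Proof.
have eH : Hmat R n = Hm C n by rewrite /Hm -lock.
have e0 s : (expR s)%:C%C != 0 :> C by rewrite rc_eq0 gt_eqF ?expR_gt0.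
split.
  move=> [s gE]; exists (expR s); split; first exact: expR_gt0.
  by rewrite expRN !rcE eH in gE; rewrite gE; exact: exp_Hm.
move=> [a [a0 gE]]; exists (ln a).
rewrite -[in dil _ _](lnK (x := a)) ?posrE// in gE; rewrite gE.
by rewrite expRN !rcE eH; exact/esym/exp_Hm.
Qed.

Definition stab0 : set G := [set g | exists c : C, act g eP = c *: eP].

(** An element of MAN fixes the line of eP because M commutes with the dilation
    of ratio 2, whose eigenspace for 2 is that line.  Conversely, let g scale eP
    by c.  Correct it by the element of N that carries eM to the line of g^-1 eM
    and by the dilation of ratio |c|: what remains scales eP and eM by the phase
    c / |c|, so it is unitary and commutes with A. *)
Lemma stab0P (g : G) : minimal_parabolic (@K0 R n) (@A0 R n) (@N0 R n) g <-> stab0 g.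
Proof.
split.
  move=> [m [a [u [[mK mA] aA uN ->]]]].
  have [b [b0 ab]] := (A0P a).1 aA; have [z [t [zt uE]]] := (N0P u).1 uN.
  have two0 : 0 < 2 :> R by rewrite ltr0n.
  have A2 : A0 (dilG two0) by apply/A0P; exists 2; split; [exact: two0|exact: erefl].
  have aE v : act a v = dil n b%:C%C *m v by rewrite actE ab.
  have uE' v : act u v = nu z t *m v by rewrite actE uE.
  have dE v : act (dilG two0) v = dil n (2%:R)%:C%C *m v by rewrite actE.
  have := congr1 (fun g => act g eP) (mA _ A2).
  rewrite !actM !dE dilP actZ rcnE => e.
  have [k mk] : exists k, act m eP = k *: eP.
    exists (hdot eM (act m eP) / 2); apply: (@dil_eigenP _ _ 2).
    - by rewrite pnatr_eq0.
    - by rewrite -natrX pnatr_eq1.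
    - by rewrite -e.
  exists (b%:C%C * k).
  by rewrite !actM uE' (nuP zt) aE dilP actZ mk scalerA.
move=> [c gP].
have c0 : c != 0.
  apply/eqP => c0; have := act_neq0 g (eP_neq0 C n); by rewrite gP c0 scale0r eqxx.
pose y : vec := act g^-1%g eM.
have yy : hdot y y = 0 by rewrite act_hdot hdote.
have Py : hdot eP y = c^* * 2.
  by rewrite -(act_hdot g) actVK gP hdotlin hdote.
have Py0 : hdot eP y != 0 by rewrite Py mulf_neq0// ?conjC_eq0 ?pnatr_eq0.
have [z [t [zt zy]]] := null_nu yy Py0.
rewrite Py mulfK ?pnatr_eq0// in zy.
have [r rE] : exists r : R, `|c| = r%:C%C.
  by exists (complex.Re `|c|); rewrite RRe_real// normr_real.
have r0 : 0 < r by rewrite -(ltcR 0 r) -rE normr_gt0.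
have r0' : (r%:C)%C != 0 :> C by rewrite rc_eq0 gt_eqF.
have rc : c^* * c = r%:C%C * r%:C%C by rewrite mulrC -rE -expr2 normCK.
have cc0 : c^* != 0 by rewrite conjC_eq0.
pose u := nuG (hptN zt); pose a := dilG r0.
pose m : G := (g * nuG zt * a^-1)%g.
have aV (v : vec) k k' : dil n r%:C%C *m v = k *: v -> k * k' = 1 ->
    act (a^-1)%g v = k' *: v.
  move=> e kk; have {}e : act a v = k *: v by rewrite actE.
  by rewrite -[in RHS](actK a v) e actZ scalerA mulrC kk scale1r.
have nE v : act (nuG zt) v = nu z t *m v by rewrite actE.
have [ph phE] : exists ph, ph = c / r%:C%C by exists (c / r%:C%C).
have phc : ph^* * ph = 1.
  by rewrite phE !conjE conj_real mulrACA rc -invfM divff// mulf_neq0.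
have mP : SUval m *m eP = ph *: eP.
  rewrite -actE /m !actM (aV _ _ (r%:C%C)^-1 (dilP _ _)) ?divff//.
  by rewrite !actZ nE (nuP zt) gP scalerA phE mulrC.
have mM : SUval m *m eM = ph *: eM.
  rewrite -actE /m !actM (aV _ _ (r%:C%C) (dilM _ _)) ?mulVf//.
  rewrite !actZ nE zy actZ /y actVK scalerA; congr (_ *: _).
  by apply: (mulfI cc0); rewrite phE [RHS]mulrA rc; field; rewrite r0' cc0.
exists m, a, u; split.
- split; first exact: (phase_unitary (SU_form m) mP mM phc).
  move=> b /A0P[s [s0 bE]]; apply: SU_ext; rewrite !SUvalM bE.
  exact: (phase_dil _ (SU_form m) mP mM phc).
- by apply/A0P; exists r; split; [exact: r0|exact: erefl].
- by apply/N0P; exists (- z), t^*; split=> //; exact: hptN.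
have un : (nuG zt * u)%g = 1%g by apply: SU_ext; rewrite SUvalM; exact: nuNr.
by rewrite /m mulgVK -mulgA un mulg1.
Qed.

End Group.

(** * Smooth functions of a matrix *)

Section MatrixLimits.
Variable K : numFieldType.

Lemma cvg_mx T (F : set_system T) {FF : Filter F} m p
    (f : T -> 'M[K]_(m, p)) (M : 'M[K]_(m, p)) :
  (forall i j, f t i j @[t --> F] --> M i j) -> f t @[t --> F] --> M.
Proof.
move=> fM A [P MP PA]; rewrite nbhs_filterE.
apply: (filterS (P := [set t | forall i j, P i j (f t i j)])); first by move=> t /PA.
by apply: filter_forall => i; apply: filter_forall => j; exact: fM.
Qed.

Lemma cvg_mx_coord T (F : set_system T) {FF : Filter F} m p
    (f : T -> 'M[K]_(m, p)) (M : 'M[K]_(m, p)) i j :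
  f t @[t --> F] --> M -> f t i j @[t --> F] --> M i j.
Proof.
move=> fM.
apply: (@cvg_comp _ _ _ f (fun M : 'M[K]_(m, p) => M i j) F (nbhs M) _ fM).
exact: coord_continuous.
Qed.

Lemma cvg_bigsum T (F : set_system T) {FF : Filter F} (I : Type) (r : seq I)
    (f : I -> T -> K) (l : I -> K) :
  (forall i, f i t @[t --> F] --> l i) ->
  \sum_(i <- r) f i t @[t --> F] --> \sum_(i <- r) l i.
Proof.
move=> h; apply: (@cvg_big K I +%R 0 predT) => //.
by move=> x; exact: add_continuous.
Qed.

Lemma cvg_mulmx T (F : set_system T) {FF : Filter F} m p q
    (f : T -> 'M[K]_(m, p)) (g : T -> 'M[K]_(p, q)) (A : 'M[K]_(m, p)) (B : 'M[K]_(p, q)) :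
  f t @[t --> F] --> A -> g t @[t --> F] --> B ->
  f t *m g t @[t --> F] --> A *m B.
Proof.
move=> fA gB; apply: cvg_mx => i j.
rewrite mxE; under eq_fun do rewrite mxE.
apply: cvg_bigsum => k; apply: cvgM; exact: cvg_mx_coord.
Qed.

Lemma cvg_mxD T (F : set_system T) {FF : Filter F} m p
    (f g : T -> 'M[K]_(m, p)) (A B : 'M[K]_(m, p)) :
  f t @[t --> F] --> A -> g t @[t --> F] --> B ->
  f t + g t @[t --> F] --> A + B.
Proof.
move=> fA gB; apply: cvg_mx => i j.
rewrite mxE; under eq_fun do rewrite mxE.
by apply: cvgD; exact: cvg_mx_coord.
Qed.

Lemma cvg_mxZ T (F : set_system T) {FF : Filter F} m p
    (c : T -> K) (f : T -> 'M[K]_(m, p)) (k : K) (A : 'M[K]_(m, p)) :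
  c t @[t --> F] --> k -> f t @[t --> F] --> A ->
  c t *: f t @[t --> F] --> k *: A.
Proof.
move=> ck fA; apply: cvg_mx => i j.
rewrite mxE; under eq_fun do rewrite mxE.
by apply: cvgM => //; exact: cvg_mx_coord.
Qed.

Lemma continuous_mx (T : topologicalType) m p (f : T -> 'M[K]_(m, p)) :
  (forall i j, continuous (fun t => f t i j)) -> continuous f.
Proof.
by move=> h x; apply: (@cvg_mx T (nbhs x) (nbhs_filter x)) => i j; exact: h.
Qed.

Lemma continuous_mulmx (T : topologicalType) m p q
    (f : T -> 'M[K]_(m, p)) (g : T -> 'M[K]_(p, q)) :
  continuous f -> continuous g -> continuous (fun t => f t *m g t).
Proof.
by move=> cf cg x; exact: (@cvg_mulmx T (nbhs x) (nbhs_filter x) _ _ _ f g _ _ (cf x) (cg x)).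
Qed.

End MatrixLimits.

Section ComplexLimits.
Variable R : realType.
Local Notation K := (R[i] : numFieldType).

Lemma Re_le_norm (x : R[i]) : (`|complex.Re x|%:C)%C <= `|x|.
Proof.
by case: x => a b; rewrite normc_def lecR -sqrtr_sqr ler_wsqrtr// lerDl sqr_ge0.
Qed.
Lemma Im_le_norm (x : R[i]) : (`|complex.Im x|%:C)%C <= `|x|.
Proof.
by case: x => a b; rewrite normc_def lecR -sqrtr_sqr ler_wsqrtr// lerDr sqr_ge0.
Qed.

Lemma real_complex_continuous : continuous (fun t : R => t%:C%C : K).
Proof.
move=> t A /nbhs_ballP[e /= e0 eA]; rewrite nbhs_filterE.
have [r r0 rE] : exists2 r : R, 0 < r & e = r%:C%C.
  exists (complex.Re e); last by rewrite RRe_real// gtr0_real.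
  by rewrite -(ltcR 0) RRe_real// gtr0_real.
apply/nbhs_ballP; exists r => //= x /= xr; apply: eA; rewrite /ball/=.
by rewrite -rmorphB/= normc_def/= expr0n addr0 sqrtr_sqr rE ltcR.
Qed.

Lemma Re_continuous : continuous (fun x : K => complex.Re x : R).
Proof.
move=> x A /nbhs_ballP[e /= e0 eA]; rewrite nbhs_filterE.
apply/nbhs_ballP; exists (e%:C%C) => //=; first by rewrite ltcR.
move=> y /= xy; apply: eA; rewrite /ball/= -(ltcR _ e).
by apply: le_lt_trans xy; rewrite -raddfB; exact: Re_le_norm.
Qed.

Lemma Im_continuous : continuous (fun x : K => complex.Im x : R).
Proof.
move=> x A /nbhs_ballP[e /= e0 eA]; rewrite nbhs_filterE.
apply/nbhs_ballP; exists (e%:C%C) => //=; first by rewrite ltcR.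
move=> y /= xy; apply: eA; rewrite /ball/= -(ltcR _ e).
by apply: le_lt_trans xy; rewrite -raddfB; exact: Im_le_norm.
Qed.

End ComplexLimits.

Section Smooth.
Variables (R : realType) (n : nat).
Local Notation mat := (mat R n).
Implicit Types (F : mat -> R) (X V W : mat) (U : set mat).

Definition line X V (t : R) : mat := X + t%:C%C *: V.

Lemma line0 X V : line X V 0 = X.
Proof. by rewrite /line rc0E scale0r addr0. Qed.

Lemma line_line X V s t : line (line X V s) V t = line X V (s + t).
Proof. by rewrite /line -addrA -scalerDl -rcDE. Qed.

Lemma cvg_line T (Fi : set_system T) {FF : Filter Fi} (f : T -> mat) (g : T -> mat)
    (s : T -> R) X V t :
  f x @[x --> Fi] --> X -> g x @[x --> Fi] --> V -> s x @[x --> Fi] --> t ->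
  line (f x) (g x) (s x) @[x --> Fi] --> line X V t.
Proof.
move=> fX gV st.
have sc : (s x)%:C%C @[x --> Fi] --> (t%:C%C : (R[i] : numFieldType)).
  apply: (@cvg_comp _ _ _ s (fun t : R => t%:C%C : (R[i] : numFieldType)) Fi (nbhs t) _ st).
  exact: real_complex_continuous.
exact: (cvg_mxD fX (cvg_mxZ sc gV)).
Qed.

Lemma smooth_cont U F X : smooth_on U F -> U X -> {for X, continuous F}.
Proof. by move=> sF UX; case: (sF [::] X UX). Qed.

Lemma smooth_dd U F V : smooth_on U F -> smooth_on U (dir_derive V F).
Proof.
move=> sF Vs X UX; have := sF (rcons Vs V) X UX.
by rewrite /dir_derives foldr_rcons.
Qed.

Lemma smooth_is_derive U F X V : smooth_on U F -> U X ->
  is_derive (0 : R) (1 : R) (fun t => F (line X V t)) (dir_derive V F X).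
Proof.
move=> sF UX; have [_ /(_ V) dF] := sF [::] X UX.
by rewrite /dir_derive derive1E; apply: DeriveDef.
Qed.

Lemma smooth_is_derive_line U F X V t : smooth_on U F -> U (line X V t) ->
  is_derive t (1 : R) (fun t => F (line X V t)) (dir_derive V F (line X V t)).
Proof.
move=> sF UX; have h := smooth_is_derive V sF UX.
have -> : (fun s => F (line X V s)) =
    (fun s => F (line (line X V t) V s)) \o (shift (- t)).
  by apply/funext => s /=; rewrite line_line /shift/= addrCA addrN addr0.
rewrite -[dir_derive _ _ _]mulr1; apply: is_derive1_comp; last exact: is_derive_shift.
by rewrite /shift/= addrN.
Qed.

Lemma near_line U X V : open U -> U X -> \forall t \near (0:R), U (line X V t).
Proof.
move=> oU UX.
have : line X V t @[t --> (0 : R)] --> line X V 0.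
  by apply: cvg_line; [exact: cvg_cst|exact: cvg_cst|exact: cvg_id].
by rewrite line0; apply; exact: open_nbhs_nbhs.
Qed.

Lemma dir_derive_eq_on U F G V : open U -> (forall X, U X -> F X = G X) ->
  forall X, U X -> dir_derive V F X = dir_derive V G X.
Proof.
move=> oU FG X UX; rewrite /dir_derive !derive1E; apply: near_eq_derive.
by apply: filterS (near_line V oU UX) => t; exact: FG.
Qed.

(** The mean value theorem along the segment from Y to Y + dV, with the continuity
    of the derivative at X; uniformity in the base point Y is what allows
    expansions along two directions to be chained. *)
Lemma smooth_first_order U F X V (e : R) : open U -> smooth_on U F -> U X -> 0 < e ->
  \forall Y \near X & d \near (0 : R), 0 <= d ->
     `|F (line Y V d) - F Y - d * dir_derive V F X| <= e * d.
Proof.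
move=> oU sF UX e0.
pose B := [set Z | U Z /\ `|dir_derive V F X - dir_derive V F Z| < e].
have nB : nbhs X B.
  apply: filterI; first exact: open_nbhs_nbhs.
  have c := smooth_cont (smooth_dd V sF) UX.
  exact: (@cvgr_dist_lt R R^o _ _ _ _ _ c).
have cl : line p.1 V p.2 @[p --> (X, (0:R))] --> X.
  rewrite -[X in _ --> X](line0 X V).
  by apply: cvg_line; [exact: cvg_fst|exact: cvg_cst|exact: cvg_snd].
have [[B1 B2] [/= nB1 nB2] B12] := cl _ nB.
have [r r0 rB2] : exists2 r : R, 0 < r & forall s, `|s| < r -> B2 s.
  move/nbhs_ballP : nB2 => [r r0 h]; exists r => // s sr; apply: h.
  by rewrite /ball/= sub0r normrN.
exists (B1, [set d | `|d| < r]).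
  split=> //=; apply/nbhs_ballP; exists r => // s; rewrite /ball/= sub0r normrN//.
move=> [Y d] /= [B1Y dr] d0.
have Bl (s : R) : s \in `[0, d] -> B (line Y V s).
  rewrite in_itv/= => /andP[s0 sd]; apply: (B12 (Y, s)); split=> //=.
  by apply: rB2; rewrite ger0_norm//; apply: le_lt_trans sd _; rewrite -(ger0_norm d0).
have der (s : R) : s \in `[0, d] -> is_derive s (1:R) (fun t => F (line Y V t)) (dir_derive V F (line Y V s)).
  by move=> /Bl[Us _]; exact: (smooth_is_derive_line sF Us).
have der' (s : R) : s \in `]0, d[ ->
    is_derive s (1:R) (fun t => F (line Y V t)) (dir_derive V F (line Y V s)).
  by move=> sd; apply: der; move: sd; rewrite !in_itv/= => /andP[? ?]; rewrite !ltW.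
have cont : {within `[0, d], continuous (fun t => F (line Y V t))}.
  by apply: derivable_within_continuous => s sd; have := der s sd; case.
have [c cd] := MVT_segment d0 der' cont.
rewrite line0 subr0 => ->; have [_ h] := Bl c cd.
rewrite mulrC -mulrBr normrM (ger0_norm d0) mulrC ler_wpM2r// distrC; exact: ltW.
Qed.

Lemma near_pair_along T (Fi : set_system T) {FF : Filter Fi}
    (P : mat -> R -> Prop) X (f : T -> mat) (d : T -> R) :
  (\forall Y \near X & d \near (0 : R), P Y d) ->
  f t @[t --> Fi] --> X -> d t @[t --> Fi] --> (0 : R) ->
  \forall t \near Fi, P (f t) (d t).
Proof. by move=> h fX d0; exact: (cvg_pair fX d0) _ h. Qed.

Lemma cvg_line0 X V : line X V d @[d --> (0 : R)^'+] --> X.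
Proof.
rewrite -[X in _ --> X](line0 X V); apply: cvg_line; [exact: cvg_cst|exact: cvg_cst|].
by apply: cvg_within_filter; exact: cvg_id.
Qed.

(** Go from X to X + dV and then to X + dV + dW: the second step starts at a
    moving point, whence the uniform expansion. *)
Lemma dir_deriveD U F X V W : open U -> smooth_on U F -> U X ->
  dir_derive (V + W) F X = dir_derive V F X + dir_derive W F X.
Proof.
move=> oU sF UX; apply/eqP; rewrite -subr_eq0 -normr_le0.
apply/ler_addgt0Pl => e e0; rewrite addr0.
have e3 : 0 < e / 3 by rewrite divr_gt0.
have c0 : d @[d --> (0 : R)^'+] --> (0 : R).
  by apply: cvg_within_filter; exact: cvg_id.
have h1 : \forall d \near (0 : R)^'+, 0 <= d ->
    `|F (line X V d) - F X - d * dir_derive V F X| <= e / 3 * d.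
  exact: near_pair_along (smooth_first_order V oU sF UX e3) (cvg_cst X) c0.
have h2 : \forall d \near (0 : R)^'+, 0 <= d ->
    `|F (line (line X V d) W d) - F (line X V d) - d * dir_derive W F X| <= e / 3 * d.
  exact: near_pair_along (smooth_first_order W oU sF UX e3) (@cvg_line0 X V) c0.
have h3 : \forall d \near (0 : R)^'+, 0 <= d ->
    `|F (line X (V + W) d) - F X - d * dir_derive (V + W) F X| <= e / 3 * d.
  exact: near_pair_along (smooth_first_order (V + W) oU sF UX e3) (cvg_cst X) c0.
near (0 : R)^'+ => d.
have d0 : 0 < d by near: d; exact: nbhs_right_gt.
have k1 : `|F (line X V d) - F X - d * dir_derive V F X| <= e / 3 * d.
  by apply: (near h1 d _) => //; exact: ltW.
have k2 : `|F (line (line X V d) W d) - F (line X V d) - d * dir_derive W F X| <= e / 3 * d.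
  by apply: (near h2 d _) => //; exact: ltW.
have k3 : `|F (line X (V + W) d) - F X - d * dir_derive (V + W) F X| <= e / 3 * d.
  by apply: (near h3 d _) => //; exact: ltW.
have lE : line (line X V d) W d = line X (V + W) d by rewrite /line scalerDr addrA.
rewrite lE in k2.
rewrite -(ler_pM2l d0) -[X in X * `|_|](gtr0_norm d0) -normrM.
move: k1 k2 k3; rewrite !ler_norml; set a := F X; set b := F (line X V d).
set c := F (line X (V + W) d); set x := dir_derive V F X; set y := dir_derive W F X.
set w := dir_derive (V + W) F X => /andP[? ?] /andP[? ?] /andP[? ?].
by apply/andP; split; lra.
Unshelve. all: by end_near. Qed.

(** The second order term of a curve does not contribute to its velocity. *)
Lemma smooth_curve U F X V W (th : R^nat) : open U -> smooth_on U F -> U X ->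
  (forall k, 0 < th k) -> th k @[k --> \oo] --> (0 : R) ->
  (F (line (line X V (th k)) W (th k ^+ 2)) - F X) / th k @[k --> \oo] -->
  (dir_derive V F X : R).
Proof.
move=> oU sF UX th0 thc; apply/(@cvgrPdist_le R R^o) => e e0.
have e3 : 0 < e / 3 by rewrite divr_gt0.
pose w : R := `|dir_derive W F X|.
have w1 : 0 < w + e / 3 + 1.
  by rewrite ltr_wpDl// addr_ge0 ?normr_ge0// ltW.
have c2 : th k ^+ 2 @[k --> \oo] --> (0 : R).
  rewrite (_ : (fun k => th k ^+ 2) = (fun k => th k * th k)); last first.
    by apply/funext => k; rewrite expr2.
  by rewrite -[X in _ --> X](mulr0 (0 : R)); exact: (cvgM thc thc).
have cl : line X V (th k) @[k --> \oo] --> X.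
  by rewrite -[X in _ --> X](line0 X V); apply: cvg_line => //; exact: cvg_cst.
have h1 : \forall k \near \oo, 0 <= th k ->
    `|F (line X V (th k)) - F X - th k * dir_derive V F X| <= e / 3 * th k.
  exact: near_pair_along (smooth_first_order V oU sF UX e3) (cvg_cst X) thc.
have h2 : \forall k \near \oo, 0 <= th k ^+ 2 ->
    `|F (line (line X V (th k)) W (th k ^+ 2)) - F (line X V (th k)) -
      th k ^+ 2 * dir_derive W F X| <= e / 3 * th k ^+ 2.
  exact: near_pair_along (smooth_first_order W oU sF UX e3) cl c2.
have h3 : \forall k \near \oo, th k < e / 3 / (w + e / 3 + 1).
  by apply: (cvgr_lt _ thc); rewrite !divr_gt0.
near=> k; have d0 := th0 k; set d := th k in d0 *.
have k1 : `|F (line X V d) - F X - d * dir_derive V F X| <= e / 3 * d.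
  by apply: (near h1 k _) => //; exact: ltW.
have k2 : `|F (line (line X V d) W (d ^+ 2)) - F (line X V d) -
    d ^+ 2 * dir_derive W F X| <= e / 3 * d ^+ 2.
  by apply: (near h2 k _) => //; rewrite sqr_ge0.
have k3 : d * (w + e / 3) <= e / 3.
  have : d < e / 3 / (w + e / 3 + 1) by exact: (near h3 k _).
  rewrite ltr_pdivlMr// => /ltW; apply: le_trans.
  by rewrite ler_wpM2l ?lerDl// ltW.
rewrite -(ler_pM2l d0) -{1}(gtr0_norm d0) -normrM.
have -> : d * (dir_derive V F X - (F (line (line X V d) W (d ^+ 2)) - F X) / d) =
   d * dir_derive V F X - (F (line (line X V d) W (d ^+ 2)) - F X).
  by field; rewrite gt_eqF.
have k4 : d ^+ 2 * (w + e / 3) <= d * (e / 3).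
  by rewrite expr2 -mulrA ler_wpM2l// ltW.
have k5 : `|d ^+ 2 * dir_derive W F X| <= d ^+ 2 * w.
  by rewrite normrM ger0_norm ?sqr_ge0.
move: k1 k2 k4 k5; rewrite !ler_norml.
set a := F X; set b := F (line X V d); set c := F (line _ _ _).
set x := dir_derive V F X; set y := _ * dir_derive W F X.
move=> /andP[? ?] /andP[? ?] ? /andP[? ?].
by apply/andP; split; lra.
Unshelve. all: by end_near. Qed.

Lemma line_scale X V (c t : R) : line X (c%:C%C *: V) t = line X V (c * t).
Proof. by rewrite /line scalerA -rcME mulrC. Qed.

Lemma dir_deriveZ U F X V (c : R) : smooth_on U F -> U X ->
  dir_derive (c%:C%C *: V) F X = c * dir_derive V F X.
Proof.
move=> sF UX; have h := smooth_is_derive V sF UX.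
have dc : is_derive (0 : R) 1 (fun t : R => c * t) c.
  by apply: is_derive_eq; rewrite /GRing.scale/= mulr1.
have h2 : is_derive (0 : R) 1 ((fun t => F (line X V t)) \o (fun t : R => c * t))
    (dir_derive V F X * c).
  by apply: is_derive1_comp; rewrite ?mulr0.
have h3 := smooth_is_derive (c%:C%C *: V) sF UX.
have e : (fun t => F (line X (c%:C%C *: V) t)) =
    (fun t => F (line X V t)) \o (fun t : R => c * t).
  by apply/funext => t /=; rewrite line_scale.
rewrite e in h3; have e3 := @derive_val _ _ _ _ _ _ _ h3.
have e2 := @derive_val _ _ _ _ _ _ _ h2.
by rewrite -[LHS]e3 [LHS]e2 mulrC.
Qed.

Definition qpath V0 V1 V2 (e : R) : mat := V0 + e%:C%C *: V1 + (e ^+ 2)%:C%C *: V2.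

Lemma dir_derive_qpath U F X V0 V1 V2 e : open U -> smooth_on U F -> U X ->
  dir_derive (qpath V0 V1 V2 e) F X =
  dir_derive V0 F X + e * dir_derive V1 F X + e ^+ 2 * dir_derive V2 F X.
Proof.
move=> oU sF UX; rewrite /qpath (dir_deriveD _ _ oU sF UX).
by rewrite (dir_deriveD _ _ oU sF UX) !(dir_deriveZ _ _ sF UX).
Qed.

Lemma dir_derive_lin U F G V c X : smooth_on U F -> smooth_on U G -> U X ->
  dir_derive V (fun X => F X + c * G X) X = dir_derive V F X + c * dir_derive V G X.
Proof.
move=> sF sG UX; have h := smooth_is_derive V sF UX; have k := smooth_is_derive V sG UX.
have hk : is_derive (0 : R) 1 (fun t => F (line X V t) + c * G (line X V t))
    (dir_derive V F X + c * dir_derive V G X).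
  by apply: is_deriveD; apply: (@is_deriveZ _ _ _ (fun t => G (line X V t)) c).
by rewrite {1}/dir_derive derive1E; exact: derive_val.
Qed.

Lemma dir_derives_lin U F G Vs c X : open U -> smooth_on U F -> smooth_on U G ->
  U X -> dir_derives Vs (fun X => F X + c * G X) X =
         dir_derives Vs F X + c * dir_derives Vs G X.
Proof.
move=> oU sF sG; elim: Vs X => [//|V Vs IH] X UX.
rewrite [LHS](dir_derive_eq_on V oU IH UX).
have sds H : smooth_on U H -> smooth_on U (dir_derives Vs H).
  move=> sH Ws Y UY; have := sH (Ws ++ Vs) Y UY.
  by rewrite /dir_derives foldr_cat.
exact: (dir_derive_lin V c (sds _ sF) (sds _ sG) UX).
Qed.

Lemma smooth_lin U F G c : open U -> smooth_on U F -> smooth_on U G ->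
  smooth_on U (fun X => F X + c * G X).
Proof.
move=> oU sF sG Vs X UX.
have e Y : U Y -> dir_derives Vs (fun X => F X + c * G X) Y =
    dir_derives Vs F Y + c * dir_derives Vs G Y.
  by move=> UY; exact: dir_derives_lin oU sF sG UY.
have [cF dF] := sF Vs X UX; have [cG dG] := sG Vs X UX; split.
  change (dir_derives Vs (fun X => F X + c * G X) Y @[Y --> X] -->
    dir_derives Vs (fun X => F X + c * G X) X).
  rewrite (e X UX).
  apply: (@cvg_trans _ (dir_derives Vs F Y + c * dir_derives Vs G Y @[Y --> X])).
    apply: (@near_eq_cvg _ _ (nbhs X)).
    by apply: filterS (open_nbhs_nbhs (conj oU UX)) => Y /e.
  exact: (cvgD cF (cvgM (cvg_cst c) cG)).
move=> V; apply: (@near_eq_derivable _ _ _ (fun t => dir_derives Vs F (line X V t) +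
   c * dir_derives Vs G (line X V t))).
  by apply: filterS (near_line V oU UX) => t Ut; rewrite e.
by apply: derivableD; [exact: dF|apply: derivableZ; exact: dG].
Qed.

Lemma dir_derive_mull (g : mat) V F :
  dir_derive V (fun X => F (g *m X)) =
  fun X => dir_derive (g *m V) F (g *m X).
Proof.
apply/funext => X; rewrite /dir_derive; congr (derive1 _ 0).
by apply/funext => t; rewrite mulmxDr -scalemxAr.
Qed.

Lemma dir_derives_mull (g : mat) Vs F :
  dir_derives Vs (fun X => F (g *m X)) =
  fun X => dir_derives (map (fun V => g *m V) Vs) F (g *m X).
Proof.
elim: Vs => [//|V Vs IH]; rewrite [LHS]/= IH.
exact: (dir_derive_mull g V (dir_derives (map (fun V => g *m V) Vs) F)).
Qed.

Lemma mull_continuous (g : mat) : continuous (fun X : mat => g *m X : mat).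
Proof. move=> X.
by apply: (@cvg_mulmx _ _ (nbhs X) _ _ _ _ (fun=> g) id g X); [exact: cvg_cst|exact: cvg_id]. Qed.

Lemma open_mull (g : mat) U : open U -> open [set X : mat | U (g *m X)].
Proof. by move=> oU; apply: open_comp => // X _; exact: mull_continuous. Qed.

Lemma smooth_mull (g : mat) U F : smooth_on U F ->
  smooth_on [set X : mat | U (g *m X)] (fun X => F (g *m X)).
Proof.
move=> sF Vs X /= UX; rewrite dir_derives_mull.
have [c d] := sF (map (fun V => g *m V) Vs) (g *m X) UX; split.
  exact: (@cvg_comp _ _ _ (fun Y : mat => g *m Y : mat)
    (dir_derives (map (fun V => g *m V) Vs) F) (nbhs X) (nbhs (g *m X)) _
    (@mull_continuous g X) c).
move=> V; apply: near_eq_derivable (d (g *m V)).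
by apply: (@filterE _ (nbhs (0 : R))) => t; rewrite mulmxDr -scalemxAr.
Qed.

(** Real rational functions whose denominators do not vanish on U: a class of
    functions closed under directional derivatives, hence made of smooth
    functions. *)
Inductive ratf U : (mat -> R) -> Prop :=
| ratf_cst c : ratf U (fun=> c)
| ratf_lin L : continuous L ->
    (forall X V t, L (line X V t) = L X + t * L V) -> ratf U L
| ratf_add F G : ratf U F -> ratf U G -> ratf U (fun X => F X + G X)
| ratf_mul F G : ratf U F -> ratf U G -> ratf U (fun X => F X * G X)
| ratf_inv F : ratf U F -> (forall X, U X -> F X != 0) ->
    ratf U (fun X => (F X)^-1).

Lemma ratf_continuous U F X : ratf U F -> U X -> {for X, continuous F}.
Proof.
move=> rF UX; elim: rF => {F} [c|L cL _|F G _ cF _ cG|F G _ cF _ cG|F _ cF F0].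
- exact: (@cst_continuous _ _ c X).
- exact: cL.
- exact: (cvgD cF cG).
- exact: (cvgM cF cG).
- exact: (cvgV (F0 X UX) cF).
Qed.

Lemma ratf_derive U F V : ratf U F -> exists2 G, ratf U G &
  forall X, U X -> is_derive (0 : R) (1 : R) (fun t => F (line X V t)) (G X).
Proof.
elim=> {F} [c|L cL lL|F G rF [F' rF' dF] rG [G' rG' dG]
  |F G rF [F' rF' dF] rG [G' rG' dG]|F rF [F' rF' dF] F0].
- exists (fun=> 0); [exact: ratf_cst|move=> X _; exact: is_derive_cst].
- exists (fun=> L V); first exact: ratf_cst.
  move=> X _; rewrite (_ : (fun t => _) = cst (L X) + (L V \*: id)); last first.
    by apply/funext => t; rewrite lL mulrC.
  by apply: is_derive_eq; rewrite add0r /GRing.scale/= mulr1.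
- exists (fun X => F' X + G' X); first exact: ratf_add.
  by move=> X UX; apply: is_deriveD; [exact: dF|exact: dG].
- exists (fun X => F X * G' X + G X * F' X).
    by apply: ratf_add; exact: ratf_mul.
  move=> X UX; have := is_deriveM (dF X UX) (dG X UX).
  by rewrite line0.
- exists (fun X => (- 1) * (F X)^-1 * (F X)^-1 * F' X).
    apply: ratf_mul => //; apply: ratf_mul; last exact: ratf_inv.
    by apply: ratf_mul; [exact: ratf_cst|exact: ratf_inv].
  move=> X UX; have := @is_deriveV R (fun t => F (line X V t)) 0 (F' X) 1.
  rewrite line0 => /(_ (F0 X UX) (dF X UX)).
  by rewrite /GRing.scale/= -exprVn expr2 !mulN1r !mulNr.
Qed.

Lemma ratf_smooth U F : open U -> ratf U F -> smooth_on U F.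
Proof.
move=> oU rF.
have key Vs : exists2 G, ratf U G & forall X, U X -> dir_derives Vs F X = G X.
  elim: Vs => [|V Vs [G rG e]]; first by exists F.
  have [G' rG' dG] := ratf_derive V rG; exists G' => // X UX.
  rewrite [LHS](dir_derive_eq_on V oU e UX) /dir_derive derive1E.
  exact: (@derive_val _ _ _ _ _ _ _ (dG X UX)).
move=> Vs X UX; have [G rG e] := key Vs; split.
  change (dir_derives Vs F Y @[Y --> X] --> dir_derives Vs F X).
  rewrite (e X UX); apply: (cvg_trans _ (ratf_continuous rG UX)).
  apply: (@near_eq_cvg _ _ (nbhs X) _ G (dir_derives Vs F)).
  by apply: filterS (open_nbhs_nbhs (conj oU UX)) => Y /e.
move=> V; have [G' rG' dG] := ratf_derive V rG.
apply: (@near_eq_derivable _ _ _ (fun t => G (line X V t))).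
  by apply: filterS (near_line V oU UX) => t Ut; rewrite e.
by have [] := dG X UX.
Qed.

End Smooth.

(** * Translation along a quadratic path of matrices *)

Section Path.
Variables (R : realType) (n : nat).
Local Notation mat := (mat R n).
Implicit Types (F G : mat -> R) (X V W : mat) (U : set mat).
Variables (g0 g1 g2 : mat).
Local Notation gp := (qpath g0 g1 g2).

Lemma qpath_mul e V : gp e *m V = qpath (g0 *m V) (g1 *m V) (g2 *m V) e.
Proof. by rewrite /qpath !mulmxDl -!scalemxAl. Qed.

Lemma qpath0 : gp 0 = g0.
Proof. by rewrite /qpath expr0n !rc0E !scale0r !addr0. Qed.

Lemma qpath_continuous : continuous gp.
Proof.
move=> e; change (line (line g0 g1 d) g2 (d ^+ 2) @[d --> e] -->
  line (line g0 g1 e) g2 (e ^+ 2)).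
apply: cvg_line; [|exact: cvg_cst|].
  by apply: cvg_line; [exact: cvg_cst|exact: cvg_cst|exact: cvg_id].
exact: (@exprn_continuous R 2 e).
Qed.

Lemma cvg_path X : gp p.2 *m p.1 @[p --> (X, (0 : R))] --> (g0 *m X : mat).
Proof.
rewrite -{2}qpath0; apply: cvg_mulmx; last exact: cvg_fst.
by apply: (cvg_comp _ _ cvg_snd); exact: qpath_continuous.
Qed.

Lemma near_path U X : open U -> U (g0 *m X) ->
  \forall p \near (X, (0 : R)), U (gp p.2 *m p.1).
Proof. by move=> oU UX; apply: cvg_path; exact: open_nbhs_nbhs. Qed.

Lemma smooth_path U F X : open U -> smooth_on U F -> U (g0 *m X) ->
  F (gp p.2 *m p.1) @[p --> (X, (0 : R))] --> (F (g0 *m X) : R).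
Proof.
move=> oU sF UX; apply: (cvg_comp _ _ (@cvg_path X)).
exact: (smooth_cont sF UX).
Qed.

Lemma cvg_eps X : p.2 @[p --> (X, (0 : R))] --> (0 : R).
Proof. exact: cvg_snd. Qed.

(** Convergence of a derivative along a path of directions reduces to this: by
    linearity in the direction, the corrections carry the factors e and e^2. *)
Lemma cvg_qcomb X (a b c : mat * R -> R) (l m k : R) :
  a p @[p --> (X, (0 : R))] --> l -> b p @[p --> (X, (0 : R))] --> m ->
  c p @[p --> (X, (0 : R))] --> k ->
  a p + p.2 * b p + p.2 ^+ 2 * c p @[p --> (X, (0 : R))] --> l.
Proof.
move=> al bm ck; have ee := @cvg_eps X.
have h : a p + p.2 * b p + p.2 * p.2 * c p @[p --> (X, (0 : R))] -->
    l + 0 * m + 0 * 0 * k.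
  exact: (cvgD (cvgD al (cvgM ee bm)) (cvgM (cvgM ee ee) ck)).
rewrite !mul0r !addr0 in h; apply: (cvg_trans _ h).
apply: (@near_eq_cvg _ _ (nbhs (X, (0 : R)))); apply: filterE => p /=.
by rewrite expr2.
Qed.

Lemma smooth_path1 U F X V : open U -> smooth_on U F -> U (g0 *m X) ->
  dir_derive (gp p.2 *m V) F (gp p.2 *m p.1) @[p --> (X, (0 : R))] -->
  (dir_derive (g0 *m V) F (g0 *m X) : R).
Proof.
move=> oU sF UX.
have h (W : mat) := smooth_path oU (smooth_dd W sF) UX.
apply: (cvg_trans _ (cvg_qcomb (h (g0 *m V)) (h (g1 *m V)) (h (g2 *m V)))).
apply: near_eq_cvg; apply: filterS (near_path oU UX) => p Up.
by rewrite (qpath_mul p.2 V) (dir_derive_qpath _ _ _ _ oU sF Up).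
Qed.

Lemma smooth_path2 U F X V W : open U -> smooth_on U F -> U (g0 *m X) ->
  dir_derive (gp p.2 *m V) (dir_derive (gp p.2 *m W) F) (gp p.2 *m p.1)
    @[p --> (X, (0 : R))] -->
  (dir_derive (g0 *m V) (dir_derive (g0 *m W) F) (g0 *m X) : R).
Proof.
move=> oU sF UX.
have h (Y : mat) := smooth_path1 (V := V) oU (smooth_dd Y sF) UX.
apply: (cvg_trans _ (cvg_qcomb (h (g0 *m W)) (h (g1 *m W)) (h (g2 *m W)))).
apply: near_eq_cvg; apply: filterS (near_path oU UX) => p Up.
have e Y : U Y -> dir_derive (gp p.2 *m W) F Y =
    (dir_derive (g0 *m W) F Y + p.2 * dir_derive (g1 *m W) F Y)
     + p.2 ^+ 2 * dir_derive (g2 *m W) F Y.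
  by move=> UY; rewrite (qpath_mul p.2 W) (dir_derive_qpath _ _ _ _ oU sF UY).
rewrite [RHS](dir_derive_eq_on _ oU e Up).
have s0 := smooth_dd (g0 *m W) sF; have s1 := smooth_dd (g1 *m W) sF.
have s2 := smooth_dd (g2 *m W) sF.
rewrite (dir_derive_lin _ _ (smooth_lin p.2 oU s0 s1) s2 Up).
by rewrite (dir_derive_lin _ _ s0 s1 Up).
Qed.

(** Written as a combination F + c G so that [smooth_lin] applies to it. *)
Definition Fdiff F (e : R) X := F (gp e *m X) + (-1) * F (g0 *m X).

Definition Udiff U (e : R) : set mat :=
  [set X : mat | U (gp e *m X)] `&` [set X : mat | U (g0 *m X)].

Lemma open_Udiff U e : open U -> open (Udiff U e).
Proof. by move=> oU; apply: openI; exact: open_mull. Qed.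

Lemma smooth_subset U U' F : U' `<=` U -> smooth_on U F -> smooth_on U' F.
Proof. by move=> UU sF Vs X /UU; exact: sF. Qed.

Lemma smooth_Fdiff U F e : open U -> smooth_on U F ->
  smooth_on (Udiff U e) (Fdiff F e).
Proof.
move=> oU sF.
have s1 : smooth_on (Udiff U e) (fun X => F (gp e *m X)).
  by apply: smooth_subset (@subIsetl _ _ _) _; exact: smooth_mull.
have s2 : smooth_on (Udiff U e) (fun X => F (g0 *m X)).
  by apply: smooth_subset (@subIsetr _ _ _) _; exact: smooth_mull.
exact (@smooth_lin R n _ _ _ (-1) (@open_Udiff U e oU) s1 s2).
Qed.

Lemma dir_derives_Fdiff U F e Vs X : open U -> smooth_on U F -> Udiff U e X ->
  dir_derives Vs (Fdiff F e) X =
  dir_derives (map (fun V => gp e *m V) Vs) F (gp e *m X) +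
  (-1) * dir_derives (map (fun V => g0 *m V) Vs) F (g0 *m X).
Proof.
move=> oU sF UX.
have s1 : smooth_on (Udiff U e) (fun X => F (gp e *m X)).
  by apply: smooth_subset (@subIsetl _ _ _) _; exact: smooth_mull.
have s2 : smooth_on (Udiff U e) (fun X => F (g0 *m X)).
  by apply: smooth_subset (@subIsetr _ _ _) _; exact: smooth_mull.
have := @dir_derives_lin R n _ _ _ Vs (-1) X (@open_Udiff U e oU) s1 s2 UX.
by rewrite !dir_derives_mull.
Qed.

Lemma near_small (X : mat) (d : R) (H : mat * R -> R) (h : mat -> R) : 0 < d ->
  H p @[p --> (X, (0 : R))] --> h X -> h Y @[Y --> X] --> h X ->
  \forall p \near (X, (0 : R)), `|H p + (-1) * h p.1| < d.
Proof.
move=> d0 Hh hh.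
have c : H p + (-1) * h p.1 @[p --> (X, (0 : R))] --> h X + (-1) * h X.
  apply: cvgD => //; apply: cvgM; first exact: cvg_cst.
  by apply: (cvg_comp _ _ cvg_fst).
rewrite mulN1r subrr in c.
exact: (cvgr0_norm_lt _ c).
Qed.

(** Locally around each X of the compact set Q the bound holds for (X', e) near
    (X, 0), by joint continuity of the derivatives; compactness makes the bound on
    e uniform. *)
Lemma near_Fdiff U F (Q : set mat) d Vs :
  open U -> smooth_on U F -> 0 < d ->
  (forall X, Q X -> U (g0 *m X)) -> compact Q -> (size Vs <= 2)%N ->
  \forall e \near (0 : R), Q `<=` [set X | `|dir_derives Vs (Fdiff F e) X| < d].
Proof.
move=> oU sF d0 QU cQ s2.
move/compact_near_coveringP : cQ => /(_ R (nbhs (0 : R)) (fun e X => `|dir_derives Vs (Fdiff F e) X| < d)).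
apply=> X QX; have UX := QU X QX.
have UX2 : \forall p \near (X, (0 : R)), Udiff U p.2 p.1.
  apply: filterI; first exact: near_path.
  have : (g0 *m p.1 : mat) @[p --> (X, (0 : R))] --> (g0 *m X : mat).
    by apply: (cvg_comp _ _ cvg_fst); exact: mull_continuous.
  by apply; exact: open_nbhs_nbhs.
have : \forall p \near (X, (0 : R)),
   `|dir_derives (map (fun V => gp p.2 *m V) Vs) F (gp p.2 *m p.1) +
     (-1) * dir_derives (map (fun V => g0 *m V) Vs) F (g0 *m p.1)| < d.
  apply: (@near_small X d (fun p => dir_derives (map (fun V => gp p.2 *m V) Vs) F (gp p.2 *m p.1))
     (fun Y => dir_derives (map (fun V => g0 *m V) Vs) F (g0 *m Y))) => //.
    case: Vs s2 => [|V [|W []]]// _ /=; first exact: smooth_path oU sF UX.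
      exact: smooth_path1 oU sF UX.
    exact: smooth_path2 oU sF UX.
  have [c _] := sF (map (fun V => g0 *m V) Vs) _ UX.
  exact: (cvg_comp _ _ (@mull_continuous _ _ g0 X) c).
move=> h; apply: filterS2 h UX2 => p hp Up.
by rewrite /= (dir_derives_Fdiff _ oU sF Up).
Qed.

Definition basis_vec (p : (bool * 'I_n.+2 * 'I_n.+2)%type) : mat :=
  let D : mat := delta_mx p.1.2 p.2 in if p.1.1 then ('i%C : R[i]) *: D else D.

Lemma real_basisP V : real_basis V -> exists p, V = basis_vec p.
Proof. by move=> [j [k [->|->]]]; [exists (false, j, k)|exists (true, j, k)]. Qed.

Lemma near_C2 U F (Q : set mat) d :
  open U -> smooth_on U F -> 0 < d ->
  (forall X, Q X -> U (g0 *m X)) -> compact Q ->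
  \forall e \near (0 : R), forall X V W, Q X -> real_basis V -> real_basis W ->
    [/\ `|Fdiff F e X| < d, `|dir_derive V (Fdiff F e) X| < d
      & `|dir_derive V (dir_derive W (Fdiff F e)) X| < d].
Proof.
move=> oU sF d0 QU cQ.
have h0 := @near_Fdiff U F Q d [::] oU sF d0 QU cQ isT.
have h1 : \forall e \near (0 : R), forall p,
    Q `<=` [set X | `|dir_derives [:: basis_vec p] (Fdiff F e) X| < d].
  apply: (@filter_forall _ _ _ (nbhs (0 : R))) => p.
  exact (@near_Fdiff U F Q d [:: basis_vec p] oU sF d0 QU cQ isT).
have h2 : \forall e \near (0 : R), forall p q,
    Q `<=` [set X | `|dir_derives [:: basis_vec p; basis_vec q] (Fdiff F e) X| < d].
  apply: (@filter_forall _ _ _ (nbhs (0 : R))) => p.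
  apply: (@filter_forall _ _ _ (nbhs (0 : R))) => q.
  exact (@near_Fdiff U F Q d [:: basis_vec p; basis_vec q] oU sF d0 QU cQ isT).
apply: filterS3 h0 h1 h2 => e h0 h1 h2 X V W QX /real_basisP[p ->] /real_basisP[q ->].
by split; [exact: h0|exact: h1|exact: h2].
Qed.

End Path.

(** * Compactness of K *)

Section Unitary.
Variables (R : realType) (n : nat).
Local Notation mat := (mat R n).
Local Notation K := (R[i] : numFieldType).

Lemma box_compact : compact [set c : K | `|complex.Re c| <= 1 /\ `|complex.Im c| <= 1].
Proof.
pose f (p : R * R) : K := p.1%:C%C + 'i%C * p.2%:C%C.
have fc : continuous f.
  move=> p; apply: cvgD.
    by apply: (cvg_comp _ _ cvg_fst); exact: real_complex_continuous.
  apply: cvgM; first exact: cvg_cst.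
  by apply: (cvg_comp _ _ cvg_snd); exact: real_complex_continuous.
have cI : compact (`[-1, 1]%classic : set R) by exact: segment_compact.
have := continuous_compact (continuous_subspaceT fc) (compact_setX cI cI).
congr compact; apply/seteqP; split.
  move=> _ [[a b] /= [+ +] <-]; rewrite !in_itv/= => /andP[? ?] /andP[? ?].
  rewrite /f/= !ler_norml; simpc.
  by split; apply/andP.
move=> [a b] /= [a1 b1]; exists (a, b); last by rewrite /f/=; simpc.
by rewrite /= !in_itv/= -!ler_norml.
Qed.

Lemma mbox_compact :
  compact [set X : mat | forall i j, `|complex.Re (X i j)| <= 1 /\ `|complex.Im (X i j)| <= 1].
Proof.
have := @rV_compact K (n.+2 * n.+2) (fun=> [set c : K | `|complex.Re c| <= 1 /\ `|complex.Im c| <= 1])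
  (fun=> box_compact).
have vc : continuous (fun v : 'rV[K]_(n.+2 * n.+2) => vec_mx v : mat).
  apply: continuous_mx => i j; under eq_fun do rewrite mxE.
  exact: coord_continuous.
move=> /(continuous_compact (continuous_subspaceT vc)).
congr compact; apply/seteqP; split.
  by move=> _ [v /= hv <-] i j; rewrite mxE; exact: hv.
move=> X hX; exists (mxvec X); last by rewrite mxvecK.
move=> i /=; case/mxvec_indexP: i => i j; rewrite mxvecE; exact: hX.
Qed.

Lemma conj_continuous : continuous (fun c : K => (c : R[i])^* : K).
Proof.
move=> x A /nbhs_ballP[e /= e0 eA]; rewrite nbhs_filterE.
apply/nbhs_ballP; exists e => //= y /= xy; apply: eA.
by rewrite /ball/= -rmorphB norm_conjC.
Qed.

Lemma trC_continuous : continuous (fun X : mat => X^t* : mat).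
Proof.
apply: continuous_mx => i j X; under eq_fun do rewrite !mxE.
apply: (cvg_comp _ _ (@coord_continuous K _ _ j i X)).
exact: conj_continuous.
Qed.

Lemma det_continuous : continuous (fun X : mat => \det X : K).
Proof.
move=> X; apply: (@cvg_bigsum K _ (nbhs X) (nbhs_filter X)) => s.
apply: (@cvgM K _ (nbhs X) (nbhs_filter X) (fun=> (-1) ^+ s)); first exact: cvg_cst.
apply: (@cvg_big K _ *%R 1 predT _ _ (nbhs X)).
  by move=> x; exact: mul_continuous.
by move=> i _; exact: coord_continuous.
Qed.

Lemma closed_eq_fun (T : topologicalType) (V : topologicalType) (f : T -> V) c :
  hausdorff_space V -> continuous f -> closed [set x | f x = c].
Proof.
move=> hV fc; apply: (@closed_comp _ _ f [set c]); first by move=> x _; exact: fc.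
exact/accessible_closed_set1/hausdorff_accessible.
Qed.

Lemma mat_hausdorff : hausdorff_space mat.
Proof. exact: norm_hausdorff. Qed.

Definition unitary_SU : set mat := [set k : mat | in_SU k /\ k^t* *m k = 1%:M].

(** A closed subset of the matrices whose entries have norm at most 1. *)
Lemma unitary_SU_compact : compact unitary_SU.
Proof.
have c1 : closed [set k : mat | (k^t* *m Jform R n *m k : mat) = Jform R n].
  apply: closed_eq_fun; first exact: mat_hausdorff.
  apply: continuous_mulmx; last by move=> X; exact: cvg_id.
  apply: continuous_mulmx; first exact: trC_continuous.
  exact: cst_continuous.
have c2 : closed [set k : mat | (\det k : K) = 1].
  apply: closed_eq_fun; [exact: norm_hausdorff|exact: det_continuous].
have c3 : closed [set k : mat | (k^t* *m k : mat) = 1%:M].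
  apply: closed_eq_fun; first exact: mat_hausdorff.
  by apply: continuous_mulmx; [exact: trC_continuous|move=> X; exact: cvg_id].
apply: (subclosed_compact _ mbox_compact); last first.
  move=> k [_ k1] i j.
  have kij : `|k i j| <= 1.
    have := congr1 (fun A : mat => A j j) k1; rewrite mxE [in RHS]mxE eqxx => e.
    rewrite -(@ler_pXn2r _ 2)// ?nnegrE// expr1n -[leRHS]e (bigD1 i)//=.
    rewrite normCK !mxE mulrC lerDl; apply: sumr_ge0 => l _.
    by rewrite !mxE mulrC -normCK exprn_ge0.
  split; rewrite -(lecR _ 1); apply: le_trans kij; [exact: Re_le_norm|exact: Im_le_norm].
have -> : unitary_SU = [set k : mat | (k^t* *m Jform R n *m k : mat) = Jform R n]
   `&` [set k : mat | (\det k : K) = 1] `&` [set k : mat | (k^t* *m k : mat) = 1%:M].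
  apply/seteqP; split=> k.
    by move=> [/andP[/eqP ? /eqP ?] ?].
  by move=> [[/= a b] c]; split=> //; apply/andP; split; apply/eqP.
by apply: closedI => //; exact: closedI.
Qed.

Lemma conjK_compact (x : SU R n) :
  compact ([set SUval k | k in conj_set x (@K0 R n)]).
Proof.
pose f (k : mat) : mat := SUval x *m k *m SUval x^-1%g.
have fc : continuous f.
  apply: continuous_mulmx; last exact: cst_continuous.
  by apply: continuous_mulmx; [exact: cst_continuous|move=> k; exact: cvg_id].
have := continuous_compact (continuous_subspaceT fc) unitary_SU_compact.
congr compact; apply/seteqP; split.
  move=> _ [k [kSU k1] <-]; exists (x * MkSU kSU * x^-1)%g => //.
  by exists (MkSU kSU).
move=> _ [_ [k kK <-] <-]; exists (SUval k) => //; split=> //.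
by case: k {kK}.
Qed.

End Unitary.

(** * Closedness and characters of N *)

Section Charac.
Variables (R : realType) (n : nat).
Local Notation C := (R[i] : numClosedFieldType).
Local Notation vec := 'cV[C]_n.+2.
Local Notation G := (SU R n).
Local Notation eP := (eP C n).
Local Notation eM := (eM C n).

Lemma act_nu (g : G) (z : vec) (t : C) v :
  SUval g = @nu C n z t -> act g v = nu z t *m v.
Proof. by move=> e; rewrite actE e. Qed.

(** Unlike the description by coordinates, these equations are visibly closed
    conditions on the entries of g. *)
Lemma N0_linear (g : G) : N0 g <-> act g eP = eP /\
  forall u v : vec, perp u -> perp v -> hdot u (act g v) = hdot u v.
Proof.
split.
  move=> /N0P[z [t [zt e]]]; split; first by rewrite (act_nu _ e) nuP.
  move=> u v up [vP vM]; rewrite (act_nu _ e) nuE vP mulr0 !scale0r !addr0.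
  by rewrite !hdotlin (perpC up).1 mulr0 oppr0 addr0.
move=> [gP gperp]; apply/N0P; apply: isom_nu; first exact: SU_form.
  by rewrite -actE.
by move=> u v; rewrite -actE; exact: gperp.
Qed.

End Charac.

Section Conjugation.
Variables (R : realType) (n : nat) (x : SU R n).
Local Notation C := (R[i] : numClosedFieldType).
Local Notation K := (R[i] : numFieldType).
Local Notation vec := 'cV[C]_n.+2.
Local Notation G := (SU R n).
Local Notation eP := (eP C n).
Local Notation eM := (eM C n).
Local Notation mat := (mat R n).

(** Transports the decomposition K = x K0 x^-1, and so on, to the standard one. *)
Definition untwist (g : G) : G := (x^-1 * g * x)%g.

Lemma untwistM g h : untwist (g * h)%g = (untwist g * untwist h)%g.
Proof. by rewrite /untwist -!mulgA mulVKg. Qed.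
Lemma untwist1 : untwist 1%g = 1%g.
Proof. by rewrite /untwist mulg1 mulVg. Qed.
Lemma untwistV g : untwist g^-1%g = (untwist g)^-1%g.
Proof. by rewrite /untwist !invgM invgK mulgA. Qed.
Lemma untwist_inj : injective untwist.
Proof. by move=> g h /mulIg/mulgI. Qed.
Definition twist (g : G) : G := (x * g * x^-1)%g.
Lemma SUval_twist g : SUval (twist g) = SUval x *m SUval g *m SUval x^-1%g.
Proof. by rewrite !SUvalM. Qed.
Lemma twistK g : untwist (twist g) = g.
Proof. by rewrite /untwist /twist -!mulgA mulKg mulVg mulg1. Qed.

Lemma conj_setP (S : set G) g : conj_set x S g <-> S (untwist g).
Proof.
split; first by move=> [s Ss <-]; rewrite -/(twist s) twistK.
by move=> Sg; exists (untwist g) => //; apply: untwist_inj; rewrite -/(twist _) twistK.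
Qed.

Lemma SUval_continuous : continuous (fun g : G => SUval g : mat).
Proof. exact: initial_continuous. Qed.

(** The functions used on G are rational in these functionals, which extend
    linearly to the whole matrix space. *)
Definition untwist_coef (u v : vec) (X : mat) : C :=
  (u^t* *m formJ C n *m SUval x^-1%g *m X *m (SUval x *m v)) 0 0.

Lemma untwist_coefE u v (g : G) : untwist_coef u v (SUval g) = hdot u (act (untwist g) v).
Proof. by rewrite /untwist_coef /hdot actE /untwist !SUvalM !mulmxA. Qed.

Lemma untwist_coef_continuous u v : continuous (untwist_coef u v : mat -> K).
Proof.
have c : continuous (fun X : mat =>
    (u^t* *m formJ C n *m SUval x^-1%g : 'rV[K]_n.+2) *m X *m
    (SUval x *m v : 'cV[K]_n.+2)).
  apply: continuous_mulmx; last exact: cst_continuous.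
  by apply: continuous_mulmx; [exact: cst_continuous|move=> X; exact: cvg_id].
by move=> X; exact: (cvg_comp _ _ (c X) (@coord_continuous K _ _ 0 0 _)).
Qed.

Lemma untwist_coef_line u v X V (t : R) :
  untwist_coef u v (line X V t) = untwist_coef u v X + t%:C%C * untwist_coef u v V.
Proof. by rewrite /untwist_coef /line mulmxDr mulmxDl mxE -scalemxAr -scalemxAl [X in _ + X]mxE. Qed.

Lemma closed_untwist_coef u v c : closed [set g : G | hdot u (act (untwist g) v) = c].
Proof.
have -> : [set g : G | hdot u (act (untwist g) v) = c] =
    [set g : G | (untwist_coef u v (SUval g) : K) = c].
  by apply/seteqP; split=> g /=; rewrite untwist_coefE.
apply: closed_eq_fun; first exact: norm_hausdorff.
move=> g; exact: (cvg_comp _ _ (@SUval_continuous g) (@untwist_coef_continuous u v _)).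
Qed.

Lemma hdot_inj (v w : vec) : (forall u, hdot u v = hdot u w) -> v = w.
Proof.
move=> h; apply/colP => i; have := h (delta_mx i 0).
rewrite !hdot_delta_l; case: ifP => _; last by rewrite !mul1r.
by rewrite !mulN1r => /oppr_inj.
Qed.

Lemma N_closed : closed (conj_set x (@N0 R n)).
Proof.
have -> : conj_set x (@N0 R n) =
  (\bigcap_(u in setT) [set g : G | hdot u (act (untwist g) eP) = hdot u eP]) `&`
  (\bigcap_(p in [set p : (vec * vec)%type | perp p.1 /\ perp p.2])
     [set g : G | hdot p.1 (act (untwist g) p.2) = hdot p.1 p.2]).
  apply/seteqP; split=> g.
    move=> /conj_setP/N0_linear[gP gu]; split; first by move=> u _ /=; rewrite gP.
    by move=> [u v] [up vp] /=; exact: gu.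
  move=> [h1 h2]; apply/conj_setP/N0_linear; split.
    by apply: hdot_inj => u; exact: h1.
  by move=> u v up vp; exact: (h2 (u, v)).
by apply: closedI; apply: closed_bigI => ? _; exact: closed_untwist_coef.
Qed.

(** On N this is twice the imaginary part of the product of u with the
    horizontal coordinate, a homomorphism to the real numbers. *)
Definition chi (u : vec) (g : G) : R := complex.Im (hdot u (act (untwist g) eM)).

Lemma chi_nu u g z t : perp u -> @hpt C n z t -> SUval (untwist g) = @nu C n z t ->
  chi u g = 2 * complex.Im (hdot u z).
Proof.
move=> up zt gE; rewrite /chi (act_nu _ gE) nuM// !hdotlin.
have [-> ->] := perpC up; rewrite mulr0 addr0 add0r.
by rewrite !mulr_natl raddfMn.
Qed.

Lemma NP g : conj_set x (@N0 R n) g <->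
  exists z t, @hpt C n z t /\ SUval (untwist g) = @nu C n z t.
Proof. by split; [move=> /conj_setP/N0P|move=> h; apply/conj_setP/N0P]. Qed.

Lemma N_mul g h : conj_set x (@N0 R n) g -> conj_set x (@N0 R n) h ->
  conj_set x (@N0 R n) (g * h)%g.
Proof.
move=> /NP[z [t [zt gE]]] /NP[z' [t' [zt' hE]]]; apply/NP.
exists (z + z'), (t + t' - hdot z z'); split; first exact: hptM.
by rewrite untwistM SUvalM gE hE; exact: nu_mul.
Qed.

Lemma N_inv g : conj_set x (@N0 R n) g -> conj_set x (@N0 R n) g^-1%g.
Proof.
move=> /NP[z [t [zt gE]]]; apply/NP; exists (- z), t^*; split; first exact: hptN.
have e : (untwist g * nuG (hptN zt))%g = 1%g.
  by apply: SU_ext; rewrite SUvalM gE; exact: nuNr.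
have -> : untwist g^-1%g = nuG (hptN zt) by rewrite untwistV -[LHS]mulg1 -e mulKg.
by [].
Qed.

Lemma chiM u g h : perp u -> conj_set x (@N0 R n) g -> conj_set x (@N0 R n) h ->
  chi u (g * h)%g = chi u g + chi u h.
Proof.
move=> up /NP[z [t [zt gE]]] /NP[z' [t' [zt' hE]]].
rewrite (chi_nu up zt gE) (chi_nu up zt' hE).
have e : SUval (untwist (g * h)%g) = @nu C n (z + z') (t + t' - hdot z z').
  by rewrite untwistM SUvalM gE hE; exact: nu_mul.
by rewrite (chi_nu up (hptM zt zt') e) hdotlin raddfD mulrDr.
Qed.

Lemma chi1_ex u : perp u -> u != 0 ->
  exists2 g, conj_set x (@N0 R n) g & chi u g = 1.
Proof.
move=> up u0; have uu0 : hdot u u != 0 by rewrite perp_eq0.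
have uur : hdot u u \is Num.real by rewrite realE perp_ge0.
have [r rE] : exists r : R, hdot u u = r%:C%C by exists (complex.Re (hdot u u)); rewrite RRe_real.
have r0 : r != 0 by rewrite -(rc_eq0 r) -rE.
pose z : vec := (('i%C : C) * (2 * r)^-1%:C%C) *: u.
have zz : (hdot z z)^* = hdot z z by exact: hdotC.
have zt : hpt z (- (hdot z z / 2)).
  split; last by rewrite !conjE zz; field.
  by case: up => a b; rewrite /perp !hdotlin a b mulr0.
exists (twist (nuG zt)); first by apply/NP; exists z, (- (hdot z z / 2)); rewrite twistK.
rewrite (@chi_nu u _ z _ up zt) ?twistK// hdotlin rE -mulrA -rcME.
by rewrite invfM mulfVK//; simpc => /=; rewrite divff// pnatr_eq0.
Qed.

End Conjugation.

(** * Lattices of N *)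

Section Lattice.
Variables (R : realType) (n : nat) (x : SU R n).
Local Notation C := (R[i] : numClosedFieldType).
Local Notation vec := 'cV[C]_n.+2.
Local Notation G := (SU R n).
Local Notation N := (conj_set x (@N0 R n)).
Local Notation chi := (chi x).

Definition half u (r : R) : set G := [set g | N g /\ r <= chi u g].

Lemma half_closed u r : closed (half u r).
Proof.
have -> : half u r = N `&` [set g | r <= chi u g] by [].
apply: closedI; first exact: N_closed.
apply: (@closed_comp _ _ (chi u) [set y | r <= y]); last exact: closed_ge.
move=> g _; have -> : chi u = fun g => complex.Im (untwist_coef x u (eM C n) (SUval g)).
  by apply/funext => h; rewrite untwist_coefE.
apply: (cvg_comp _ _ (cvg_comp _ _ (@SUval_continuous R n g) (@untwist_coef_continuous _ _ x u _ _))).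
exact: Im_continuous.
Qed.

Lemma closed_Borel (B : set G) : closed B -> <<s @open G >> B.
Proof.
move=> cB; rewrite -[B]setCK; apply: sigma_algebraC; apply: sub_sigma_algebra.
exact: closed_openC.
Qed.

(** Suppose L lies in the kernel of the character.  Then the half spaces
    chi >= r of N are unions of cosets of L, and they are translates of each
    other, so they all have the same finite mass.  Letting r tend to +oo shows
    that this mass is 0, and letting r tend to -oo that N has mass 0. *)
Lemma lattice_not_in_hyperplane (L : set G) u : perp u -> u != 0 -> lattice N L ->
  exists2 l, L l & chi u l != 0.
Proof.
move=> up u0 [_ LN [mu [muN0 /andP[muN muNoo] mu_inv]]]; apply: contrapT => h.
have L0 l : L l -> chi u l = 0.
  by move=> Ll; apply/eqP/negPn/negP => l0; apply: h; exists l.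
have satH r : saturated_Borel L (half u r).
  split; first by apply: closed_Borel; exact: half_closed.
  move=> g l [Ng rg] Ll; split; first exact/N_mul/LN.
  by rewrite (chiM up Ng (LN _ Ll)) (L0 l Ll) addr0.
have mH r : measurable (half u r : set (g_sigma_algebraType (saturated_Borel L))).
  exact: (@sub_sigma_algebra _ setT (saturated_Borel L) _ (satH r)).
have [y Ny y1] := chi1_ex x up u0.
have tr r : mu (half u (1 + r)) = mu (half u r).
  rewrite -(mu_inv y _ Ny (satH r)); congr (mu _); apply/seteqP; split.
    move=> g [Ng rg]; exists (y^-1 * g)%g; last by rewrite mulVKg.
    split; first exact/N_mul/Ng/N_inv.
    have := chiM up Ny (N_mul (N_inv Ny) Ng); rewrite mulVKg y1 => e.
    by rewrite -(lerD2l 1) -e.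
  by move=> _ [g [Ng rg] <-]; split; [exact: N_mul|rewrite chiM// y1 lerD2l].
have up_k (k : nat) : mu (half u k%:R) = mu (half u 0).
  by elim: k => // k IH; rewrite -natr1 addrC tr.
have down_k (k : nat) : mu (half u (- k%:R)) = mu (half u 0).
  elim: k => [|k IH]; first by rewrite oppr0.
  by rewrite -IH -[LHS]tr -natr1 opprD addrCA subrr addr0.
have cap0 : \bigcap_k half u k%:R = set0.
  rewrite -subset0 => g gk; have [_] := gk (Num.truncn `|chi u g|).+1 I.
  by rewrite leNgt => /negP[]; apply: le_lt_trans (ler_norm _) _; exact: truncnS_gt.
have cupN : \bigcup_k half u (- k%:R) = N.
  apply/seteqP; split; first by move=> g [k _ []].
  move=> g Ng; exists (Num.truncn `|chi u g|).+1 => //; split=> //.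
  rewrite lerNl; apply: le_trans (ltW (truncnS_gt _)).
  by rewrite -normrN ler_norm.
have mN : measurable (N : set (g_sigma_algebraType (saturated_Borel L))).
  by rewrite -cupN; apply: bigcupT_measurable => k; exact: mH.
have H0oo : (mu (half u 0) < +oo)%E.
  apply: (le_lt_trans _ muNoo).
  by apply: (le_measure mu (mem_set (mH 0)) (mem_set mN)) => g [].
have H0 : mu (half u 0) = 0%E.
  have c := @nonincreasing_cvg_mu _ _ R mu (fun k => half u k%:R) H0oo.
  have {}c : mu (half u k%:R) @[k --> \oo] --> mu (\bigcap_k half u k%:R).
    apply: c => [k||]; first exact: mH.
      by rewrite cap0.
    apply/nonincreasing_seqP => k; apply/subsetPset => g [Ng].
    by move=> kg; split=> //; apply: le_trans kg; rewrite ler_nat.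
  rewrite cap0 measure0 in c.
  have c' : mu (half u k%:R) @[k --> \oo] --> mu (half u 0).
    by under eq_fun do rewrite up_k; exact: cvg_cst.
  exact: (cvg_unique _ c' c).
have : mu N = 0%E.
  have c := @nondecreasing_cvg_mu _ _ R mu (fun k => half u (- k%:R)).
  have {}c : mu (half u (- k%:R)) @[k --> \oo] --> mu (\bigcup_k half u (- k%:R)).
    apply: c => [k||]; first exact: mH.
      by rewrite cupN.
    apply/nondecreasing_seqP => k; apply/subsetPset => g [Ng].
    by move=> kg; split=> //; apply: le_trans kg; rewrite lerN2 ler_nat.
  rewrite cupN in c.
  have c' : mu (half u (- k%:R)) @[k --> \oo] --> 0%E.
    by under eq_fun do rewrite down_k H0; exact: cvg_cst.
  exact: (cvg_unique _ c c').
by move=> e; move: muN; rewrite e ltxx.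
Qed.

End Lattice.

(** * Symplectic transvections of the Heisenberg group *)

Section Shear.
Variables (C : numClosedFieldType) (n : nat).
Local Notation vec := 'cV[C]_n.+2.
Local Notation J := (formJ C n).
Local Notation eP := (eP C n).
Local Notation eM := (eM C n).
Implicit Types (v w z : vec) (a b c t : C).
Variables (u : vec).

Lemma nu_dil a z t : a != 0 -> a^* = a -> hpt z t ->
  nu z t *m dil n a = dil n a *m nu (a^-1 *: z) (a ^- 2 * t).
Proof.
move=> a0 ar zt; have zt' : hpt (a^-1 *: z) (a ^- 2 * t).
  by rewrite -exprVn; apply: hptZ; rewrite ?conjE ?ar.
rewrite (dil_nu a0 ar zt') scalerA divff// scale1r mulrA divff ?mul1r//.
by rewrite expf_neq0.
Qed.

Lemma dil_nu_inj a z t a' z' t' : hpt z t -> hpt z' t' ->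
  dil n a *m nu z t = dil n a' *m nu z' t' -> a' != 0 ->
  [/\ a = a', z = z' & t = t'].
Proof.
move=> zt zt' e a0.
have eqv v := congr1 (fun A : 'M[C]_n.+2 => A *m v) e.
have eqP := eqv eP; rewrite -!mulmxA (nuP zt) (nuP zt') !dilP in eqP.
have aa : a = a'.
  have := congr1 (hdot eM) eqP; rewrite !hdotlin hdote.
  by apply: mulIf; rewrite pnatr_eq0.
have eqM := eqv eM; rewrite -!mulmxA (nuM zt) (nuM zt') aa in eqM.
have {}eqM := congr1 (mulmx (dil n a'^-1)) eqM.
have dd : dil n a'^-1 *m dil n a' = 1%:M.
  by rewrite dil_mul ?invr_eq0// mulVf// dil1.
rewrite !mulmxA dd !mul1mx in eqM.
have [[zP zM] _] := zt; have [[zP' zM'] _] := zt'.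
have tt : t = t'.
  have := congr1 (hdot eM) eqM; rewrite !hdotlin !hdote zM zM' !mulr0 !addr0 !add0r.
  by move=> /(mulIf _) h; apply: (@mulfI _ 2); rewrite ?pnatr_eq0// h ?pnatr_eq0.
split=> //; move: eqM; rewrite tt => /addIr/addrI/(congr1 (fun v => 2^-1 *: v)).
by rewrite !scalerA mulVf ?pnatr_eq0// !scale1r.
Qed.

Lemma an_mul a b z t z' t' : a != 0 -> b != 0 -> b^* = b -> hpt z t -> hpt z' t' ->
  (dil n a *m nu z t) *m (dil n b *m nu z' t') =
  dil n (a * b) *m nu (b^-1 *: z + z') (b ^- 2 * t + t' - hdot (b^-1 *: z) z').
Proof.
move=> a0 b0 br zt zt'.
have zt2 : hpt (b^-1 *: z) (b ^- 2 * t).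
  by rewrite -exprVn; apply: hptZ; rewrite ?conjE ?br.
rewrite -(dil_mul n a0 b0) -(nu_mul zt2 zt') -!mulmxA; congr (_ *m _).
by rewrite !mulmxA (nu_dil b0 br zt).
Qed.

Lemma hpt_an b z t z' t' : b^* = b -> hpt z t -> hpt z' t' ->
  hpt (b^-1 *: z + z') (b ^- 2 * t + t' - hdot (b^-1 *: z) z').
Proof.
move=> br zt zt'; apply: hptM => //.
by rewrite -exprVn; apply: hptZ; rewrite ?conjE ?br.
Qed.

Lemma an_inv a z t : a != 0 -> a^* = a -> hpt z t ->
  (dil n a *m nu z t) *m (dil n a^-1 *m nu (- (a *: z)) (a ^+ 2 * t)^*) = 1%:M.
Proof.
move=> a0 ar zt; have zt' := hptZ ar zt.
rewrite (dil_nu a0 ar zt) -mulmxA (mulmxA (dil n a)) (dilV n a0) mul1mx.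
exact: nuNr.
Qed.

Lemma an_NN z t z' t' : hpt z t -> hpt z' t' ->
  (dil n 1 *m nu z t) *m (dil n 1 *m nu z' t') =
  dil n 1 *m nu (z + z') (t + t' - hdot z z').
Proof. by move=> zt zt'; rewrite dil1 !mul1mx; exact: nu_mul. Qed.

Lemma an_AA a b : a != 0 -> b != 0 ->
  (dil n a *m nu 0 0) *m (dil n b *m nu 0 0) = dil n (a * b) *m nu 0 0.
Proof. by move=> a0 b0; rewrite nu0 !mulmx1 dil_mul. Qed.

Lemma an_AN a z t :
  (dil n a *m nu 0 0) *m (dil n 1 *m nu z t) = dil n a *m nu z t.
Proof. by rewrite nu0 dil1 mulmx1 mul1mx. Qed.

Lemma invM_imag b : (b * 'i)^-1 * 'i = b^-1 :> C.
Proof. by rewrite invfM mulfVK// neq0Ci. Qed.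

Lemma an_mulv a z t v : (dil n a *m nu z t) *m v = dil n a *m (nu z t *m v).
Proof. by rewrite mulmxA. Qed.

Lemma an_eP a z t : hpt z t -> (dil n a *m nu z t) *m eP = a *: eP.
Proof. by move=> zt; rewrite an_mulv (nuP zt) dilP. Qed.

Lemma an_eM a z t : hpt z t -> (dil n a *m nu z t) *m eM =
  a^-1 *: eM + 2 *: z + (2 * t * a) *: eP.
Proof.
move=> zt; rewrite an_mulv (nuM zt) !mulmxDr -!scalemxAr dilM dilP.
by rewrite dil_perp ?scalerA//; case: zt.
Qed.

Lemma mulmx_qpath (X D Y M0 M1 M2 : 'M[C]_n.+2) b c :
  X *m (D *m (M0 + b *: M1 + c *: M2)) *m Y =
  X *m (D *m M0) *m Y + b *: (X *m (D *m M1) *m Y) + c *: (X *m (D *m M2) *m Y).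
Proof. by rewrite !mulmxDr !mulmxDl -!scalemxAr -!scalemxAl. Qed.

Definition om z : C := locked ('i * (hdot u z - hdot z u)).

Lemma om_real z : (om z)^* = om z.
Proof. by rewrite /om -lock conjE conjCi !conjE !hdotC; ring. Qed.
Lemma omD z z' : om (z + z') = om z + om z'.
Proof. by rewrite /om -!lock !hdotlin; ring. Qed.
Lemma omZ a z : a^* = a -> om (a *: z) = a * om z.
Proof. by move=> ar; rewrite /om -!lock !hdotlin ar; ring. Qed.

Variable e : C.
Hypothesis er : e^* = e.
Hypothesis up : perp u.

(** The symplectic transvection of parameter e along u. *)
Definition shear z : vec := locked (z + (e * om z) *: u).
Lemma shearE z : shear z = z + (e * om z) *: u.
Proof. by rewrite /shear -lock. Qed.
(** Only the real part of t changes, to restore the relation t + t^* + |z|^2 = 0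
    for the new horizontal coordinate. *)
Definition shear_t z t : C := t + (hdot z z - hdot (shear z) (shear z)) / 2.

Lemma shear_perp z : perp z -> perp (shear z).
Proof.
move: up => [a b] [c d]; rewrite /perp !shearE !hdotlin a b c d.
by rewrite !mulr0 !addr0.
Qed.

Lemma shearD z z' : shear (z + z') = shear z + shear z'.
Proof. by rewrite !shearE omD; apply/colP => i; rewrite !mxE; ring. Qed.
Lemma shearZ a z : a^* = a -> shear (a *: z) = a *: shear z.
Proof. by move=> ar; rewrite !shearE (omZ _ ar); apply/colP => i; rewrite !mxE; ring. Qed.
Lemma shear0 : shear 0 = 0.
Proof. by rewrite -(scale0r 0) shearZ ?conjE// !scale0r. Qed.

Lemma shear_symplectic z z' :
  hdot (shear z) (shear z') - hdot (shear z') (shear z) = hdot z z' - hdot z' z.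
Proof.
have i2 : 'i * 'i = -1 :> C by rewrite -expr2 sqrCi.
rewrite !shearE !hdotlin !conjE er !om_real.
have -> : hdot u z' = hdot z' u - 'i * om z'.
  by rewrite /om -lock mulrA i2; ring.
have -> : hdot u z = hdot z u - 'i * om z.
  by rewrite /om -lock mulrA i2; ring.
ring.
Qed.

Lemma hpt_shear z t : hpt z t -> hpt (shear z) (shear_t z t).
Proof.
move=> [zp et]; split; first exact: shear_perp.
by rewrite /shear_t !conjE !hdotC -[RHS]et; field.
Qed.

(** The transvection preserves Im <z, z'> but not Re <z, z'>; the change in the
    real part is exactly the polarization of the correction of t. *)
Lemma shear_tM z t z' t' :
  shear_t (z + z') (t + t' - hdot z z') =
  shear_t z t + shear_t z' t' - hdot (shear z) (shear z').
Proof.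
have e1 : hdot (shear z') (shear z) =
    hdot (shear z) (shear z') - hdot z z' + hdot z' z.
  have := shear_symplectic z z' => h.
  set a := hdot (shear z) _ in h *; set b := hdot (shear z') _ in h *.
  have -> : b = a - (a - b) by ring.
  by rewrite h; ring.
rewrite /shear_t shearD !(hdotDl, hdotDr) e1; by field.
Qed.

Lemma shear_tZ a z t : a^* = a -> shear_t (a *: z) (a ^+ 2 * t) = a ^+ 2 * shear_t z t.
Proof. by move=> ar; rewrite /shear_t shearZ// !hdotlin ar; field. Qed.

Lemma shear_an b z z' : b^* = b ->
  shear (b^-1 *: z + z') = b^-1 *: shear z + shear z'.
Proof. by move=> br; rewrite shearD shearZ// conjE br. Qed.

Lemma shear_t_an b z t z' t' : b^* = b ->
  shear_t (b^-1 *: z + z') (b ^- 2 * t + t' - hdot (b^-1 *: z) z') =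
  b ^- 2 * shear_t z t + shear_t z' t' - hdot (b^-1 *: shear z) (shear z').
Proof.
move=> br; have bVr : (b^-1)^* = b^-1 by rewrite conjE br.
by rewrite shear_tM -exprVn shear_tZ// (shearZ _ bVr).
Qed.

Lemma shear_t0 t : shear_t 0 t = t.
Proof. by rewrite /shear_t shear0 !hdot0r subrr mul0r addr0. Qed.

(** The deformed element is a quadratic polynomial in the parameter e. *)
Lemma nu_shear z t :
  nu (shear z) (shear_t z t) = nu z t
   + e *: (heisY (om z *: u) + heisZ n (- om z * (hdot z u + hdot u z) / 2))
   + e ^+ 2 *: heisZ n (- om z ^+ 2 * hdot u u / 2).
Proof.
apply: mulmx_ext => v; rewrite !mulmxDl -!scalemxAl mulmxDl !heisZE heisYE !nuE.
rewrite /shear_t !shearE !hdotlin !conjE er om_real.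
by apply/colP => i; rewrite !mxE; field.
Qed.

(** Affine in the coordinates, so that the curves th |-> (th z, th^2 t) are
    quadratic in th. *)
Lemma nv_expand z t : nv z t = 1%:M + J *m heisY z *m J + J *m heisZ n t *m J.
Proof.
have e0 : nu z t = 1%:M + heisY z + heisZ n t.
  apply: mulmx_ext => v; rewrite !mulmxDl nuE heisYE heisZE mul1mx.
  by rewrite !addrA.
by rewrite /nv -lock e0 !mulmxDr !mulmxDl mulmx1 JJ.
Qed.

Lemma heisY_add z z' : heisY (z + z') = heisY z + heisY z'.
Proof.
apply: mulmx_ext => v; rewrite mulmxDl !heisYE !hdotlin.
by apply/colP => i; rewrite !mxE; ring.
Qed.
Lemma heisY_scale a z : a^* = a -> heisY (a *: z) = a *: heisY z.
Proof.
move=> ar; apply: mulmx_ext => v; rewrite -scalemxAl !heisYE !hdotlin ar.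
by apply/colP => i; rewrite !mxE; ring.
Qed.
Lemma heisZ_scale a t : heisZ n (a * t) = a *: heisZ n t.
Proof. by apply: mulmx_ext => v; rewrite -scalemxAl !heisZE scalerA mulrA. Qed.

Lemma oppYD (X Y : 'M[C]_n.+2) z z' :
  X *m (J *m heisY (z + z') *m J) *m Y =
  X *m (J *m heisY z *m J) *m Y + X *m (J *m heisY z' *m J) *m Y.
Proof. by rewrite heisY_add !(mulmxDr, mulmxDl). Qed.

Lemma oppYZ (X Y : 'M[C]_n.+2) a z : a^* = a ->
  X *m (J *m heisY (a *: z) *m J) *m Y =
  a *: (X *m (J *m heisY z *m J) *m Y).
Proof. by move=> ar; rewrite heisY_scale// -!(scalemxAr, scalemxAl). Qed.

Lemma oppY_lin (X Y : 'M[C]_n.+2) a b z z' : a^* = a -> b^* = b ->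
  X *m (J *m heisY (a *: z + b *: z') *m J) *m Y =
  a *: (X *m (J *m heisY z *m J) *m Y) + b *: (X *m (J *m heisY z' *m J) *m Y).
Proof. by move=> ar br; rewrite oppYD (oppYZ _ _ _ ar) (oppYZ _ _ _ br). Qed.

Lemma nv_curve (X Y : 'M[C]_n.+2) b z t : X *m Y = 1%:M -> b^* = b ->
  X *m nv (b *: z) (b ^+ 2 * t) *m Y = 1%:M +
    b *: (X *m (J *m heisY z *m J) *m Y) +
    b ^+ 2 *: (X *m (J *m heisZ n t *m J) *m Y).
Proof.
move=> XY br; rewrite nv_expand heisY_scale// heisZ_scale.
by rewrite !(mulmxDr, mulmxDl) -!(scalemxAr, scalemxAl) mulmx1 XY.
Qed.

(** Inversion: the coordinates, in the opposite unipotent group, of the point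
    g oo, where g has coordinates (z, t). *)
Lemma hpt_inversion z t : hpt z t -> t != 0 -> hpt ((2 * t)^-1 *: z) (4 * t)^-1.
Proof.
move=> [[zP zM] et] t0; split; first by rewrite /perp !hdotlin zP zM mulr0.
have tc0 : t^* != 0 by rewrite conjC_eq0.
rewrite !hdotlin !conjE -[RHS](mul0r (4 * t * t^*)^-1) -et.
by field; rewrite t0 tc0.
Qed.

Lemma nvP z t : perp z -> nv z t *m eP = eP + 2 *: z + (2 * t) *: eM.
Proof.
move=> zp; rewrite nvE// hdote (perpC zp).1 scale0r subr0.
by rewrite [2 * t]mulrC.
Qed.

(** In the copy of SL_2 acting on the plane of eP and eM, an upper times a lower
    unipotent can carry one null line to the other. *)
Lemma to_inf_eP : nu 0 ('i / 2) *m (nv 0 ('i / 2) *m eP) = 'i *: eM :> vec.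
Proof.
have i2 : 'i * 'i = -1 :> C by rewrite -expr2 sqrCi.
rewrite nvP; last by split; rewrite hdot0r.
rewrite nuE !hdotlin !hdote !hdot0l !hdot0r !scaler0 !addr0.
have -> : 2 * ('i / 2) = 'i :> C by field.
have -> : 'i / 2 * (0 + 2 * 0 + 'i * 2) = -1 :> C by rewrite -i2; field.
by rewrite !mulr0 !addr0 scale0r subr0 scaleN1r addrC addrA addNr add0r.
Qed.

Lemma hpt_half_i : @hpt C n 0 ('i / 2).
Proof.
split; first by split; rewrite hdot0r.
by rewrite hdot0r !conjE conjCi; ring.
Qed.

(** The two vectors are images of eP by an opposite unipotent and of eM by a
    dilation times an element of N; their proportionality gives the two
    descriptions of one boundary point. *)
Lemma inversion_line z t a : t != 0 -> a != 0 ->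
  eP + 2 *: (a^-1 *: ((2 * t)^-1 *: z)) + (2 * (a^-1 ^+ 2 * (4 * t)^-1)) *: eM =
  (2 * t * a)^-1 *: (a^-1 *: eM + 2 *: z + (2 * t * a) *: eP).
Proof.
move=> t0 a0; apply/colP => i; rewrite !mxE; field.
by rewrite a0 t0.
Qed.

End Shear.

Section SelfShear.
Variables (C : numClosedFieldType) (n : nat).
Implicit Types (z : 'cV[C]_n.+2) (e : C).

Lemma shear_self e z : shear ('i *: z) e z = (1 + 2 * e * hdot z z * 'i) *: z.
Proof.
have i2 : 'i * 'i = -1 :> C by rewrite -expr2 sqrCi.
rewrite shearE /om -lock !hdotlin conjCi scalerA -{1}[z]scale1r -scalerDl.
congr (_ *: _); congr (1 + _).
have -> : e * ('i * (- 'i * hdot z z - 'i * hdot z z)) * 'i =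
  - 2 * e * hdot z z * ('i * 'i) * 'i by ring.
by rewrite i2; ring.
Qed.

(** Along u = i z the transvection multiplies z by 1 + 2 e |z|^2 i, so it
    strictly increases the norm when e and z are nonzero. *)
Lemma hdot_shear_self e z : e^* = e ->
  hdot (shear ('i *: z) e z) (shear ('i *: z) e z) =
  (1 + 4 * e ^+ 2 * hdot z z ^+ 2) * hdot z z.
Proof.
move=> er; have i2 : 'i * 'i = -1 :> C by rewrite -expr2 sqrCi.
rewrite shear_self !hdotlin !conjE er conjCi hdotC.
have -> : (1 + 2 * e * hdot z z * - 'i) * ((1 + 2 * e * hdot z z * 'i) * hdot z z)
  = (1 - 4 * e ^+ 2 * hdot z z ^+ 2 * ('i * 'i)) * hdot z z by ring.
by rewrite i2; ring.
Qed.

End SelfShear.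

Section Coordinates.
Variables (C : numClosedFieldType) (n : nat).
Local Notation eP := (eP C n).
Local Notation eM := (eM C n).

Lemma hdot_an_eM a (z : 'cV[C]_n.+2) t : hpt z t ->
  [/\ hdot z ((dil n a *m nu z t) *m eM) = 2 * hdot z z,
      hdot eM ((dil n a *m nu z t) *m eM) = 4 * t * a
    & hdot eP ((dil n a *m nu z t) *m eM) = 2 * a^-1].
Proof.
move=> zt; rewrite (an_eM _ zt); have [zp _] := zt; have [zP zM] := perpC zp.
have [Pz Mz] := zp.
by split; rewrite !hdotlin ?hdote ?zP ?zM ?Pz ?Mz; ring.
Qed.

End Coordinates.

(** * A rational identity *)

(** A cubic polynomial in k vanishing at 0, 1, 2, 3 is zero.  Its finite
    differences give b = 0, then a = q, and its value at 0 gives p = q. *)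
Lemma cubic_rigid (R : realFieldType) (a b s d p q : R) : d != 0 -> q != 0 ->
  (forall k : nat, (a + 2 * (s + k%:R * d) * b) * (q + 4 * (s + k%:R * d) ^+ 2)
     = q * (p + 4 * (s + k%:R * d) ^+ 2)) -> p = q.
Proof.
move=> d0 q0 h; pose E (k : nat) := (a + 2 * (s + k%:R * d) * b) * (q + 4 * (s + k%:R * d) ^+ 2)
  - q * (p + 4 * (s + k%:R * d) ^+ 2).
have E0 k : E k = 0 by rewrite /E h subrr.
have b0 : b = 0.
  have : b * (48 * d ^+ 3) = E 3 - 3 * E 2 + 3 * E 1 - E 0 by rewrite /E; ring.
  have c0 : 48 * d ^+ 3 != 0 by rewrite mulf_neq0 ?expf_neq0 ?pnatr_eq0.
  rewrite !E0 !mulr0 !subr0 addr0 => /eqP.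
  by rewrite mulf_eq0 (negbTE c0) orbF => /eqP.
have aq : a = q.
  have : (a - q) * (8 * d ^+ 2) = E 2 - 2 * E 1 + E 0 by rewrite /E b0; ring.
  have c0 : 8 * d ^+ 2 != 0 by rewrite mulf_neq0 ?expf_neq0 ?pnatr_eq0.
  rewrite !E0 mulr0 subr0 addr0 => /eqP.
  by rewrite mulf_eq0 (negbTE c0) orbF subr_eq0 => /eqP.
apply: (mulfI q0); apply/eqP; rewrite -subr_eq0 -oppr_eq0.
have <- : E 0 = - (q * p - q * q) by rewrite /E b0 aq; ring.
by rewrite E0.
Qed.

(** As functions of s, the two sides are rational with denominators p^2 + 4 s^2
    and q^2 + 4 s^2, equal at an arithmetic progression of values of s. *)
Lemma rational_rigid (R : realFieldType) (Dz Du t s p q : R) :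
  s != 0 -> 0 < p -> q != 0 ->
  (forall k : nat, let sk := t + k%:R * s in
    (- p / (p ^+ 2 + 4 * sk ^+ 2)) * Dz + (- 2 * sk / (p ^+ 2 + 4 * sk ^+ 2)) * Du =
    - 4 * q ^+ 2 / (4 * q ^+ 2 + 16 * sk ^+ 2)) -> p ^+ 2 = q ^+ 2.
Proof.
move=> s0 p0 q0 E; apply: (@cubic_rigid _ (p * Dz) Du t s) => //.
  by rewrite sqrf_eq0.
move=> k; have := E k; set sk := _ + _ => {}E /=.
have D1 : p ^+ 2 + 4 * sk ^+ 2 != 0.
  by rewrite gt_eqF// ltr_pwDl ?exprn_gt0// mulr_ge0 ?ler0n ?sqr_ge0.
have D2 : q ^+ 2 + 4 * sk ^+ 2 != 0.
  by rewrite gt_eqF// ltr_pwDl ?exprn_even_gt0// mulr_ge0 ?ler0n ?sqr_ge0.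
have -> : p * Dz + 2 * sk * Du = - (p ^+ 2 + 4 * sk ^+ 2) *
    (- p / (p ^+ 2 + 4 * sk ^+ 2) * Dz + - 2 * sk / (p ^+ 2 + 4 * sk ^+ 2) * Du).
  by field.
rewrite {}E; have -> : 4 * q ^+ 2 + 16 * sk ^+ 2 = 4 * (q ^+ 2 + 4 * sk ^+ 2) by ring.
by field.
Qed.

(** * The boundary and the deformed actions *)

Section Boundary.
Variables (R : realType) (n : nat) (x : SU R n).
Local Notation C := (R[i] : numClosedFieldType).
Local Notation vec := 'cV[C]_n.+2.
Local Notation G := (SU R n).
Local Notation eP := (eP C n).
Local Notation eM := (eM C n).
Local Notation mat := (mat R n).
Local Notation untwist := (untwist x).
Local Notation twist := (twist x).
Local Notation K := (conj_set x (@K0 R n)).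
Local Notation A := (conj_set x (@A0 R n)).
Local Notation N := (conj_set x (@N0 R n)).
Local Notation P := (minimal_parabolic K A N).

(** A vector of the null line that corresponds to the coset of g. *)
Definition bvec (g : G) : vec := act (untwist g) eP.

Lemma P_stab g : P g <-> exists c, bvec g = c *: eP.
Proof.
split.
  move=> [m [a [u [[mK mA] aA uN ->]]]]; apply/stab0P.
  exists (untwist m), (untwist a), (untwist u); split; last by rewrite !untwistM.
  - split; first exact/conj_setP.
    move=> b bA; have := mA (twist b); rewrite conj_setP twistK => /(_ bA)/(congr1 untwist).
    by rewrite untwistM [untwist (twist b * m)%g]untwistM twistK.
  - exact/conj_setP.
  - exact/conj_setP.
move=> /stab0P[m [a [u [[mK mA] aA uN e]]]].
exists (twist m), (twist a), (twist u); split.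
- split; first by rewrite conj_setP twistK.
  move=> b /conj_setP/mA h; apply: (@untwist_inj _ _ x).
  by rewrite untwistM [RHS]untwistM twistK.
- by rewrite conj_setP twistK.
- by rewrite conj_setP twistK.
by apply: (@untwist_inj _ _ x); rewrite e [RHS]untwistM [in RHS]untwistM !twistK.
Qed.

Lemma bvecM g h : bvec (g * h)%g = act (untwist g) (bvec h).
Proof. by rewrite /bvec untwistM actM. Qed.
Lemma bvec1 : bvec 1%g = eP.
Proof. by rewrite /bvec untwist1 act1. Qed.
Lemma bvec_neq0 g : bvec g != 0.
Proof. exact/act_neq0/eP_neq0. Qed.
Lemma bvec_null g : hdot (bvec g) (bvec g) = 0.
Proof. by rewrite act_hdot hdote. Qed.

Lemma P1 : P 1%g.
Proof. by apply/P_stab; exists 1; rewrite bvec1 scale1r. Qed.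
Lemma PM g h : P g -> P h -> P (g * h)%g.
Proof.
move=> /P_stab[c gc] /P_stab[d hd]; apply/P_stab; exists (d * c).
by rewrite bvecM hd actZ -/(bvec g) gc scalerA.
Qed.
Lemma PV g : P g -> P g^-1%g.
Proof.
move=> /P_stab[c gc]; apply/P_stab; exists c^-1.
have c0 : c != 0.
  by apply/eqP => c0; have := bvec_neq0 g; rewrite gc c0 scale0r eqxx.
have : bvec (g^-1 * g)%g = c *: bvec g^-1%g by rewrite bvecM gc actZ.
by rewrite mulVg bvec1 => ->; rewrite scalerA mulVf// scale1r.
Qed.

(** Identifies G/P with the space of null lines. *)
Lemma coset_eq g h :
  coset_of P g = coset_of P h <-> exists2 c, c != 0 & bvec g = c *: bvec h.
Proof.
split.
  move/(congr1 sval) => /= e.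
  have : left_coset P g g by exists 1%g; [exact: P1|rewrite mulg1].
  rewrite e => -[p /P_stab[c pc] <-]; exists c.
    by apply/eqP => c0; have := bvec_neq0 p; rewrite pc c0 scale0r eqxx.
  by rewrite bvecM pc actZ.
move=> [c c0 e]; apply: eq_exist.
have Phg : P (h^-1 * g)%g.
  by apply/P_stab; exists c; rewrite bvecM e actZ -bvecM mulVg bvec1.
apply/seteqP; split=> _ [p Pp <-].
  by exists (h^-1 * g * p)%g; [exact: PM|rewrite !mulgA mulgV mul1g].
exists ((h^-1 * g)^-1 * p)%g; first exact/PM/Pp/PV.
by rewrite invgM invgK !mulgA mulgV mul1g.
Qed.

Lemma coset_surj (X : quotient P) : exists g, X = coset_of P g.
Proof. by case: X => X [g eX]; exists g; apply: eq_exist. Qed.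

Lemma translateE g h : left_translate g (coset_of P h) = coset_of P (g * h)%g.
Proof.
apply: eq_exist; apply/seteqP; split.
  by move=> _ [_ [p Pp <-] <-]; exists p => //; rewrite mulgA.
by move=> _ [p Pp <-]; exists (h * p)%g; [exists p|rewrite mulgA].
Qed.

Lemma translate1 : left_translate (P := P) 1%g = id.
Proof.
by apply/funext => X; have [g ->] := coset_surj X; rewrite translateE mul1g.
Qed.
Lemma translateM g h : left_translate (P := P) (g * h)%g = left_translate g \o left_translate h.
Proof.
by apply/funext => X /=; have [k ->] := coset_surj X; rewrite !translateE mulgA.
Qed.

Lemma translate_smooth g : smooth_map (left_translate (P := P) g).
Proof.
move=> f [U [F [oU GU sF FE]]].
exists [set X : mat | U (SUval g *m X)], (fun X => F (SUval g *m X)); split.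
- exact: open_mull.
- by move=> _ [h _ <-] /=; apply: GU; exists (g * h)%g.
- exact: smooth_mull.
- by move=> h; rewrite -SUvalM FE /= translateE.
Qed.

Lemma translate_diffeo g : diffeo (left_translate (P := P) g).
Proof.
exists (left_translate g^-1%g); split; try exact: translate_smooth.
  by move=> X; rewrite -[LHS]/((left_translate _ \o left_translate _) X) -translateM mulVg translate1.
by move=> X; rewrite -[LHS]/((left_translate _ \o left_translate _) X) -translateM mulgV translate1.
Qed.

(** Coordinates on the conjugate of A0 N0 by x. *)
Definition ANform g a z t := [/\ 0 < a, @hpt C n z t &
  SUval (untwist g) = @dil C n (a%:C)%C *m nu z t].
Definition AN : set G := [set g | exists a z t, ANform g a z t].

Lemma ANform_mul g h a z t b z' t' : ANform g a z t -> ANform h b z' t' ->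
  ANform (g * h)%g (a * b) ((b%:C%C)^-1 *: z + z')
    ((b%:C%C) ^- 2 * t + t' - hdot ((b%:C%C)^-1 *: z) z').
Proof.
move=> [a0 zt gE] [b0 zt' hE].
have b0' : (b%:C%C : C) != 0 by rewrite rc_eq0 gt_eqF.
have a0' : (a%:C%C : C) != 0 by rewrite rc_eq0 gt_eqF.
have br := conj_real b.
split; [exact: mulr_gt0|exact: hpt_an|].
by rewrite untwistM SUvalM gE hE rcME; exact: an_mul.
Qed.

Lemma ANform_uniq g a z t a' z' t' : ANform g a z t -> ANform g a' z' t' ->
  [/\ a = a', z = z' & t = t'].
Proof.
move=> [a0 zt gE] [a0' zt' gE'].
have [|aa -> ->] := dil_nu_inj zt zt' (etrans (esym gE) gE').
  by rewrite rc_eq0 gt_eqF.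
by split=> //; apply: (@complexI R).
Qed.

Lemma ANform1 : ANform 1%g 1 0 0.
Proof.
split=> //; first exact: hpt0.
by rewrite untwist1 SUval1 rc1E dil1 nu0 mulmx1.
Qed.

Lemma ANform_A g : A g -> exists a, ANform g a 0 0.
Proof.
move=> /conj_setP/A0P[a [a0 e]]; exists a; split=> //; first exact: hpt0.
by rewrite e nu0 mulmx1.
Qed.

Lemma ANform_N g : N g -> exists z t, ANform g 1 z t.
Proof.
move=> /NP[z [t [zt e]]]; exists z, t; split=> //.
by rewrite e rc1E dil1 mul1mx.
Qed.

Lemma ANform_ex a z t : 0 < a -> @hpt C n z t -> exists g, ANform g a z t.
Proof.
move=> a0 zt; exists (twist (dilG n a0 * nuG zt)%g); split=> //.
by rewrite twistK.
Qed.

Lemma ANform_inj g h a z t : ANform g a z t -> ANform h a z t -> g = h.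
Proof.
by move=> [_ _ gE] [_ _ hE]; apply: (@untwist_inj _ _ x); apply: SU_ext; rewrite gE hE.
Qed.

Lemma ANform_inv g a z t : ANform g a z t -> exists b z' t', ANform g^-1%g b z' t'.
Proof.
move=> gE; have [a0 zt _] := gE.
have a0' : (a%:C%C : C) != 0 by rewrite rc_eq0 gt_eqF.
have ar := conj_real a.
have zt' : @hpt C n (- (a%:C%C *: z)) ((a%:C%C) ^+ 2 * t)^*.
  by apply: hptN; exact: hptZ.
have ai0 : 0 < a^-1 by rewrite invr_gt0.
have [h hE] := ANform_ex ai0 zt'.
suff gh : (g * h)%g = 1%g.
  exists a^-1, (- (a%:C%C *: z)), ((a%:C%C) ^+ 2 * t)^*.
  by rewrite -[g^-1%g]mulg1 -gh mulKg.
apply: (@untwist_inj _ _ x); apply: SU_ext; rewrite untwist1 untwistM SUvalM.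
have [_ _ ->] := gE; have [_ _ ->] := hE; rewrite rcVE; exact: an_inv.
Qed.

Lemma AN_subgroup : subgroup AN.
Proof.
split; first by exists 1, 0, 0; exact: ANform1.
move=> g h [a [z [t gE]]] [b [z' [t' hE]]].
have [b' [z2 [t2 hE']]] := ANform_inv hE.
by do 3 eexists; exact: ANform_mul gE hE'.
Qed.

Lemma bvec_AN g a z t : ANform g a z t -> bvec g = (a%:C%C : C) *: eP.
Proof. by move=> [_ zt gE]; rewrite /bvec actE gE; exact: an_eP. Qed.

Section Deform.
Variables (u : vec) (up : perp u).

Definition defrel (e : R) (g h : G) := exists a z t,
  ANform g a z t /\ ANform h a (shear u e%:C%C z) (shear_t u e%:C%C z t).

(** On AN, the unique element related to g: the relation is the graph of a
    homomorphism, by uniqueness of the coordinates. *)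
Definition beta (e : R) (g : G) : G := get [set h | defrel e g h].

Lemma defrel_ex e g : AN g -> exists h, defrel e g h.
Proof.
move=> [a [z [t gE]]]; have [a0 zt _] := gE.
have [h hE] := ANform_ex a0 (hpt_shear e%:C%C up zt).
by exists h, a, z, t.
Qed.

Lemma betaP e g : AN g -> defrel e g (beta e g).
Proof. by move=> /(defrel_ex e)/getPex. Qed.

Lemma betaE e g a z t : ANform g a z t ->
  ANform (beta e g) a (shear u e%:C%C z) (shear_t u e%:C%C z t).
Proof.
move=> gE; have [|a' [z' [t' [gE' hE]]]] := @betaP e g; first by exists a, z, t.
by have [aa zz tt] := ANform_uniq gE gE'; subst a' z' t'.
Qed.

Lemma beta1 e : beta e 1%g = 1%g.
Proof.
apply: (ANform_inj (betaE e ANform1)).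
by rewrite shear0 shear_t0; exact: ANform1.
Qed.

(** Both the transvection and the correction of t are compatible with the
    dilations, so they extend from N to AN. *)
Lemma betaM e g h : AN g -> AN h -> beta e (g * h)%g = (beta e g * beta e h)%g.
Proof.
move=> [a [z [t gE]]] [b [z' [t' hE]]].
have b0 : 0 < b by case: hE.
apply: (ANform_inj (betaE e (ANform_mul gE hE))).
have := ANform_mul (betaE e gE) (betaE e hE).
by rewrite (shear_an _ _ _ _ (conj_real b)) (shear_t_an _ (conj_real e) _ _ _ _ (conj_real b)).
Qed.

Lemma beta_path g : AN g -> exists g1 g2 : mat,
  forall e, SUval (beta e g) = qpath (SUval g) g1 g2 e.
Proof.
move=> [a [z [t gE]]].
pose c (X : 'M[C]_n.+2) : mat := SUval x *m (dil n a%:C%C *m X) *m SUval x^-1%g.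
have cE h b : SUval (untwist h) = dil n a%:C%C *m b -> SUval h = c b.
  move=> e; rewrite /c -e -!SUvalM; congr SUval.
  by rewrite /untwist -!mulgA mulVKg mulgV mulg1.
exists (c (heisY (om u z *: u) + heisZ n (- om u z * (hdot z u + hdot u z) / 2))).
exists (c (heisZ n (- om u z ^+ 2 * hdot u u / 2))).
move=> e; have [_ _ hE] := betaE e gE; have [_ _ gE'] := gE.
rewrite (cE _ _ hE) (cE _ _ gE') /qpath rcXE (nu_shear u (conj_real e)) /c.
exact: mulmx_qpath.
Qed.

Definition rho (e : R) (g : G) : quotient P -> quotient P := left_translate (beta e g).

Lemma rho_action e (Gamma : set G) : Gamma `<=` AN -> smooth_action Gamma (rho e).
Proof.
move=> GAN; split.
- by move=> g _; exact: translate_diffeo.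
- by rewrite /rho beta1 translate1.
- by move=> g h /GAN Gg /GAN Gh; rewrite /rho betaM// translateM.
Qed.

Lemma rho_close_one g f (eps : R) : AN g -> smooth_fun f -> 0 < eps ->
  \forall e \near (0 : R),
    C2_small K eps (fun X => f (rho e g X) - f (left_translate g X)).
Proof.
move=> Ng [U [F [oU GU sF FE]]] eps0; have [g1 [g2 gp]] := beta_path Ng.
have QU X : [set SUval k | k in K] X -> U (SUval g *m X).
  by move=> [k _ <-]; apply: GU; exists (g * k)%g.
have := @near_C2 R n (SUval g) g1 g2 U F _ eps oU sF eps0 QU (@conjK_compact R n x).
apply: filterS => e he.
exists (Udiff (SUval g) g1 g2 U e), (Fdiff (SUval g) g1 g2 F e); split.
  split.
  - exact: open_Udiff.
  - move=> _ [h _ <-]; split; rewrite /= -?gp -SUvalM; apply: GU.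
      by exists (beta e g * h)%g.
    by exists (g * h)%g.
  - exact: smooth_Fdiff.
  - by move=> h; rewrite /Fdiff -gp -!SUvalM !FE mulN1r /rho !translateE.
by move=> k V W Kk; apply: he; exists k.
Qed.

Lemma rho_close (S : set G) (T : set (quotient P -> R)) eps :
  finite_set S -> finite_set T -> S `<=` AN -> T `<=` smooth_fun (P := P) -> 0 < eps ->
  \forall e \near (0 : R), C2_close K S T eps (rho e).
Proof.
move=> /finite_seqP[s ->] /finite_seqP[r ->] sAN rsm eps0.
have hr g : g \in s -> forall r' : seq (quotient P -> R), {subset r' <= r} ->
   \forall e \near (0 : R), forall f, f \in r' ->
    C2_small K eps (fun X => f (rho e g X) - f (left_translate g X)).
  move=> gs; elim=> [|f r' IH] rr; first by apply: filterE.
  have h1 := rho_close_one (sAN g gs) (rsm f (rr f (mem_head _ _))) eps0.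
  have h2 := IH (fun f' fr => rr f' (mem_behead (s := f :: r') fr)).
  apply: filterS2 h1 h2 => e h1 h2 f'.
  by rewrite in_cons => /orP[/eqP ->|/h2].
have hs (s' : seq G) : {subset s' <= s} ->
   \forall e \near (0 : R), forall g f, g \in s' -> f \in r ->
    C2_small K eps (fun X => f (rho e g X) - f (left_translate g X)).
  elim: s' => [|g s' IH] ss; first by apply: filterE.
  have h1 := hr g (ss g (mem_head _ _)) r (fun _ => id).
  have h2 := IH (fun f' fr => ss f' (mem_behead (s := g :: s') fr)).
  apply: filterS2 h1 h2 => e h1 h2 g' f.
  by rewrite in_cons => /orP[/eqP ->|g's] fr; [exact: h1|exact: h2].
by apply: filterS (hs s (fun _ => id)) => e he g f /= gs fr; exact: he.
Qed.

End Deform.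
End Boundary.

(** * The test function on the boundary *)

Section Quo.
Variable R : realType.
Local Notation Re := complex.Re.
Local Notation Im := complex.Im.
Implicit Types a b c k : R[i].

Lemma Re_mul a b : Re (a * b) = Re a * Re b - Im a * Im b.
Proof. by case: a => a1 a2; case: b. Qed.
Lemma Im_mul a b : Im (a * b) = Re a * Im b + Im a * Re b.
Proof. by case: a => a1 a2; case: b. Qed.
Lemma Re_add a b : Re (a + b) = Re a + Re b.
Proof. by case: a => a1 a2; case: b. Qed.
Lemma Im_add a b : Im (a + b) = Im a + Im b.
Proof. by case: a => a1 a2; case: b. Qed.
Lemma complex_ext a b : Re a = Re b -> Im a = Im b -> a = b.
Proof. by case: a => a1 a2; case: b => b1 b2 /= -> ->. Qed.

(** The euclidean product of the plane, Re (a b^* ), and a quotient of it that is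
    unchanged when the three arguments are multiplied by a common scalar, hence a
    function on projective space. *)
Definition rdot a b : R := Re a * Re b + Im a * Im b.
Definition rdot_sum b c : R := rdot b b + rdot c c.
Definition rdot_quo a b c : R := rdot a b / rdot_sum b c.

Lemma rdot_scale k a b : rdot (k * a) (k * b) = rdot k k * rdot a b.
Proof. by rewrite /rdot !Re_mul !Im_mul; ring. Qed.

Lemma rdot_eq0 a : (rdot a a == 0) = (a == 0).
Proof.
case: a => a1 a2; rewrite /rdot /= -!expr2 paddr_eq0 ?sqr_ge0// !sqrf_eq0.
by rewrite eq_complex.
Qed.

Lemma rdot_ge0 a : 0 <= rdot a a.
Proof. by rewrite /rdot -!expr2 addr_ge0 ?sqr_ge0. Qed.

Lemma rdot_sum_eq0 b c : (rdot_sum b c == 0) = (b == 0) && (c == 0).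
Proof. by rewrite /rdot_sum paddr_eq0 ?rdot_ge0// !rdot_eq0. Qed.

Lemma rdot_quo_scale k a b c : k != 0 -> rdot_quo (k * a) (k * b) (k * c) = rdot_quo a b c.
Proof.
move=> k0; rewrite /rdot_quo /rdot_sum !rdot_scale -mulrDr invfM mulrACA divff ?mul1r//.
by rewrite rdot_eq0.
Qed.

(** The value of the test function at b^m beta_e(g) oo, divided by th = al^-m;
    here q = |w|^2 and t is the last coordinate of beta_e(g). *)
Lemma rdot_quo_orbit (q s th : R) (t : R[i]) : th != 0 -> q != 0 ->
  Re t = - q / 2 -> Im t = s ->
  rdot_quo (2 * q%:C%C) (4 * t * (th^-1)%:C%C) (2 * th%:C%C) / th =
  - 4 * q ^+ 2 / (4 * q ^+ 2 + 16 * s ^+ 2 + 4 * th ^+ 4).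
Proof.
move=> th0 q0 tr ti; set D := _ + _ + _.
have D0 : D != 0.
  rewrite gt_eqF// /D -addrA ltr_pwDl//.
    by rewrite pmulr_rgt0// exprn_even_gt0.
  by rewrite addr_ge0// mulr_ge0 ?ler0n// ?sqr_ge0// exprn_even_ge0.
have -> : rdot_quo (2 * q%:C%C) (4 * t * (th^-1)%:C%C) (2 * th%:C%C) =
    (- 4 * q ^+ 2 / th) / (D / th ^+ 2).
  rewrite -!(rcnE R) /rdot_quo; congr (_ / _).
    by rewrite /rdot !(Re_mul, Im_mul) tr ti /=; field.
  by rewrite /rdot_sum /rdot !(Re_mul, Im_mul) tr ti /= /D; field.
by field; rewrite th0 D0.
Qed.

(** Real coordinates of 1 / 2t on 1 and i, to be used with real linear maps. *)
Lemma inv_coords (p s : R) (t : R[i]) : p != 0 -> Re t = - p / 2 -> Im t = s ->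
  (2 * t)^-1 = (- p / (p ^+ 2 + 4 * s ^+ 2))%:C%C
     + (- 2 * s / (p ^+ 2 + 4 * s ^+ 2))%:C%C * 'i%C.
Proof.
move=> p0 tr ti; set D := p ^+ 2 + 4 * s ^+ 2.
have D0 : D != 0.
  by rewrite gt_eqF// ltr_pwDl ?exprn_even_gt0// mulr_ge0 ?ler0n ?sqr_ge0.
have t0 : 2 * t != 0.
  rewrite mulf_neq0 ?pnatr_eq0//; apply/eqP => t0; move: tr; rewrite t0 /= => /esym/eqP.
  by rewrite mulf_eq0 oppr_eq0 (negbTE p0) invr_eq0 pnatr_eq0.
apply: (mulfI t0); rewrite divff//; apply: complex_ext;
  rewrite -!(rcnE R) !(Re_mul, Im_mul, raddfD) tr ti /=; rewrite ?(Re_mul, Im_mul) /=.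
  by rewrite /D; field.
by rewrite /D; field.
Qed.

End Quo.

Section TestFunction.
Variables (R : realType) (n : nat) (x : SU R n).
Local Notation C := (R[i] : numClosedFieldType).
Local Notation vec := 'cV[C]_n.+2.
Local Notation G := (SU R n).
Local Notation eP := (eP C n).
Local Notation eM := (eM C n).
Local Notation mat := (mat R n).
Local Notation P := (minimal_parabolic (conj_set x (@K0 R n))
  (conj_set x (@A0 R n)) (conj_set x (@N0 R n))).
Local Notation bvec := (bvec x).
Variable w : vec.

(** Re (<w, y> <eM, y>^* ) / (|<eM, y>|^2 + |<eP, y>|^2).  For w orthogonal to
    eP and eM it vanishes at eP, where its derivative is a multiple of Re <w, .>;
    the denominator is positive on nonzero null vectors. *)
Definition test_vec (y : vec) : R := rdot_quo (hdot w y) (hdot eM y) (hdot eP y).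

Lemma test_vecZ k y : k != 0 -> test_vec (k *: y) = test_vec y.
Proof. by move=> k0; rewrite /test_vec !hdotZr rdot_quo_scale. Qed.

Definition testF (X : mat) : R :=
  rdot_quo (untwist_coef x w eP X) (untwist_coef x eM eP X) (untwist_coef x eP eP X).

Lemma testFE (g : G) : testF (SUval g) = test_vec (bvec g).
Proof. by rewrite /testF !untwist_coefE. Qed.

Definition testU : set mat :=
  [set X : mat | rdot_sum (untwist_coef x eM eP X) (untwist_coef x eP eP X) != 0].

Lemma ratf_Re U v v' : @ratf R n U (fun X => complex.Re (untwist_coef x v v' X)).
Proof.
apply: ratf_lin.
  by move=> X; exact: (cvg_comp _ _ (@untwist_coef_continuous _ _ x v v' X) (@Re_continuous R _)).
move=> X V t; by rewrite untwist_coef_line Re_add Re_mul /= mul0r subr0.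
Qed.
Lemma ratf_Im U v v' : @ratf R n U (fun X => complex.Im (untwist_coef x v v' X)).
Proof.
apply: ratf_lin.
  by move=> X; exact: (cvg_comp _ _ (@untwist_coef_continuous _ _ x v v' X) (@Im_continuous R _)).
move=> X V t; by rewrite untwist_coef_line Im_add Im_mul /= mul0r addr0.
Qed.

Lemma ratf_rdot U v v' r r' :
  @ratf R n U (fun X => rdot (untwist_coef x v v' X) (untwist_coef x r r' X)).
Proof.
by apply: ratf_add; apply: ratf_mul; try exact: ratf_Re; exact: ratf_Im.
Qed.

Lemma testU_open : open testU.
Proof.
have c : continuous (fun X : mat => rdot_sum (untwist_coef x eM eP X) (untwist_coef x eP eP X)).
  move=> X; apply: (@ratf_continuous R n setT) => //.
  by apply: ratf_add; exact: ratf_rdot.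
apply: (@open_comp _ _ _ [set y : R | y != 0]); first by move=> X _; exact: c.
exact: open_neq.
Qed.

Lemma testF_smooth : smooth_on testU testF.
Proof.
apply: ratf_smooth; first exact: testU_open.
apply: ratf_mul; first exact: ratf_rdot.
by apply: ratf_inv => //; apply: ratf_add; exact: ratf_rdot.
Qed.

Lemma testU_SU (g : G) : testU (SUval g).
Proof.
rewrite /testU /= !untwist_coefE -/(bvec g) rdot_sum_eq0; apply/negP => /andP[/eqP m0 /eqP p0].
have lp : perp (bvec g) by split.
have := perp_eq0 lp; rewrite (bvec_null x g) eqxx => /esym.
by rewrite (negbTE (bvec_neq0 x g)).
Qed.

(** Evaluated at any representative, since [test_vec] depends only on the line. *)
Definition testf (X : quotient P) : R := test_vec (bvec (get [set g | X = coset_of P g])).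

Lemma testfE g : testf (coset_of P g) = test_vec (bvec g).
Proof.
rewrite /testf; set g' := get _.
have : coset_of P g = coset_of P g' by apply: (@getPex _ [set g' | _ = coset_of P g']); exists g.
by move=> /coset_eq[c c0 ->]; rewrite test_vecZ.
Qed.

Lemma testf_smooth : smooth_fun testf.
Proof.
exists testU, testF; split; [exact: testU_open| |exact: testF_smooth|].
  by move=> _ [g _ <-]; exact: testU_SU.
by move=> g; rewrite testFE testfE.
Qed.

End TestFunction.

(** * Elements of a standard subgroup *)

Section LatticePoints.
Variables (R : realType) (n : nat) (x : SU R n).
Local Notation C := (R[i] : numClosedFieldType).
Local Notation vec := 'cV[C]_n.+2.
Local Notation G := (SU R n).
Local Notation N := (conj_set x (@N0 R n)).
Local Notation ANform := (ANform x).

Lemma generated_subgroup (S : set G) : subgroup (generated S).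
Proof.
split; first by move=> T [].
by move=> g h gS hS T sT ST; apply: sT.2; [exact: gS|exact: hS].
Qed.
Lemma sub_generated (S : set G) : S `<=` generated S.
Proof. by move=> g Sg T _; apply. Qed.

Lemma subgroupV (S : set G) g : subgroup S -> S g -> S g^-1%g.
Proof. by move=> [S1 SB] Sg; have := SB _ _ S1 Sg; rewrite mul1g. Qed.
Lemma subgroupM (S : set G) g h : subgroup S -> S g -> S h -> S (g * h)%g.
Proof.
move=> sS Sg Sh; have := sS.2 _ _ Sg (subgroupV sS Sh).
by rewrite invgK.
Qed.

Lemma ANform_NN g h z t z' t' : ANform g 1 z t -> ANform h 1 z' t' ->
  ANform (g * h)%g 1 (z + z') (t + t' - hdot z z').
Proof.
move=> [_ zt gE] [_ zt' hE]; split; [exact: ltr01|exact: hptM|].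
by rewrite untwistM SUvalM gE hE rc1E; exact: an_NN.
Qed.

Lemma ANform_AA g h a b : ANform g a 0 0 -> ANform h b 0 0 ->
  ANform (g * h)%g (a * b) 0 0.
Proof.
move=> [a0 zt gE] [b0 _ hE]; split; [exact: mulr_gt0|by []|].
rewrite untwistM SUvalM gE hE rcME; apply: an_AA; first by rewrite rc_eq0 gt_eqF.
by rewrite rc_eq0 gt_eqF.
Qed.

Lemma ANform_AN g h a z t : ANform g a 0 0 -> ANform h 1 z t ->
  ANform (g * h)%g a z t.
Proof.
move=> [a0 _ gE] [_ zt hE]; split; [exact: a0|exact: zt|].
by rewrite untwistM SUvalM gE hE rc1E; exact: an_AN.
Qed.

(** The commutator of two lattice elements (z, _) and (z1, _) is central with
    coordinate s = <z1, z> - <z, z1>, nonzero when the character of z does not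
    vanish on the second one; multiplying by its powers moves t by multiples
    of s. *)
Lemma lattice_fibre (L : set G) (S : set G) : (0 < n)%N -> lattice N L ->
  subgroup S -> L `<=` S ->
  exists (z : vec) (t s : C), [/\ perp z, z != 0, s != 0, s^* = - s &
    forall k : nat, exists2 g, S g & ANform g 1 z (t + k%:R * s)].
Proof.
move=> n0 latL sS LS; have [_ LN _] := latL.
pose u0 : vec := delta_mx ord0 0.
have u00 : u0 != 0.
  apply/eqP => /(congr1 (fun v : vec => v ord0 0)); rewrite !mxE !eqxx => /eqP.
  by rewrite oner_eq0.
have i0 : (inord n == ord0 :> 'I_n.+2) = false.
  by apply/eqP => /(congr1 val); rewrite /= inordK// => e; rewrite e in n0.
have m0 : (ord_max == ord0 :> 'I_n.+2) = false by apply/eqP => /(congr1 val).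
have u0p : perp u0.
  by split; rewrite ?hdotP ?hdotM !mxE i0 m0/= ?subrr ?addr0.
have [l0 Ll0 chi0] := lattice_not_in_hyperplane u0p u00 latL.
have [z0 [t0 l0E]] := ANform_N (LN _ Ll0); have [_ zt0 _] := l0E.
have l0N : SUval (untwist x l0) = @nu C n z0 t0.
  by case: l0E => _ _ ->; rewrite rc1E dil1 mul1mx.
have z0p : perp z0 by case: zt0.
have z00 : z0 != 0.
  apply: contraNneq chi0 => z00; rewrite (chi_nu u0p zt0 l0N) z00 hdot0r.
  by rewrite mulr0.
have [l1 Ll1 chi1] := lattice_not_in_hyperplane z0p z00 latL.
have [z1 [t1 l1E]] := ANform_N (LN _ Ll1); have [_ zt1 _] := l1E.
have l1N : SUval (untwist x l1) = @nu C n z1 t1.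
  by case: l1E => _ _ ->; rewrite rc1E dil1 mul1mx.
rewrite (chi_nu z0p zt1 l1N) in chi1.
pose s : C := hdot z1 z0 - hdot z0 z1.
have sc : s^* = - s by rewrite /s !conjE !hdotC; ring.
have s0 : s != 0.
  apply: contraNneq chi1 => /eqP; rewrite /s subr_eq0 => /eqP e.
  have : (hdot z0 z1)^* = hdot z0 z1 by rewrite hdotC.
  case: (hdot z0 z1) => a b /= [] /eqP; rewrite eq_sym -subr_eq0 opprK -mulr2n.
  by rewrite mulrn_eq0/= => /eqP ->; rewrite mulr0.
have hpt0s : @hpt C n 0 s by split; rewrite ?/perp ?hdot0r ?sc ?subrr ?addr0.
have [c cE] := @ANform_ex _ _ x 1 0 s ltr01 hpt0s.
have cl : (c * (l1 * l0))%g = (l0 * l1)%g.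
  have e1 := ANform_NN cE (ANform_NN l1E l0E).
  have e2 := ANform_NN l0E l1E.
  apply: (ANform_inj e1); move: e2; rewrite hdot0l add0r (addrC z1).
  by have -> : t0 + t1 - hdot z0 z1 = s + (t1 + t0 - hdot z1 z0) - 0 by rewrite /s; ring.
have Sc : S c.
  have -> : c = (l0 * l1 * (l1 * l0)^-1)%g by rewrite -cl mulgK.
  by apply: sS.2; apply: subgroupM => //; exact: LS.
exists z0, t0, s; split=> //; elim=> [|k [g Sg gE]].
  by exists l0; [exact: LS|rewrite mul0r addr0].
exists (c * g)%g; first exact: subgroupM.
have := ANform_NN cE gE; rewrite hdot0l add0r subr0.
by have -> : s + (t0 + k%:R * s) = t0 + k.+1%:R * s by rewrite -natr1; ring.
Qed.

Lemma ANform_AV g a : ANform g a 0 0 -> ANform g^-1%g a^-1 0 0.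
Proof.
move=> gE; have [a0 _ _] := gE.
have ai0 : 0 < a^-1 by rewrite invr_gt0.
have [h hE] := ANform_ex x ai0 (hpt0 C n).
have aa : a / a = 1 by rewrite divff// gt_eqF.
have e := ANform_AA gE hE; rewrite aa in e.
by rewrite -[g^-1%g]mulg1 -(ANform_inj e (ANform1 x)) mulKg.
Qed.

Lemma ANform_AX g a k : ANform g a 0 0 -> ANform (g ^+ k)%g (a ^+ k) 0 0.
Proof.
move=> gE; elim: k => [|k IH]; first by rewrite expg0 expr0; exact: ANform1.
by rewrite expgS exprS; exact: ANform_AA.
Qed.

Lemma expanding_A (a : G) (S : set G) : conj_set x (@A0 R n) a -> a <> 1%g ->
  subgroup S -> S a ->
  exists b al, [/\ S b, 1 < al & ANform b al 0 0].
Proof.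
move=> Aa a1 sS Sa; have [al aE] := ANform_A Aa; have [al0 _ _] := aE.
have [al1|al1|al1] := ltgtP al 1.
- exists a^-1%g, al^-1; split; [exact: subgroupV|by rewrite invf_gt1|exact: ANform_AV].
- by exists a, al.
- by exfalso; apply: a1; apply: (ANform_inj aE); rewrite al1; exact: ANform1.
Qed.

End LatticePoints.

(** * The two fixed points and the curves through the base point *)

Section NonConj.
Variables (R : realType) (n : nat) (x : SU R n).
Local Notation C := (R[i] : numClosedFieldType).
Local Notation vec := 'cV[C]_n.+2.
Local Notation G := (SU R n).
Local Notation eP := (eP C n).
Local Notation eM := (eM C n).
Local Notation mat := (mat R n).
Local Notation J := (formJ C n).
Local Notation K := (conj_set x (@K0 R n)).
Local Notation A := (conj_set x (@A0 R n)).
Local Notation N := (conj_set x (@N0 R n)).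
Local Notation P := (minimal_parabolic K A N).
Local Notation ANform := (ANform x).
Local Notation bvec := (bvec x).
Local Notation twist := (twist x).

Definition org : quotient P := coset_of P 1%g.
Definition to_inf : G := twist (nuG (hpt_half_i C n) * nvG (hpt_half_i C n))%g.
Definition inf : quotient P := coset_of P to_inf.

Lemma bvec_to_inf : bvec to_inf = 'i *: eM.
Proof. by rewrite /bvec /to_inf twistK actM !actE; exact: to_inf_eP. Qed.

Lemma imag_neq0 : 'i != 0 :> C.
Proof. exact: neq0Ci. Qed.

Lemma bvec_org g k : bvec g = k *: eP -> coset_of P g = org.
Proof.
move=> gk; apply/coset_eq; exists k; last by rewrite bvec1.
by apply/eqP => k0; have := bvec_neq0 x g; rewrite gk k0 scale0r eqxx.
Qed.

Lemma bvec_inf g k : bvec g = k *: eM -> coset_of P g = inf.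
Proof.
move=> gk; apply/coset_eq; exists (k / 'i); last first.
  by rewrite bvec_to_inf scalerA divfK// imag_neq0.
rewrite mulf_neq0 ?invr_eq0 ?imag_neq0//.
by apply/eqP => k0; have := bvec_neq0 x g; rewrite gk k0 scale0r eqxx.
Qed.

Lemma org_neq_inf : org <> inf.
Proof.
move=> /coset_eq[c c0]; rewrite bvec1 bvec_to_inf scalerA => /(congr1 (hdot eP)).
rewrite hdotlin !hdote => /esym/eqP; rewrite !mulf_eq0 (negbTE c0).
by rewrite (negbTE imag_neq0) pnatr_eq0.
Qed.

Lemma AN_org g a z t : ANform g a z t -> left_translate g org = org.
Proof. by move=> gE; rewrite translateE mulg1; exact: bvec_org (bvec_AN gE). Qed.

Lemma A_inf g a : ANform g a 0 0 -> left_translate g inf = inf.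
Proof.
move=> gE; rewrite translateE; apply: (@bvec_inf _ ('i * (a%:C%C)^-1)).
rewrite bvecM bvec_to_inf actZ -scalerA; congr (_ *: _).
have [_ zt e] := gE; rewrite actE e an_eM// scaler0 addr0 mulr0 mul0r scale0r.
by rewrite addr0.
Qed.

Lemma A_fixed g a X : ANform g a 0 0 -> 1 < a -> left_translate g X = X ->
  X = org \/ X = inf.
Proof.
move=> gE a1; have [h ->] := coset_surj X; rewrite translateE => /coset_eq[c c0].
rewrite bvecM; have [a0 zt e] := gE; rewrite actE e an_mulv nu0 mul1mx => fix_h.
have a0' : (a%:C%C : C) != 0 by rewrite rc_eq0 gt_eqF.
have a2 : (a%:C%C : C) ^+ 2 != 1.
  rewrite -rcXE -(rc1E R) (inj_eq (@complexI R)) gt_eqF//.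
  by rewrite -(expr1n _ 2) ltr_pXn2r// nnegrE ?ler01 ?ltW.
have [hk|hk] := dil_null_fix a0' a2 (bvec_null x h) (bvec_neq0 x h) fix_h.
  by left; exact: bvec_org hk.
by right; exact: bvec_inf hk.
Qed.

Lemma N_inf_moved g z t : ANform g 1 z t -> z != 0 -> left_translate g inf <> inf.
Proof.
move=> gE z0; rewrite translateE => /coset_eq[c _]; rewrite bvecM bvec_to_inf actZ scalerA.
have [_ zt e] := gE; rewrite actE e an_eM// => /(congr1 (hdot z)).
have [zp _] := zt; have [zP zM] := perpC zp.
rewrite !hdotlin zP zM !mulr0 add0r addr0 => /eqP.
rewrite mulf_eq0 (negbTE imag_neq0)/= mulf_eq0 pnatr_eq0/= perp_eq0//.
by rewrite (negbTE z0).
Qed.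

Definition opp_curve (z : vec) (t : C) (zt : hpt z t) : G := twist (nvG zt).

(** In the opposite Heisenberg chart at the base point, the points g oo with g of
    coordinates (a, z, t) lie on one curve when only a varies; the dilation factor
    1/a is the parameter of the curve. *)
Lemma opp_curve_coset g a z t : ANform g a z t -> t != 0 ->
  forall zt' : hpt ((a%:C%C)^-1 *: ((2 * t)^-1 *: z)) ((a%:C%C)^-1 ^+ 2 * (4 * t)^-1),
  coset_of P (opp_curve zt') = left_translate g inf.
Proof.
move=> [a0 zt gE] t0 zt'; rewrite translateE; apply/coset_eq.
have a0' : (a%:C%C : C) != 0 by rewrite rc_eq0 gt_eqF.
have tn : (2 * t * a%:C%C) != 0 :> C by rewrite !mulf_neq0// pnatr_eq0.
exists (((2 * t * a%:C%C) * 'i)^-1).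
  by rewrite invr_eq0 mulf_neq0 ?imag_neq0.
rewrite bvecM bvec_to_inf actZ scalerA invM_imag actE gE (an_eM _ zt).
rewrite /bvec /opp_curve twistK actE /= nvP; last by case: zt'.
exact: inversion_line.
Qed.

Lemma hpt_Re (z : vec) (t : C) (p : R) : hpt z t -> hdot z z = p%:C%C -> complex.Re t = - p / 2.
Proof.
move=> [_ e] zp; have := congr1 (@complex.Re R) e; rewrite zp.
case: t {e} => a b /= e; have {}e : 2 * a = - p.
  by apply/eqP; rewrite -subr_eq0 -[X in _ == X]e; apply/eqP; ring.
by rewrite -e; field.
Qed.

(** Velocity and second order term, at the identity, of the curves
    [opp_curve]. *)
Definition opp_dir (z : vec) : mat := SUval x *m (J *m heisY z *m J) *m SUval x^-1%g.
Definition opp_dir2 (t : C) : mat := SUval x *m (J *m heisZ n t *m J) *m SUval x^-1%g.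

Lemma opp_dir_lin (a b : R) z z' :
  opp_dir (a%:C%C *: z + b%:C%C *: z') = a%:C%C *: opp_dir z + b%:C%C *: opp_dir z'.
Proof.
exact: (oppY_lin _ _ _ _ (conj_real a) (conj_real b)).
Qed.

Lemma opp_curve_line z t (th : R) (zt' : hpt (th%:C%C *: z) (th%:C%C ^+ 2 * t)) :
  SUval (opp_curve zt') = line (line 1%:M (opp_dir z) th) (opp_dir2 t) (th ^+ 2).
Proof.
rewrite /opp_curve SUval_twist /line rcXE.
apply: nv_curve; last exact: conj_real.
by rewrite -SUvalM mulgV.
Qed.

End NonConj.

(** * The differential of a conjugacy at the base point *)

Section Contradiction.
Variables (R : realType) (n : nat) (x : SU R n).
Local Notation C := (R[i] : numClosedFieldType).
Local Notation vec := 'cV[C]_n.+2.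
Local Notation G := (SU R n).
Local Notation eP := (eP C n).
Local Notation eM := (eM C n).
Local Notation mat := (mat R n).
Local Notation K := (conj_set x (@K0 R n)).
Local Notation A := (conj_set x (@A0 R n)).
Local Notation N := (conj_set x (@N0 R n)).
Local Notation P := (minimal_parabolic K A N).
Local Notation ANform := (ANform x).
Local Notation org := (org x).
Local Notation inf := (inf x).

Variables (z : vec) (zp : perp z) (z0 : z != 0).
Local Notation u := ('i *: z : vec).
Variables (e : R) (e0 : e != 0).
Local Notation w := (shear u e%:C%C z).

Lemma perp_i : perp u.
Proof. by case: zp => a b; rewrite /perp !hdotlin a b mulr0. Qed.

Variables (S : set G) (h h' : quotient P -> quotient P).
Hypotheses (hK : cancel h h') (h'K : cancel h' h) (hs : smooth_map h).
Hypothesis hS : forall g, S g -> rho u e g = h \o left_translate g \o h'.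
Variables (b : G) (al : R).
Hypotheses (Sb : S b) (bE : ANform b al 0 0) (al1 : 1 < al).
Hypothesis bS : forall g k, S g -> S (b ^+ k * g)%g.

Lemma h_equiv g X : S g -> left_translate (beta x u e g) (h X) = h (left_translate g X).
Proof. by move=> Sg; rewrite -[LHS]/(rho u e g (h X)) hS//= hK. Qed.

(** beta_e fixes A, so h commutes with b itself. *)
Lemma h_fix_b X : left_translate b X = X -> left_translate b (h X) = h X.
Proof.
move=> bX; rewrite -{2}bX -(h_equiv X Sb); congr (left_translate _ _).
apply: (ANform_inj bE); have := betaE perp_i e bE.
by rewrite shear0 shear_t0.
Qed.

Variables (t s : C) (s0 : s != 0) (sr : s^* = - s).
Hypothesis zS : forall k : nat, exists2 g, S g & ANform g 1 z (t + k%:R * s).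

Lemma sqr_norm_ex : exists2 p : R, 0 < p & hdot z z = p%:C%C.
Proof.
exists (complex.Re (hdot z z)); last by rewrite RRe_real// realE perp_ge0.
rewrite -(ltcR 0) RRe_real ?realE ?perp_ge0//.
by rewrite lt_def perp_ge0// perp_eq0// z0.
Qed.

Lemma w_norm (p : R) : hdot z z = p%:C%C ->
  hdot w w = ((1 + 4 * e ^+ 2 * p ^+ 2) * p)%:C%C.
Proof.
move=> zz; rewrite (hdot_shear_self _ (conj_real e)) zz !rcE.
ring.
Qed.

Lemma w_neq0 : w != 0.
Proof.
have [p p0 zz] := sqr_norm_ex; have ww := w_norm zz.
apply/eqP => w0; move: ww; rewrite w0 hdot0r => /esym/eqP; rewrite rc_eq0.
rewrite mulf_eq0 (gt_eqF p0) orbF gt_eqF// ltr_wpDr//.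
by apply: mulr_ge0; rewrite ?sqr_ge0//; apply: mulr_ge0; rewrite ?sqr_ge0.
Qed.

(** h maps fixed points of b to fixed points of b; the image of the base point is
    fixed by the deformed translations, and those move the other point. *)
Lemma h_org : h org = org.
Proof.
have [//|hi] := A_fixed bE al1 (h_fix_b (AN_org bE)).
have [g Sg gE] := zS 0; have := h_equiv org Sg; rewrite (AN_org gE) hi.
by move=> /(N_inf_moved (betaE perp_i e gE) w_neq0).
Qed.

Lemma h_inf : h inf = inf.
Proof.
have [hi|//] := A_fixed bE al1 (h_fix_b (A_inf bE)).
by exfalso; apply: (@org_neq_inf R n x); rewrite -(hK org) -(hK inf) h_org hi.
Qed.

Variable (U : set mat) (F : mat -> R).
Hypotheses (oU : open U) (GU : range (@SUval R n) `<=` U) (sF : smooth_on U F).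
Hypothesis FE : forall g, F (SUval g) = @testf R n x w (h (coset_of P g)).

Lemma F_at1 : F 1%:M = 0.
Proof.
rewrite -[1%:M](SUval1 R n) FE -/org h_org testfE bvec1 /test_vec /rdot_quo.
rewrite (perpC (shear_perp _ perp_i zp)).1.
by rewrite /rdot /= !mul0r addr0 mul0r.
Qed.

Lemma U_at1 : U 1%:M.
Proof. by apply: GU; exists 1%g. Qed.

(** The curve reaches b^m g oo at th = al^-m, and h sends this point to
    b^m beta_e(g) oo, where the test function is explicit. *)
Lemma F_curve (p q : R) k m (th : R) tau
    (zt' : hpt (th%:C%C *: ((2 * tau)^-1 *: z)) (th%:C%C ^+ 2 * (4 * tau)^-1)) :
  0 < p -> q != 0 ->
  hdot z z = p%:C%C -> hdot w w = q%:C%C -> tau = t + k%:R * s -> th = (al ^+ m)^-1 ->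
  F (SUval (opp_curve x zt')) / th =
  - 4 * q ^+ 2 / (4 * q ^+ 2 + 16 * complex.Im tau ^+ 2 + 4 * th ^+ 4).
Proof.
move=> p0 q0 zz ww tauE thE; have [g Sg gE] := zS k; rewrite -tauE in gE.
have gmE := ANform_AN (ANform_AX m bE) gE; have [a0 zt _] := gmE.
have tr := hpt_Re zt zz.
have t0 : tau != 0.
  apply/eqP => t0; move: tr; rewrite t0 /= => /esym/eqP.
  by rewrite mulf_eq0 oppr_eq0 (gt_eqF p0) invr_eq0 pnatr_eq0.
have thC : th%:C%C = ((al ^+ m)%:C%C)^-1 :> C by rewrite thE rcVE.
have th0 : th != 0 by rewrite thE invr_eq0 gt_eqF.
have -> : F (SUval (opp_curve x zt')) =
    @testf R n x w (left_translate (beta x u e (b ^+ m * g)%g) inf).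
  rewrite FE -[in RHS]h_inf (h_equiv _ (bS m Sg)); congr (testf _ (h _)).
  move: zt'; rewrite thC => zt'; exact: opp_curve_coset gmE t0 zt'.
have := betaE perp_i e gmE; set t' := shear_t _ _ _ _; move=> bgE.
have [_ wt' be] := bgE; have t'r := hpt_Re wt' ww.
have t'i : complex.Im t' = complex.Im tau.
  rewrite /t' /shear_t zz ww Im_add Im_mul.
  by rewrite -rcNE -rcDE -[2]rcnE -rcVE /= mulr0 mul0r !addr0.
rewrite -t'i translateE testfE bvecM bvec_to_inf actZ test_vecZ ?imag_neq0//.
rewrite actE be /test_vec.
have [-> -> ->] := hdot_an_eM (al ^+ m)%:C%C wt'.
rewrite ww -thC (_ : (al ^+ m)%:C%C = (th^-1)%:C%C); last by rewrite thE invrK.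
by rewrite (rdot_quo_orbit th0 q0 t'r erefl).
Qed.

(** The limit m -> oo of [F_curve] computes the derivative of F in the direction
    z / 2 t_k, which is expanded by real linearity on the directions z and i z. *)
Lemma derivative_eq (p q : R) k : 0 < p -> q != 0 ->
  hdot z z = p%:C%C -> hdot w w = q%:C%C ->
  let sk := complex.Im t + k%:R * complex.Im s in
  (- p / (p ^+ 2 + 4 * sk ^+ 2)) * dir_derive (opp_dir x z) F 1%:M +
  (- 2 * sk / (p ^+ 2 + 4 * sk ^+ 2)) * dir_derive (opp_dir x u) F 1%:M =
  - 4 * q ^+ 2 / (4 * q ^+ 2 + 16 * sk ^+ 2).
Proof.
move=> p0 q0 zz ww sk; have [g Sg gE] := zS k.
pose tau := t + k%:R * s; rewrite -/tau in gE; have [_ zt _] := gE.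
have tr := hpt_Re zt zz.
have ti : complex.Im tau = sk.
  by rewrite /tau Im_add Im_mul -[k%:R]rcnE /= mul0r addr0.
have t0 : tau != 0.
  apply/eqP => t0; move: tr; rewrite t0 /= => /esym/eqP.
  by rewrite mulf_eq0 oppr_eq0 (gt_eqF p0) invr_eq0 pnatr_eq0.
pose th m : R := (al ^+ m)^-1.
have al0 : 0 < al by apply: lt_trans al1.
have th0 m : 0 < th m by rewrite invr_gt0 exprn_gt0.
have thc : th m @[m --> \oo] --> (0 : R).
  rewrite /th; under eq_fun do rewrite -exprVn; apply: cvg_expr.
  by rewrite ger0_norm ?invr_ge0 ?ltW// invf_lt1.
have c := @smooth_curve R n U F 1%:M (opp_dir x ((2 * tau)^-1 *: z))
  (opp_dir2 x (4 * tau)^-1) th oU sF U_at1 th0 thc.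
have zt' m : hpt ((th m)%:C%C *: ((2 * tau)^-1 *: z)) ((th m)%:C%C ^+ 2 * (4 * tau)^-1).
  by apply: hptZ; [exact: conj_real|exact: hpt_inversion].
have {}c : - 4 * q ^+ 2 / (4 * q ^+ 2 + 16 * sk ^+ 2 + 4 * th m ^+ 4) @[m --> \oo]
    --> dir_derive (opp_dir x ((2 * tau)^-1 *: z)) F 1%:M.
  apply: (cvg_trans _ c); apply: near_eq_cvg; apply: nearW => m.
  rewrite F_at1 subr0 -(opp_curve_line x (zt' m)) -ti.
  exact: (F_curve (zt' m) p0 q0 zz ww erefl erefl).
have D0 : 4 * q ^+ 2 + 16 * sk ^+ 2 != 0.
  rewrite gt_eqF// ltr_pwDl//; last by rewrite mulr_ge0 ?ler0n ?sqr_ge0.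
  by rewrite pmulr_rgt0// exprn_even_gt0.
have c2 : - 4 * q ^+ 2 / (4 * q ^+ 2 + 16 * sk ^+ 2 + 4 * th m ^+ 4) @[m --> \oo]
    --> - 4 * q ^+ 2 / (4 * q ^+ 2 + 16 * sk ^+ 2).
  apply: cvgM; first exact: cvg_cst.
  apply: cvgV => //; rewrite -[X in _ --> X]addr0.
  apply: cvgD; first exact: cvg_cst.
  rewrite -[X in _ --> X](mulr0 4); apply: cvgM; first exact: cvg_cst.
  rewrite -[X in _ --> X](expr0n R 4).
  exact: (cvg_comp _ _ thc (@exprn_continuous R 4 0)).
have <- := cvg_unique _ c c2; last exact: norm_hausdorff.
rewrite (inv_coords (lt0r_neq0 p0) tr ti) scalerDl -scalerA.
rewrite (complexiE R) opp_dir_lin.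
rewrite (@dir_deriveD R n U F 1%:M _ _ oU sF U_at1).
by congr (_ + _); apply/esym;
  [exact (@dir_deriveZ R n U F 1%:M (opp_dir x z) _ sF U_at1)
  |exact (@dir_deriveZ R n U F 1%:M (opp_dir x u) _ sF U_at1)].
Qed.

Lemma not_smoothly_conjugate : False.
Proof.
have [p p0 zz] := sqr_norm_ex; have ww := w_norm zz.
set q := (_ * p) in ww.
have c0 : 0 < 4 * e ^+ 2 * p ^+ 2.
  by rewrite mulr_gt0 ?exprn_gt0// mulr_gt0// exprn_even_gt0.
have pq : p < q by rewrite /q ltr_pMl// ltrDl.
have q0 : q != 0 by rewrite gt_eqF// (lt_trans p0).
have d0 : complex.Im s != 0.
  apply: contraNneq s0; case: (s) sr => a1 a2 /= [] e1 a20; rewrite a20.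
  by have -> : a1 = 0 by lra.
have [Dz [Du E]] : exists Dz Du : R, forall k : nat,
    let sk := complex.Im t + k%:R * complex.Im s in
    (- p / (p ^+ 2 + 4 * sk ^+ 2)) * Dz + (- 2 * sk / (p ^+ 2 + 4 * sk ^+ 2)) * Du =
    - 4 * q ^+ 2 / (4 * q ^+ 2 + 16 * sk ^+ 2).
  exists (dir_derive (opp_dir x z) F 1%:M), (dir_derive (opp_dir x u) F 1%:M) => k.
  exact: (derivative_eq k p0 q0 zz ww).
have := rational_rigid d0 p0 q0 E; apply/eqP.
by rewrite eqrXn2 ?ltW// ?(lt_trans p0)// lt_eqF.
Qed.

End Contradiction.

Lemma near0_nonzero (R : realType) (Q : set R) :
  (\forall e \near (0 : R), Q e) -> exists2 e : R, e != 0 & Q e.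
Proof.
move=> Q0; suff [e [Qe en]] : exists e, (Q `&` [set y : R | y != 0]) e by exists e.
apply: (@filter_ex R ((0 : R)^') _); apply: filterI.
  exact: (@nbhs_dnbhs R (0 : R) _ Q0).
exact: (@nbhs_dnbhs_neq R 0).
Qed.

Theorem proposition8p4 (R : realType) (n : nat) (K A N Gamma : set (SU R n)) :
  (2 <= n)%N ->
  Iwasawa K A N ->
  standard_subgroup A N Gamma ->
  ~ C2_locally_rigid (minimal_parabolic K A N) K Gamma.
Proof.
move=> n2 [x [-> -> ->]] [L [a [latL Aa a1 _ GE]]] [S [T [eps [[fS SG fT Ts eps0] rigid]]]].
have n0 : (0 < n)%N by apply: leq_trans n2.
have sG : subgroup Gamma by rewrite GE; exact: generated_subgroup.
have LG : L `<=` Gamma by move=> g Lg; rewrite GE; apply: sub_generated; left.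
have aG : Gamma a by rewrite GE; apply: sub_generated; right.
have GAN : Gamma `<=` AN x.
  rewrite GE => g; apply; first exact: AN_subgroup.
  move=> {}g [Lg|->].
    by have [_ LN _] := latL; have [z [t gE]] := ANform_N (LN _ Lg); exists 1, z, t.
  by have [al aE] := ANform_A Aa; exists al, 0, 0.
have [z [t [s [zp z0 s0 sr zS]]]] := lattice_fibre n0 latL sG LG.
have [b [al [Gb al1 bE]]] := expanding_A Aa a1 sG aG.
have up := perp_i zp.
have close := rho_close up fS fT (subset_trans SG GAN) Ts eps0.
have [e e0 /rigid rg] := near0_nonzero close.
have [h [h' [hK h'K hs _ hG]]] := rg (rho_action up e GAN).
have [U [F [oU GU sF FE]]] := hs _ (@testf_smooth R n x (shear ('i *: z) e%:C%C z)).
have bS g k : Gamma g -> Gamma (b ^+ k * g)%g.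
  move=> Gg; apply: subgroupM => //; elim: k => [|k IH]; first exact: sG.1.
  by rewrite expgS; exact: subgroupM.
exact: (not_smoothly_conjugate zp z0 e0 hK hG Gb bE al1 bS s0 sr zS oU GU sF FE).
Qed.
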